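(* In the setting described in the context, for every $x\in\mathcal X$ and $0<\delta\le\bar\delta$ the following hold. (1) $\partial^cQ_x(x)=\partial^c\tilde\varphi(x)$. (2) $g_\delta(x)=\nabla Q_{x,\delta}(x)$. (3) $g_\delta(x)\in\partial_\delta Q_x(x)$, where $\partial_\delta Q_x(x)$ is the Goldstein $\delta$-subdifferential of $Q_x$; moreover $$\partial_\delta Q_x(x)=d_x(x)+\operatorname{conv}\Big(\bigcup_{\|s-x\|\le\delta}\{V^\top d_y(x):V\in\mathrm J^cy(s)\}\Big).$$
   Context: Norms: Euclidean for vectors, the induced operator (spectral) norm for matrices. $\mathbb B_n$ is the closed unit ball of $\mathbb R^n$. Response mapping. $\mathcal X\subset\mathbb R^n$ is nonempty and compact. $\mathcal N$ is an open set containing $\mathcal X$. For each $x\in\mathcal N$ the lower-level solution set $S(x)=\arg\min_{\xi\in\mathcal Y}g(x,\xi)$ (with $\mathcal Y\subseteq\mathbb R^m$) is a singleton $\{y(x)\}$, and the response map $y:\mathcal N\to\mathbb R^m$ is locally Lipschitz. A number $\bar\delta>0$ with $\mathcal X_{\bar\delta}:=\mathcal X+\bar\delta\mathbb B_n\subseteq\mathcal N$ is fixed; on $\mathcal X_{\bar\delta}$, $y$ is bounded in norm by $Y_{\max}$ and $L_y$-Lipschitz. Smoothing. For $0<\delta\le\bar\delta$, $y_\delta(u)=\mathbb E_{\xi\sim\mathrm{Unif}(\mathbb B_n)}[y(u+\delta\xi)]$ (defined for $u$ in a neighborhood of $\mathcal X$, where it is continuously differentiable), with Jacobian $\mathrm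 Jy_\delta(u)\in\mathbb R^{m\times n}$. Upper-level objective. $\varphi\in C^1(\mathbb R^n\times\mathbb R^m)$ with partial gradients $\nabla_1\varphi$ (in $x$) and $\nabla_2\varphi$ (in $y$). There are finite constants $L_{1x},L_{1y},L_{2x},L_{2y},M_y>0$ such that for all $(x,y),(x',y')\in W$: $\|\nabla_1\varphi(x,y)-\nabla_1\varphi(x',y')\|\le L_{1x}\|x-x'\|+L_{1y}\|y-y'\|$, $\|\nabla_2\varphi(x,y)-\nabla_2\varphi(x',y')\|\le L_{2x}\|x-x'\|+L_{2y}\|y-y'\|$, $\|\nabla_2\varphi(x,y)\|\le M_y$. Here $W\subseteq\mathbb R^n\times\mathbb R^m$ is a set containing all pairs $(x,y(x))$ and $(x,y_\delta(x))$ with $x\in\mathcal X$, $0<\delta\le\bar\delta$. Reduced hyperobjective: $\tilde\varphi(x)=\varphi(x,y(x))$ on $\mathcal N$. Notation: $d_x(x)=\nabla_1\varphi(x,y(x))$, $d_y(x)=\nabla_2\varphi(x,y(x))$. Bi-ZOL approximate hypergradient: $g_\delta(x)=d_x(x)+\mathrm Jy_\delta(x)^\top d_y(x)$. Anchored models, for a fixed anchor $x\in\mathcal X$, as functions of $u$: $Q_x(u)=\varphi(x,y(x))+\langle d_x(x),u-x\rangle+\langle d_y(x),y(u)-y(x)\rangle$ (for $u\in\mathcal N$), and $Q_{x,\delta}(u)=\varphi(x,y(x))+\langle d_x(x),u-x\rangle+\langle d_y(x),y_\delta(u)-y(x)\rangle$. Clarke and Goldstein objects. For a locally Lipschitz map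 $F:\mathcal O\to\mathbb R^m$ on an open set $\mathcal O\subseteq\mathbb R^n$, differentiable exactly on the full-measure set $\Omega_F$, $\mathrm J^cF(x)=\operatorname{conv}\{\lim_k \mathrm JF(x^k): x^k\to x,\ x^k\in\Omega_F\}$; for scalar $f$, $\partial^cf(x)=\operatorname{conv}\{\lim_k\nabla f(x^k):x^k\to x,\ x^k\in\Omega_f\}$. The Goldstein $\delta$-subdifferential of $f:\mathcal O\to\mathbb R$ is $\partial_\delta f(x)=\operatorname{conv}\big(\bigcup_{z\in\mathcal O,\ \|z-x\|\le\delta}\partial^cf(z)\big)$. *)

(* Defs.v *)
(* Vectors are row vectors; the topology (hence limits and
   Frechet differentiability) is the library one, which in finite dimension is
   the Euclidean one, while every metric quantity uses the Euclidean norm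
   [enorm] below and not the library's sup norm on matrices. *)
From HB Require Import structures.
From mathcomp Require Import all_boot all_order all_algebra.
From mathcomp Require Import all_classical all_reals all_analysis.

Set Implicit Arguments.
Unset Strict Implicit.
Unset Printing Implicit Defensive.

Import Order.TTheory GRing.Theory Num.Theory.
Import numFieldNormedType.Exports.

Local Open Scope classical_set_scope.
Local Open Scope ring_scope.

Section euclidean.
Context {R : realType}.

Definition dotp n (u v : 'rV[R]_n) : R := \sum_(i < n) u 0 i * v 0 i.

Definition enorm n (u : 'rV[R]_n) : R := Num.sqrt (dotp u u).

Definition eball n (x : 'rV[R]_n) (r : R) : set 'rV[R]_n :=
  [set z | enorm (z - x) <= r].

(* Minkowski sum of [A] with the closed ball of radius [r] centred at 0 *)
Definition enlarge n (A : set 'rV[R]_n) (r : R) : set 'rV[R]_n :=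
  [set u | exists2 x, A x & exists2 b, eball 0 1 b & u = x + r *: b].

Definition elipschitz n m (L : R) (A : set 'rV[R]_n)
    (f : 'rV[R]_n -> 'rV[R]_m) : Prop :=
  forall u v, A u -> A v -> enorm (f u - f v) <= L * enorm (u - v).

Definition locally_lipschitz n m (O : set 'rV[R]_n)
    (f : 'rV[R]_n -> 'rV[R]_m) : Prop :=
  forall x, O x ->
    exists L : R, exists2 U, nbhs x U & elipschitz L (U `&` O) f.

End euclidean.

Definition argmin {R : realType} {T : Type} (A : set T) (f : T -> R) : set T :=
  [set z | A z /\ forall z', A z' -> f z <= f z'].

Definition conv_hull {R : realType} {V : lmodType R} (A : set V) : set V :=
  smallest (@convex_set R V) A.

(* Lebesgue measure on R^n, carried by the library's measurable space of
   n-tuples: Dirac mass for n = 0, then iterated product measure. *)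
Section lebesgue_tuple_step.
Context {R : realType} (n : nat).
Local Notation RT := (measurableTypeR R).
Variable mu : {sigma_finite_measure set (n.-tuple RT) -> \bar R}.

Definition tcons (p : RT * n.-tuple RT) : n.+1.-tuple RT :=
  [tuple of p.1 :: p.2].

Lemma measurable_tcons : measurable_fun [set: RT * n.-tuple RT] tcons.
Proof. exact: (measurable_cons measurable_fst measurable_snd). Qed.

Definition lebesgue_step : set (n.+1.-tuple RT) -> \bar R :=
  pushforward (@lebesgue_measure R \x mu)%E tcons.

Let measurable_preimage_tcons A : measurable A -> measurable (tcons @^-1` A).
Proof. by move=> mA; rewrite -[X in measurable X]setTI; exact: measurable_tcons. Qed.

Let lebesgue_step0 : lebesgue_step set0 = 0%E.
Proof. by rewrite /lebesgue_step /pushforward preimage_set0 measure0. Qed.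

Let lebesgue_step_ge0 A : (0 <= lebesgue_step A)%E.
Proof. by rewrite /lebesgue_step /pushforward measure_ge0. Qed.

Let lebesgue_step_sigma_additive : semi_sigma_additive lebesgue_step.
Proof.
move=> F mF tF mUF; rewrite /lebesgue_step /pushforward preimage_bigcup.
apply: measure_semi_sigma_additive.
- by move=> i; exact: measurable_preimage_tcons.
- apply/trivIsetP => /= i j _ _ ij; rewrite -preimage_setI.
  by move/trivIsetP : tF => /(_ _ _ _ _ ij) ->//; rewrite preimage_set0.
- by rewrite -preimage_bigcup; exact: measurable_preimage_tcons.
Qed.

HB.instance Definition _ := isMeasure.Build _ _ _ lebesgue_step
  lebesgue_step0 lebesgue_step_ge0 lebesgue_step_sigma_additive.

Let lebesgue_step_sigma_finite : sigma_finite setT lebesgue_step.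
Proof.
have [F FT Foo] : sigma_finite setT (@lebesgue_measure R \x mu)%E.
  have /sigma_finiteP[F [TF ndF Foo]] := sigma_finiteT (@lebesgue_measure R).
  have /sigma_finiteP[G [TG ndG Goo]] := sigma_finiteT mu.
  exists (fun k => F k `*` G k).
    rewrite -setXTT TF TG predeqE => -[a v]; split.
      move=> [/= [i _ Fia] [k _ Gkv]]; exists (maxn i k) => //; split.
        by move: a Fia; exact/subsetPset/ndF/leq_maxl.
      by move: v Gkv; exact/subsetPset/ndG/leq_maxr.
    by move=> [k _ []/= ? ?]; split; exists k.
  move=> k; have [? ?] := Foo k; have [? ?] := Goo k.
  split; first exact: measurableX.
  by rewrite product_measure1E// lte_mul_pinfty// ge0_fin_numE.
pose g (v : n.+1.-tuple RT) : RT * n.-tuple RT := (thead v, [tuple of behead v]).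
have mg : measurable_fun [set: n.+1.-tuple RT] g.
  apply/measurable_fun_pairP; split; last exact: measurable_behead.
  exact: measurable_tnth.
have tconsK : cancel tcons g.
  case=> a v; rewrite /g /tcons/= theadE; congr pair.
  exact: val_inj.
exists (fun k => g @^-1` F k).
  by rewrite -preimage_bigcup -FT preimage_setT.
move=> k; have [mF Fk] := Foo k; split.
  by rewrite -[X in measurable X]setTI; exact: mg.
rewrite /lebesgue_step /pushforward -comp_preimage (_ : g \o tcons = id)//.
exact/funext.
Qed.

HB.instance Definition _ := Measure_isSigmaFinite.Build _ _ _ lebesgue_step
  lebesgue_step_sigma_finite.

End lebesgue_tuple_step.

Fixpoint lebesgue_tuple {R : realType} (n : nat) :
    {sigma_finite_measure set (n.-tuple (measurableTypeR R)) -> \bar R} :=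
  match n with
  | 0%N => \d_([tuple] : 0.-tuple (measurableTypeR R))
  | n'.+1 => lebesgue_step (lebesgue_tuple n')
  end.

Section smoothing.
Context {R : realType}.

Definition row_of_tuple n (t : n.-tuple R) : 'rV[R]_n := \row_i tnth t i.

Definition unit_tball n : set (n.-tuple (measurableTypeR R)) :=
  [set t | eball 0 1 (row_of_tuple t)].

(* expectation of [f] under the uniform distribution on the unit ball *)
Definition unif_ball_mean n (f : 'rV[R]_n -> R) : R :=
  (fine (lebesgue_tuple n (@unit_tball n)))^-1 *
  \int[lebesgue_tuple n]_(t in @unit_tball n) f (row_of_tuple t).

Definition smoothing n m (y : 'rV[R]_n -> 'rV[R]_m) (delta : R)
    (u : 'rV[R]_n) : 'rV[R]_m :=
  \row_j unif_ball_mean (fun xi => y (u + delta *: xi) 0 j).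

End smoothing.

Section derivatives.
Context {R : realType}.

(* The library's ['J F x] acts on row vectors from the right; [Jac] is its
   transpose, the usual m x n Jacobian.  Accordingly the row vector
   representing V^T d, for V : 'M_(m, n), is [d *m V]. *)
Definition Jac n m (F : 'rV[R]_n -> 'rV[R]_m) (x : 'rV[R]_n) : 'M[R]_(m, n) :=
  ('J F x)^T.

Definition grad n (f : 'rV[R]_n -> R) (x : 'rV[R]_n) : 'rV[R]_n :=
  \row_i 'd (f : 'rV[R]_n -> R^o) x (delta_mx 0 i).

Definition grad1 n m (phi : 'rV[R]_n * 'rV[R]_m -> R) (x : 'rV[R]_n)
    (y : 'rV[R]_m) : 'rV[R]_n := grad (fun x' => phi (x', y)) x.

Definition grad2 n m (phi : 'rV[R]_n * 'rV[R]_m -> R) (x : 'rV[R]_n)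
    (y : 'rV[R]_m) : 'rV[R]_m := grad (fun y' => phi (x, y')) y.

(* In finite dimension, continuity of all directional values of the
   differential is continuity of the differential. *)
Definition C1 (V : normedModType R) (f : V -> R) : Prop :=
  (forall p, differentiable (f : V -> R^o) p) /\
  (forall v, continuous (fun p => 'd (f : V -> R^o) p v : R^o)).

(* Functions are total; [O] is the open set on which [F] is considered. *)
Definition clarke_jac n m (O : set 'rV[R]_n) (F : 'rV[R]_n -> 'rV[R]_m)
    (x : 'rV[R]_n) : set 'M[R]_(m, n) :=
  conv_hull [set V : 'M[R]_(m, n) | exists xk : nat -> 'rV[R]_n,
    [/\ forall k, O (xk k) /\ differentiable F (xk k),
        xk @ \oo --> x & (fun k => Jac F (xk k)) @ \oo --> V]].

Definition clarke_subdiff n (O : set 'rV[R]_n) (f : 'rV[R]_n -> R)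
    (x : 'rV[R]_n) : set 'rV[R]_n :=
  conv_hull [set v : 'rV[R]_n | exists xk : nat -> 'rV[R]_n,
    [/\ forall k, O (xk k) /\ differentiable (f : 'rV[R]_n -> R^o) (xk k),
        xk @ \oo --> x & (fun k => grad f (xk k)) @ \oo --> v]].

Definition goldstein n (O : set 'rV[R]_n) (f : 'rV[R]_n -> R) (delta : R)
    (x : 'rV[R]_n) : set 'rV[R]_n :=
  conv_hull (\bigcup_(z in O `&` eball x delta) clarke_subdiff O f z).

End derivatives.

Section bizol.
Context {R : realType} (n m : nat).
Variables (phi : 'rV[R]_n * 'rV[R]_m -> R) (y : 'rV[R]_n -> 'rV[R]_m).

Definition hyperobjective (x : 'rV[R]_n) : R := phi (x, y x).

Definition d_x (x : 'rV[R]_n) : 'rV[R]_n := grad1 phi x (y x).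

Definition d_y (x : 'rV[R]_n) : 'rV[R]_m := grad2 phi x (y x).

Definition hypergradient (delta : R) (x : 'rV[R]_n) : 'rV[R]_n :=
  d_x x + d_y x *m Jac (smoothing y delta) x.

Definition anchored (x u : 'rV[R]_n) : R :=
  phi (x, y x) + dotp (d_x x) (u - x) + dotp (d_y x) (y u - y x).

Definition anchored_smooth (delta : R) (x u : 'rV[R]_n) : R :=
  phi (x, y x) + dotp (d_x x) (u - x)
  + dotp (d_y x) (smoothing y delta u - y x).

End bizol.

(* Main.v *)
Require Import Defs.
From HB Require Import structures.
From mathcomp Require Import all_boot all_order all_algebra.
From mathcomp Require Import all_classical all_reals all_analysis.
From mathcomp Require Import measurable_realfun ring lra.

Set Implicit Arguments.
Unset Strict Implicit.
Unset Printing Implicit Defensive.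

Import Order.TTheory GRing.Theory Num.Theory.
Import numFieldNormedType.Exports.

Local Open Scope classical_set_scope.
Local Open Scope ring_scope.

(* Around the ball of radius delta about x, y is replaced by a globally Lipschitz
   extension.  Rademacher's theorem (Fubini, with one-dimensional density points
   gluing the slicewise differentials) and dominated convergence show that the
   smoothing is differentiable and that its Jacobian is the mean of Jac y over
   the ball.  Hence, in every direction, it is dominated by Jac y at some
   point of the ball, and so by a limit of Jacobians; these limits form a compact
   set over the ball, so separation puts the hypergradient in the Goldstein set.
   Near a point z, both the anchored model and, at z = x, the hyperobjective have
   increments <b, du> + <w, dy> up to o(|du|), which bounds their limiting
   gradients by increments of <w, y>; the mean value theorem, applied to the
   smoothing of y, turns such increments into Jacobians of y at nearby points.
   This avoids the fact that the Clarke Jacobian ignores null sets, which would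
   otherwise be needed because <w, y> may be differentiable where y is not. *)

(** * Rademacher's theorem *)

(** All the sets in the conclusion pass through one normal form, the convex hull of the vectors
    [b + w *m V], where [b] and [w] are [d_x] and [d_y] at the anchor and [V] is a limit of
    Jacobians of the extension [yt] over a compact set: the singleton of [x] for (1), the ball for
    (3). The two sides of (1) are never compared with each other; both are shown to be the same
    hull. One inclusion is a chain rule at points where [y] is differentiable. The other is
    separation, for which a bound with an arbitrarily small error in each direction suffices:
    compactness removes the error and makes the hull closed, so that no closure enters the
    equalities. The extension has to agree with [y] on a ball of radius [delta + eta], since the
    smoothing on a neighbourhood of [x] and the limits of Jacobians at boundary points of the ball
    see points outside the ball. A globally Lipschitz [yt] then lets slices, averages and increments
    be taken without tracking domains. *)

Section lipschitz_ae_derivable.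
Context {R : realType}.
Local Notation mu := (@lebesgue_measure R).

Definition rlipschitz (L : R) (g : R -> R) :=
  forall x y, `|g x - g y| <= L * `|x - y|.

Lemma rlipschitz_continuous L g : rlipschitz L g -> continuous g.
Proof.
move=> gL x; apply/cvgrPdist_le => e e0.
have L1 : 0 < `|L| + 1 by rewrite ltr_wpDl.
near=> y.
rewrite (le_trans (gL _ _))//.
rewrite (@le_trans _ _ ((`|L| + 1) * `|x - y|))//.
  by rewrite ler_wpM2r// (le_trans (ler_norm _))// lerDl.
rewrite -ler_pdivlMl//.
by near: y; apply: cvgr_dist_le => //; rewrite mulr_gt0// invr_gt0.
Unshelve. all: by end_near. Qed.

Lemma near_lincomb_derivable (f g : R -> R) (a b c x : R) :
  (\forall t \near x, a * f t + b * t + c = g t) ->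
  derivable f x 1 -> derivable g x 1.
Proof.
move=> fg df.
have d1 : derivable (cst a * f) x 1 by exact: derivableM (derivable_cst _ _ _) df.
have d2 : derivable (cst b * id) x 1.
  by apply: derivableM; [exact: derivable_cst|exact: derivable_id].
exact: near_eq_derivable fg (derivableD (derivableD d1 d2) (derivable_cst c x 1)).
Qed.

Section half_lipschitz.
Variable g : R -> R.
Hypothesis gL : rlipschitz 2^-1 g.

(* Both [x / 2 + g] and [x / 2 - g] are nondecreasing, and their Stieltjes measures
   add up to Lebesgue measure, hence have densities with respect to it. *)
Let incr (s : bool) x := (if s then 1 else -1) * g x + 2^-1 * x.

Let incr_nd s : nondecreasing (incr s).
Proof.
move=> x y xy; rewrite /incr -subr_ge0.
have := gL y x; rewrite (ger0_norm (_ : 0 <= y - x)) ?subr_ge0//.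
by rewrite ler_norml => /andP[? ?]; case: s; lra.
Qed.

Let incr_rc s : right_continuous (incr s).
Proof.
move=> x; apply: cvg_at_right_filter.
have cg : g t @[t --> x] --> g x by exact: rlipschitz_continuous gL x.
by apply: cvgD; apply: cvgM => //; exact: cvg_cst.
Qed.

HB.instance Definition _ s :=
  isCumulative.Build R _ R (incr s) (@incr_nd s) (@incr_rc s).

Let nu s : {measure set (measurableTypeR R) -> \bar R} :=
  lebesgue_stieltjes_measure (incr s).

Let nu_itv s a b : a <= b -> nu s `]a, b]%classic = (incr s b - incr s a)%:E.
Proof.
move=> ab; rewrite /nu/= /lebesgue_stieltjes_measure /measure_extension/=.
by rewrite measurable_mu_extE/= ?wlength_itv_bnd//; exact: is_ocitv.
Qed.

Let nuD A : measurable A -> mu A = measure_add (nu true) (nu false) A.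
Proof.
apply: lebesgue_measure_unique => _ [[a b] _ <-] /=.
rewrite [RHS]measure_addE/=; have [ab|ba] := leP a b; last first.
  by rewrite set_itv_ge ?measure0 ?adde0// -leNgt bnd_simp ltW.
rewrite (nu_itv true ab) (nu_itv false ab) lebesgue_measure_itv/= lte_fin -EFinD /incr.
move: ab; rewrite le_eqVlt => /predU1P[->|->].
  by rewrite ltxx; congr EFin; lra.
by congr EFin; lra.
Qed.

Let nu_le A : measurable A -> (nu true A <= mu A)%E.
Proof. by move=> mA; rewrite nuD// [leRHS]measure_addE leeDl. Qed.

Let mitv (k : R) : measurable (`]-k, k]%classic : set (measurableTypeR R)).
Proof. exact: measurable_itv. Qed.

Let nu_restr_fin (k : R) : (nu true `](- k)%R, k]%classic < +oo)%E.
Proof.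
rewrite (le_lt_trans (nu_le (mitv k)))//.
by rewrite lebesgue_measure_itv/=; case: ifP => // _; rewrite ltry.
Qed.

(** The Stieltjes measure of [incr true] is dominated by Lebesgue measure, so it has a density;
    cutting it down to a bounded interval makes it finite and the density integrable. On []-k, k[]
    the primitive of the density is [incr true] up to a constant, and a primitive of an integrable
    function is derivable almost everywhere. *)
Lemma half_lipschitz_ae_derivable_itv (k : R) :
  {ae mu, forall x, `]-k, k[%classic x -> derivable g x 1}.
Proof.
pose nuk : {finite_measure set (measurableTypeR R) -> \bar R} :=
  mfrestr (mitv k) (nu_restr_fin k).
have numu : nuk `<< mu.
  apply/null_content_dominatesP => A mA A0; apply/eqP; rewrite eq_le measure_ge0 andbT -A0.
  apply: le_trans (nu_le mA); rewrite /nuk/= /mfrestr /mrestr.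
  by apply: le_measure; rewrite ?inE//; exact: measurableI.
pose h := Radon_Nikodym_SigmaFinite.f nuk mu.
have hi : mu.-integrable setT h by exact: Radon_Nikodym_SigmaFinite.f_integrable.
have hfin x : h x \is a fin_num by exact: Radon_Nikodym_SigmaFinite.f_fin_num.
have hE : EFin \o (fine \o h) = h by apply/funext => x /=; rewrite fineK.
have hF x : `]-k, k[%classic x ->
    \int[mu]_(t in `]-oo, x]%classic) (fine \o h) t = incr true x - incr true (-k).
  rewrite /= in_itv/= => /andP[kx xk]; rewrite /Rintegral.
  under eq_integral do rewrite /= fineK//.
  rewrite -Radon_Nikodym_SigmaFinite.f_integral// /nuk/= /mfrestr /mrestr.
  rewrite (_ : _ `&` _ = `]-k, x]%classic); first by rewrite (nu_itv true (ltW kx)).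
  apply/seteqP; split => t /=; rewrite !in_itv/=.
    by move=> [tx /andP[-> _]].
  by move=> /andP[-> tx]; split => //; rewrite (le_trans tx)// ltW.
pose F (x : R) : R := \int[mu]_(t in `]-oo, x]%classic) (fine \o h) t.
have : {ae mu, forall x : R, derivable F x 1 /\ F^`()%classic x = (fine \o h) x}.
  apply: FTC1Ny.
    by move=> y; rewrite hE; exact: integrableS hi.
  rewrite -(patch_setT (fun=> 0) (fine \o h)); apply: integrable_locally => //.
  by rewrite hE.
apply: filterS; first exact: (ae_filter_ringOfSetsType mu).
move=> x [dF _] xk.
(* Here [F t = g t + t / 2 - incr true (-k)] near [x], which is solved for [g t]. *)
apply: (@near_lincomb_derivable F _ 1 (- 2^-1) (incr true (-k)) _ _ dF).
have := @near_in_itvoo R (-k) k x xk.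
by apply: filterS => t /hF Ft; rewrite /F Ft /incr; lra.
Qed.

End half_lipschitz.

Lemma rlipschitz_ae_derivable L g : rlipschitz L g ->
  {ae mu, forall x, derivable g x 1}.
Proof.
move=> gL.
(* [L] carries no sign condition; [|L| + 1] is a positive Lipschitz constant in every case. *)
have L1 : 0 < 2 * (`|L| + 1) by rewrite mulr_gt0// ltr_wpDl.
pose g' x := (2 * (`|L| + 1))^-1 * g x.
have g'L : rlipschitz 2^-1 g'.
  move=> x y; rewrite /g' -mulrBr normrM gtr0_norm ?invr_gt0//.
  rewrite ler_pdivrMl//; apply: le_trans (gL x y) _.
  by rewrite mulrA (mulrC 2) mulfK ?pnatr_eq0// ler_wpM2r// (le_trans (ler_norm _))// lerDl.
have : {ae mu, forall x, forall k : nat, `]-(k%:R : R), k%:R[%classic x -> derivable g' x 1}.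
  by apply/ae_foralln => k; exact: half_lipschitz_ae_derivable_itv.
apply: filterS; first exact: (ae_filter_ringOfSetsType mu).
move=> x /(_ (Num.bound `|x : R|)).
rewrite /= in_itv/= -ltr_norml.
rewrite archi_boundP// => /(_ isT) dg'.
apply: (@near_lincomb_derivable g' _ (2 * (`|L| + 1)) 0 0 _ _ dg').
apply: (@filterE _ (nbhs (x : R))) => t.
by rewrite mul0r !addr0 /g' mulrA divff ?mul1r// gt_eqF.
Qed.

End lipschitz_ae_derivable.

(** * Lebesgue density points *)

Section density.
Context {R : realType}.
Local Notation mu := (@lebesgue_measure R).

(** The consequence of density that the product step consumes: every small step [t] from [x] can be
    corrected into one landing in [A], at a cost that is small relative to [|t|]. *)
Definition thick_at (A : set R) (x : R) := forall e, 0 < e ->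
  exists2 r, 0 < r & forall t, `|t| < r ->
    exists2 t', `|t' - t| <= e * `|t| & A (x + t').

(* If no [x + t'] with [|t' - t| <= e |t|] lies in [A], then [A] misses a fixed
   fraction of the ball of radius [(1 + e) |t|], so [x] has density less than 1. *)
Lemma ae_thick_at (A : set R) : measurable A ->
  {ae mu, forall x, A x -> thick_at A x}.
Proof.
move=> mA; have := lebesgue_density mA.
apply: filterS; first exact: (ae_filter_ringOfSetsType mu).
move=> x + Ax e e0; rewrite indicE mem_set//= => dens.
have e1 : 0 < 1 + e by rewrite addr_gt0.
have mball y s : measurable (ball (y : R) s : set (measurableTypeR R)).
  by rewrite ball_itv; exact: measurable_itv.
(* Removing a ball of radius [e * |t|] from a ball of radius [(1 + e) * |t|] leaves exactly this
   fraction of its measure. *)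
pose c := 1 - e / (1 + e).
have c1 : (c%:E < (1%R : R)%:E)%E by rewrite lte_fin ltrBlDr ltrDl divr_gt0.
have : nbhs (1%R : R)%:E [set y : \bar R | (c%:E < y)%E].
  by apply: open_nbhs_nbhs; split => //; exact: open_ereal_gt_ereal.
move/dens => -[r/= r0 rP].
exists (r / (1 + e)); first by rewrite divr_gt0.
move=> t tr; have [->|t0] := eqVneq t 0.
  by exists 0; rewrite ?subr0 ?normr0 ?mulr0 ?addr0.
apply: contrapT => tA.
have nt : 0 < `|t| by rewrite normr_gt0.
pose q := (1 + e) * `|t|.
have q0 : 0 < q by rewrite mulr_gt0.
have et0 : 0 < e * `|t| by rewrite mulr_gt0.
have qr : `|0 - q| < r by rewrite sub0r normrN gtr0_norm// /q mulrC -ltr_pdivlMr.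
have := rP q qr q0; rewrite /= lebesgue_measure_ball ?ltW//.
have sub : ball (x + t) (e * `|t|) `<=` ball x q.
  move=> z; rewrite /ball/= => zt.
  rewrite (_ : x - z = (x + t - z) - t); last by ring.
  rewrite (le_lt_trans (ler_normB _ _))// /q mulrDl mul1r addrC ltrD2l//.
have : (mu (A `&` ball x q) <= (q *+ 2 - (e * `|t|) *+ 2)%:E)%E.
  rewrite EFinB -(lebesgue_measure_ball x (ltW q0)).
  rewrite -(lebesgue_measure_ball (x + t) (ltW et0)) leeBrDr; last first.
    by rewrite lebesgue_measure_ball// ltW.
  rewrite -measureU; first last.
  - apply/seteqP; split => // z [[Az _] zt]; apply: tA.
    exists (z - x); last by rewrite addrC subrK.
    move: zt; rewrite /ball/= => zt.
    by rewrite (_ : z - x - t = - (x + t - z)) ?normrN ?ltW//; ring.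
  - exact: mball.
  - by apply: measurableI => //; exact: mball.
  apply: le_measure; rewrite ?inE.
  - apply: measurableU; last exact: mball.
    by apply: measurableI => //; exact: mball.
  - exact: mball.
  - by move=> z [[]//|/sub].
move=> le1 lt2; move: lt2; apply/negP; rewrite -leNgt.
rewrite inver mulrn_eq0/= gt_eqF// lee_pdivrMr ?mulrn_wgt0//.
apply: (le_trans le1); rewrite -EFinM lee_fin /c.
rewrite /q le_eqVlt; apply/orP; left; apply/eqP; field.
by rewrite gt_eqF.
Qed.

End density.

(** * Euclidean norm and its comparison with the sup norm *)

Section euclidean_norm.
Context {R : realType}.
Implicit Types n : nat.

Lemma dotpC n (u v : 'rV[R]_n) : dotp u v = dotp v u.
Proof. by apply: eq_bigr => i _; rewrite mulrC. Qed.

Lemma dotpDl n (u v w : 'rV[R]_n) : dotp (u + v) w = dotp u w + dotp v w.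
Proof. by rewrite -big_split; apply: eq_bigr => i _; rewrite mxE mulrDl. Qed.

Lemma dotpZl n a (u v : 'rV[R]_n) : dotp (a *: u) v = a * dotp u v.
Proof. by rewrite /dotp mulr_sumr; apply: eq_bigr => i _; rewrite mxE mulrA. Qed.

Lemma dotpNl n (u v : 'rV[R]_n) : dotp (- u) v = - dotp u v.
Proof. by rewrite -scaleN1r dotpZl mulN1r. Qed.

Lemma dotpBl n (u v w : 'rV[R]_n) : dotp (u - v) w = dotp u w - dotp v w.
Proof. by rewrite dotpDl dotpNl. Qed.

Lemma dotpDr n (u v w : 'rV[R]_n) : dotp w (u + v) = dotp w u + dotp w v.
Proof. by rewrite dotpC dotpDl !(dotpC w). Qed.

Lemma dotpZr n a (u v : 'rV[R]_n) : dotp u (a *: v) = a * dotp u v.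
Proof. by rewrite dotpC dotpZl dotpC. Qed.

Lemma dotpNr n (u v : 'rV[R]_n) : dotp u (- v) = - dotp u v.
Proof. by rewrite dotpC dotpNl dotpC. Qed.

Lemma dotpBr n (u v w : 'rV[R]_n) : dotp w (u - v) = dotp w u - dotp w v.
Proof. by rewrite dotpDr dotpNr. Qed.

Lemma dotp0l n (u : 'rV[R]_n) : dotp 0 u = 0.
Proof. by apply: big1 => i _; rewrite mxE mul0r. Qed.

Lemma dotp0r n (u : 'rV[R]_n) : dotp u 0 = 0.
Proof. by rewrite dotpC dotp0l. Qed.

Lemma dotp_ge0 n (u : 'rV[R]_n) : 0 <= dotp u u.
Proof. by apply: sumr_ge0 => i _; rewrite -expr2 sqr_ge0. Qed.

Lemma enorm_ge0 n (u : 'rV[R]_n) : 0 <= enorm u.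
Proof. exact: sqrtr_ge0. Qed.
Hint Resolve enorm_ge0 : core.

Lemma enorm_sqr n (u : 'rV[R]_n) : enorm u ^+ 2 = dotp u u.
Proof. by rewrite sqr_sqrtr// dotp_ge0. Qed.

Lemma enormZ n a (u : 'rV[R]_n) : enorm (a *: u) = `|a| * enorm u.
Proof.
by rewrite /enorm dotpZl dotpZr mulrA -expr2 sqrtrM ?sqr_ge0// sqrtr_sqr.
Qed.

Lemma enormN n (u : 'rV[R]_n) : enorm (- u) = enorm u.
Proof. by rewrite -scaleN1r enormZ normrN1 mul1r. Qed.

Lemma enormB n (u v : 'rV[R]_n) : enorm (u - v) = enorm (v - u).
Proof. by rewrite -enormN opprB. Qed.

Lemma enorm0 n : enorm (0 : 'rV[R]_n) = 0.
Proof. by rewrite /enorm dotp0l sqrtr0. Qed.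

Lemma normr_coord_le_enorm n (u : 'rV[R]_n) i : `|u 0 i| <= enorm u.
Proof.
rewrite -(@ler_pXn2r _ 2)// ?nnegrE// enorm_sqr real_normK ?num_real//.
rewrite /dotp (bigD1 i)//= -expr2 lerDl.
by apply: sumr_ge0 => j _; rewrite -expr2 sqr_ge0.
Qed.

Lemma mx_norm_le m n (A : 'M[R]_(m, n)) c : 0 <= c ->
  (forall i j, `|A i j| <= c) -> `|A| <= c.
Proof.
move=> c0 Ac; rewrite [leLHS]mx_normrE.
by apply: bigmax_le => // -[i j] _ /=.
Qed.

Lemma normr_coord_le m n (A : 'M[R]_(m, n)) i j : `|A i j| <= `|A|.
Proof.
rewrite [leRHS]mx_normrE.
exact: (le_bigmax _ (fun ij : 'I_m * 'I_n => `|A ij.1 ij.2|) (i, j)).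
Qed.

Lemma mx_norm_le_enorm n (u : 'rV[R]_n) : `|u| <= enorm u.
Proof.
by apply: mx_norm_le => // i j; rewrite ord1 normr_coord_le_enorm.
Qed.

Lemma enorm_eq0 n (u : 'rV[R]_n) : enorm u = 0 -> u = 0.
Proof.
move=> u0; apply/rowP => i; rewrite mxE; apply/eqP.
by rewrite -normr_le0 -u0 normr_coord_le_enorm.
Qed.

Lemma cauchy_schwarz n (u v : 'rV[R]_n) : `|dotp u v| <= enorm u * enorm v.
Proof.
have [u0|u0] := eqVneq (enorm u) 0.
  by rewrite u0 mul0r (enorm_eq0 u0) dotp0l normr0.
have uu : 0 < dotp u u by rewrite -enorm_sqr exprn_gt0// lt_def u0 enorm_ge0.
rewrite -(@ler_pXn2r _ 2)// ?nnegrE ?mulr_ge0// exprMn !enorm_sqr.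
rewrite real_normK ?num_real//.
have := dotp_ge0 (dotp u u *: v - dotp u v *: u).
rewrite dotpBl !dotpBr !dotpZl !dotpZr (dotpC v u).
set a := dotp u u in uu *; set b := dotp u v; set c := dotp v v => H.
have : 0 <= a * (a * c - b ^+ 2) by lra.
by rewrite pmulr_rge0// subr_ge0.
Qed.

Lemma enormD n (u v : 'rV[R]_n) : enorm (u + v) <= enorm u + enorm v.
Proof.
rewrite -(@ler_pXn2r _ 2)// ?nnegrE ?addr_ge0// enorm_sqr dotpDl !dotpDr.
rewrite sqrrD !enorm_sqr (dotpC v u).
have := cauchy_schwarz u v; have := ler_norm (dotp u v); lra.
Qed.

Lemma enorm_le_sum n (u : 'rV[R]_n) : enorm u <= \sum_(i < n) `|u 0 i|.
Proof.
rewrite -(@ler_pXn2r _ 2)// ?nnegrE ?sumr_ge0// enorm_sqr.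
rewrite expr2 mulr_suml; apply: ler_sum => i _.
rewrite (le_trans (ler_norm _))// normrM ler_wpM2l//.
by rewrite (bigD1 i)//= lerDl sumr_ge0.
Qed.

Lemma enorm_le_mx_norm n (u : 'rV[R]_n) : enorm u <= n%:R * `|u|.
Proof.
apply: (le_trans (enorm_le_sum u)).
have -> : n%:R * `|u| = \sum_(i < n) `|u| by rewrite sumr_const card_ord mulr_natl.
by apply: ler_sum => i _; exact: normr_coord_le.
Qed.

(** The divisor is [n + 1] rather than [n] so that dimension 0 needs no separate treatment. *)
Lemma enorm_lt_mx n (h : 'rV[R]_n) c : `|h| < c / (n%:R + 1) -> enorm h < c.
Proof.
have n1 : 0 < n%:R + 1 :> R by rewrite ltr_wpDl.
rewrite ltr_pdivlMr// => hc; apply: le_lt_trans (enorm_le_mx_norm h) _.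
by apply: le_lt_trans hc; rewrite mulrC ler_wpM2l// lerDl.
Qed.

Lemma nbhs_enormP n (x : 'rV[R]_n) (A : set 'rV[R]_n) :
  nbhs x A <-> exists2 r, 0 < r & forall h, enorm h < r -> A (x + h).
Proof.
split=> [/nbhs_ballP[r/= r0 rA]|[r r0 rA]].
  exists r => // h hr; apply: rA; rewrite -ball_normE/= opprD addNKr normrN.
  exact: le_lt_trans (mx_norm_le_enorm h) hr.
apply/nbhs_ballP; exists (r / (n%:R + 1)) => /=; first by rewrite divr_gt0// ltr_wpDl.
move=> z; rewrite -ball_normE/= -normrN opprB => zx.
rewrite -(subrK x z) addrC; apply: rA.
apply: le_lt_trans (enorm_le_mx_norm _) _.
rewrite ltr_pdivlMr ?ltr_wpDl// in zx; apply: le_lt_trans zx.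
by rewrite mulrC ler_wpM2l// lerDl.
Qed.

Lemma enorm_continuous n : continuous (@enorm R n).
Proof.
move=> x; apply/(@cvgrPdist_lt _ _ _ (nbhs x) (nbhs_filter x)) => e e0.
apply/nbhs_enormP.
exists e => // h he; apply: le_lt_trans he.
have := enormD x h; have := enormD (x + h) (- h); rewrite addrK enormN => h1 h2.
by rewrite ler_norml; apply/andP; split; lra.
Qed.

Lemma elipschitz_continuous n L (f : 'rV[R]_n -> R) :
  (forall u v, `|f u - f v| <= L * enorm (u - v)) -> continuous f.
Proof.
move=> fL x; apply/(@cvgrPdist_lt _ _ _ (nbhs x) (nbhs_filter x)) => e e0.
apply/nbhs_enormP.
have L1 : 0 < `|L| + 1 by rewrite ltr_wpDl.
exists (e / (`|L| + 1)); first by rewrite divr_gt0.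
move=> h; rewrite ltr_pdivlMr// => he; apply: le_lt_trans he.
apply: le_trans (fL _ _) _; rewrite opprD addNKr enormN mulrC ler_wpM2l//.
by rewrite (le_trans (ler_norm _))// lerDl.
Qed.

End euclidean_norm.

#[global] Hint Resolve enorm_ge0 : core.

(** * Countable description of differentiability *)

Section first_order_approximation.
Context {R : realType}.

Definition approx_at k n (J : 'rV[R]_k -> 'rV[R]_n) (f : 'rV[R]_n -> R)
    (e r : R) (a : 'rV[R]_k) (x : 'rV[R]_n) :=
  forall h, enorm h < r -> `|f (x + J h) - f x - dotp a h| <= e * enorm h.

(* Differentiability along the image of the linear map [J].  Letting the gradient
   [a] depend on [e] makes the set of such [x] visibly measurable, since [a], [e]
   and [r] can then be taken rational; for [J = id], [diff_along_is_grad]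
   recovers a single gradient. *)
Definition diff_along k n (J : 'rV[R]_k -> 'rV[R]_n) (f : 'rV[R]_n -> R)
    (x : 'rV[R]_n) :=
  forall e, 0 < e -> exists a, exists2 r, 0 < r & approx_at J f e r a x.

Lemma rat_approx k (a : 'rV[R]_k) e : 0 < e ->
  exists q : 'rV[rat]_k, enorm (a - map_mx ratr q) < e.
Proof.
move=> e0.
have k0 : 0 < k%:R + 1 :> R by rewrite ltr_wpDl.
have /choice[q qP] : forall i, exists q : rat,
    a 0 i - e / (k%:R + 1) < ratr q < a 0 i + e / (k%:R + 1).
  move=> i; have /rat_in_itvoo[q] : a 0 i - e / (k%:R + 1) < a 0 i + e / (k%:R + 1).
    by rewrite ltrD2l gtrN ?divr_gt0.
  by rewrite in_itv/= => ?; exists q.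
exists (\row_i q i).
apply: le_lt_trans (enorm_le_mx_norm _) _.
apply: (@le_lt_trans _ _ (k%:R * (e / (k%:R + 1)))).
  rewrite ler_wpM2l//; apply: mx_norm_le => [|i j]; first by rewrite divr_ge0 ?ltW.
  by have := qP j; rewrite ord1 !mxE => /andP[? ?]; rewrite ler_norml; apply/andP; split; lra.
rewrite mulrA ltr_pdivrMr// mulrC ltr_pM2l// ltrDl//.
Qed.

(** By Cauchy-Schwarz, moving [a] to a rational vector within [e / 2] costs at most
    [e / 2 * enorm h]; the other half of [e] is left for the approximation itself. The right-hand
    side uses only countably many sets, each of them closed by [closed_approx_at]. *)
Lemma diff_along_ratP k n (J : 'rV[R]_k -> 'rV[R]_n) f x :
  diff_along J f x <-> forall i : nat, exists j : nat, exists q : 'rV[rat]_k,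
    approx_at J f i.+1%:R^-1 j.+1%:R^-1 (map_mx ratr q) x.
Proof.
split=> [df i|H e e0].
  have i0 : 0 < i.+1%:R^-1 / 2 :> R by rewrite divr_gt0.
  move: (i.+1%:R^-1) i0 => E i0.
  have [a [r r0 ar]] := df _ i0.
  have [q qa] := rat_approx a i0.
  have [j jr] : exists j : nat, j.+1%:R^-1 < r.
    by near \oo => j; exists j; near: j; exact: near_infty_natSinv_lt (PosNum r0).
  exists j, q => h hj.
  have := ar h (lt_trans hj jr).
  have -> : dotp (map_mx ratr q) h = dotp a h - dotp (a - map_mx ratr q) h.
    by rewrite dotpBl; ring.
  have := cauchy_schwarz (a - map_mx ratr q) h.
  have : enorm (a - map_mx ratr q) * enorm h <= E / 2 * enorm h.
    exact: ler_wpM2r (enorm_ge0 h) _ _ (ltW qa).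
  rewrite !ler_norml => ? /andP[? ?] /andP[? ?]; apply/andP; split; lra.
have [i ie] : exists i : nat, i.+1%:R^-1 < e.
  by near \oo => i; exists i; near: i; exact: near_infty_natSinv_lt (PosNum e0).
have [j [q ijq]] := H i.
exists (map_mx ratr q), j.+1%:R^-1; first by rewrite invr_gt0.
by move=> h /ijq /le_trans; apply; exact: ler_wpM2r (enorm_ge0 h) _ _ (ltW ie).
Unshelve. all: by end_near. Qed.

Lemma closed_approx_at k n (J : 'rV[R]_k -> 'rV[R]_n) f e r a :
  continuous f -> closed [set x | approx_at J f e r a x].
Proof.
move=> cf.
have -> : [set x | approx_at J f e r a x] = \bigcap_(h in [set h | enorm h < r])
    ((fun x => `|f (x + J h) - f x - dotp a h|) @^-1` [set y | y <= e * enorm h]).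
  by apply/seteqP; split.
apply: closed_bigI => h _; apply: closed_comp; last exact: closed_le.
move=> x _; have Fx : Filter (nbhs x) by exact: nbhs_filter.
have cfJ : f (z + J h) @[z --> x] --> f (x + J h).
  apply: (@cvg_comp _ _ _ (fun z : 'rV[R]_n => z + J h) f _ _ _ _ (cf (x + J h))).
  exact: cvgD cvg_id (cvg_cst _).
have c1 := @cvgB R R^o _ (nbhs x) Fx _ _ _ _ cfJ (cf x).
have c2 := @cvgB R R^o _ (nbhs x) Fx _ _ _ _ c1 (@cvg_cst R^o (dotp a h) _ (nbhs x) Fx).
exact: (@cvg_norm R R^o _ (nbhs x) Fx _ _ c2).
Qed.

End first_order_approximation.

Section consr.
Context {R : realType}.

(** Counterpart on row vectors of [tcons], through which [lebesgue_tuple] is built; it splits off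
    the first coordinate so that Fubini and the induction on the dimension apply. *)
Definition consr n (a : R) (p : 'rV[R]_n) : 'rV[R]_n.+1 :=
  \row_j (if unlift ord0 j is Some i then p 0 i else a).

Lemma consr0E n a (p : 'rV[R]_n) : consr a p 0 ord0 = a.
Proof. by rewrite mxE unlift_none. Qed.

Lemma consrSE n a (p : 'rV[R]_n) i : consr a p 0 (lift ord0 i) = p 0 i.
Proof. by rewrite mxE liftK. Qed.

Lemma consr_eta n (u : 'rV[R]_n.+1) :
  u = consr (u 0 ord0) (\row_i u 0 (lift ord0 i)).
Proof.
apply/rowP => j; case: (unliftP ord0 j) => [i|] ->.
  by rewrite consrSE mxE.
by rewrite consr0E.
Qed.

Lemma consrD n a b (p q : 'rV[R]_n) :
  consr a p + consr b q = consr (a + b) (p + q).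
Proof.
apply/rowP => j; rewrite mxE; case: (unliftP ord0 j) => [i|] ->.
  by rewrite !consrSE mxE.
by rewrite !consr0E.
Qed.

Lemma consrN n a (p : 'rV[R]_n) : - consr a p = consr (- a) (- p).
Proof.
apply/rowP => j; rewrite mxE; case: (unliftP ord0 j) => [i|] ->.
  by rewrite !consrSE mxE.
by rewrite !consr0E.
Qed.

Lemma dotp_consr n a b (p q : 'rV[R]_n) :
  dotp (consr a p) (consr b q) = a * b + dotp p q.
Proof.
rewrite /dotp big_ord_recl !consr0E; congr (_ + _).
by apply: eq_bigr => i _; rewrite !consrSE.
Qed.

Lemma enorm_consr_sqr n a (p : 'rV[R]_n) :
  enorm (consr a p) ^+ 2 = a ^+ 2 + enorm p ^+ 2.
Proof. by rewrite !enorm_sqr dotp_consr -expr2. Qed.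

Lemma normr_le_enorm_consr n a (p : 'rV[R]_n) : `|a| <= enorm (consr a p).
Proof. by rewrite -[in leLHS](consr0E a p) normr_coord_le_enorm. Qed.

Lemma enorm_le_consr n a (p : 'rV[R]_n) : enorm p <= enorm (consr a p).
Proof.
have : enorm p ^+ 2 <= enorm (consr a p) ^+ 2.
  by rewrite enorm_consr_sqr lerDr sqr_ge0.
by move=> H; rewrite -(@ler_pXn2r _ 2) ?nnegrE ?enorm_ge0.
Qed.

Lemma enorm_consr0 n a : enorm (consr a (0 : 'rV[R]_n)) = `|a|.
Proof. by rewrite /enorm dotp_consr dotp0l addr0 -expr2 sqrtr_sqr. Qed.

Lemma enorm_consr00 n (p : 'rV[R]_n) : enorm (consr 0 p) = enorm p.
Proof. by rewrite /enorm dotp_consr mulr0 add0r. Qed.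

Lemma row_of_tuple_tcons n (a : R) (v : n.-tuple R) :
  row_of_tuple (tcons (a, v)) = consr a (row_of_tuple v).
Proof.
apply/rowP => j; case: (unliftP ord0 j) => [i|] ->.
  by rewrite consrSE !mxE tnthS.
by rewrite consr0E mxE tnth0.
Qed.

End consr.

Section product_step.
Context {R : realType} (n : nat) (L : R) (f : 'rV[R]_n.+1 -> R).
Hypothesis L0 : 0 <= L.
Hypothesis fL : forall u v, `|f u - f v| <= L * enorm (u - v).

Lemma rlipschitz_slice (p : 'rV[R]_n) : rlipschitz L (fun s => f (consr s p)).
Proof.
move=> s s'; rewrite (le_trans (fL _ _))// consrN consrD subrr.
by rewrite enorm_consr0.
Qed.

Lemma derivable_approx (g : R -> R) (a : R) : derivable g a 1 ->
  exists b, forall e, 0 < e -> exists2 r, 0 < r & forall t, `|t| < r ->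
    `|g (a + t) - g a - b * t| <= e * `|t|.
Proof.
move=> /cvg_ex[b /= gb]; exists b => e e0.
move/cvgrPdist_le : gb => /(_ e e0) [r/= r0 rP].
exists r => // t tr; have [->|t0] := eqVneq t 0.
  by rewrite addr0 mulr0 subr0 subrr normr0 mulr0.
have := rP t; rewrite /ball_/= sub0r normrN => /(_ tr t0).
rewrite [t *: 1]mulr1 /GRing.scale/= => ge.
rewrite (_ : _ - _ = - (b - t^-1 * (g (t + a) - g a)) * t); last first.
  by rewrite (addrC a); field.
by rewrite normrM normrN ler_wpM2r.
Qed.

(* A step [consr t q] is split as [consr t 0 + consr 0 q]; thickness replaces the
   base point [consr (a + t) p] of the second half by a nearby one at which the
   slice approximation holds uniformly. *)
Lemma diff_along_consr a (p : 'rV[R]_n) :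
  derivable (fun t => f (consr t p)) a 1 ->
  (forall e, 0 < e -> exists b, exists2 r, 0 < r &
     thick_at [set t | approx_at (consr 0) f e r b (consr t p)] a) ->
  diff_along id f (consr a p).
Proof.
move=> /derivable_approx[b gb] Hs e e0.
have e4 : 0 < e / 4 by rewrite divr_gt0.
(* Four errors share [e]: the derivative in the first variable, the slice approximation, and two
   Lipschitz moves of the first coordinate between [a + t] and [a + t']. Each move costs
   [L * e' * |t|], at most a quarter. *)
pose e' := e / (4 * (L + 1)).
have L1 : 0 < L + 1 by rewrite ltr_wpDl.
have e'0 : 0 < e' by rewrite divr_gt0// mulr_gt0.
have Le' : L * e' <= e / 4.
  rewrite /e' mulrA ler_pdivrMr ?mulr_gt0//; nra.
have [a0 [r1 r10 thick]] := Hs _ e4.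
have [r2 r20 gP] := gb _ e4.
have [r3 r30 tP] := thick _ e'0.
exists (consr b a0), (Num.min r1 (Num.min r2 r3)).
  by rewrite !lt_min r10 r20.
move=> h; rewrite (consr_eta h); move: (h 0 ord0) (\row_i _) => t q {h}.
rewrite !lt_min => /and3P[h1 h2 h3].
have tH := normr_le_enorm_consr t q; have qH := enorm_le_consr t q.
have [t' tt' At'] := tP t (le_lt_trans tH h3).
have gt := gP t (le_lt_trans tH h2).
have := At' q (le_lt_trans qH h1).
rewrite !consrD addr0 dotp_consr => sl.
have f1 := rlipschitz_slice (p + q) (a + t) (a + t').
have f2 := rlipschitz_slice p (a + t') (a + t).
rewrite (_ : a + t - (a + t') = t - t') in f1; last by ring.
rewrite (_ : a + t' - (a + t) = t' - t) in f2; last by ring.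
have : L * `|t' - t| <= e / 4 * `|t|.
  apply: (@le_trans _ _ (L * (e' * `|t|))); first exact: ler_wpM2l.
  by rewrite mulrA ler_wpM2r.
rewrite [`|t - t'|]distrC in f1.
move: f1 f2 sl gt; set H := enorm (consr t q).
have e1 : e / 4 * `|t| <= e / 4 * H by rewrite ler_wpM2l// ltW.
have e2 : e / 4 * enorm q <= e / 4 * H by rewrite ler_wpM2l// ltW.
move: e1 e2; move: (L * _) (e / 4 * enorm q) (e / 4 * `|t|) => x1 x2 x3.
rewrite !ler_norml => e1 e2 /andP[? ?] /andP[? ?] /andP[? ?] /andP[? ?] ?.
by apply/andP; split; lra.
Qed.

End product_step.

Section tuple_measurability.
Context {R : realType}.
Local Notation RT := (measurableTypeR R).

(** Tuples carry the product sigma-algebra, row vectors the norm topology. The link is that an open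
    set is the countable union of the rational cubes it contains, and a cube is a finite
    intersection of coordinate conditions. *)
Lemma open_measurable_tuple n (O : set 'rV[R]_n) : open O ->
  measurable [set t : n.-tuple RT | O (row_of_tuple t)].
Proof.
move=> oO.
pose B (qk : 'rV[rat]_n * nat) : set 'rV[R]_n :=
  [set x | forall i, `|x 0 i - ratr (qk.1 0 i)| < qk.2.+1%:R^-1].
have -> : [set t : n.-tuple RT | O (row_of_tuple t)] =
    \bigcup_(qk in [set qk | B qk `<=` O]) [set t : n.-tuple RT | B qk (row_of_tuple t)].
  apply/seteqP; split=> [t /= Ot|t [qk/= qkO /qkO]//].
  have /nbhs_ballP[r/= r0 rO] : nbhs (row_of_tuple t) O by exact: open_nbhs_nbhs.
  have [k kr] : exists k : nat, k.+1%:R^-1 < r / 2.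
    have r2 : 0 < r / 2 by rewrite divr_gt0.
    by near \oo => i; exists i; near: i; exact: near_infty_natSinv_lt (PosNum r2).
  have k0 : 0 < k.+1%:R^-1 :> R by rewrite invr_gt0.
  have [q qt] := rat_approx (row_of_tuple t) k0.
  exists (q, k) => /=.
    move=> x /= Bx; apply: rO; rewrite -ball_normE/=.
    apply: (@le_lt_trans _ _ (k.+1%:R^-1 + k.+1%:R^-1)); last first.
      by move: kr; move: (k.+1%:R^-1) => E; lra.
    apply: mx_norm_le => [|i j]; first by rewrite addr_ge0 ?ltW.
    rewrite ord1 [_ 0 j]mxE [(- x) 0 j]mxE.
    rewrite -(subrKA (ratr (q 0 j))) (le_trans (ler_normD _ _))//.
    apply: lerD; last by rewrite distrC ltW.
    have := normr_coord_le_enorm (row_of_tuple t - map_mx ratr q) j.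
    by rewrite !mxE => /le_trans; apply; exact: ltW.
  move=> i; apply: le_lt_trans qt.
  by have := normr_coord_le_enorm (row_of_tuple t - map_mx ratr q) i; rewrite !mxE.
rewrite bigcup_mkcond; apply: countable_bigcupT_measurable => // -[q k].
case: ifP => // _.
have -> : [set t : n.-tuple RT | B (q, k) (row_of_tuple t)] =
    \bigcap_(i in [set: 'I_n]) ((fun t : n.-tuple RT => tnth t i) @^-1`
       ball (ratr (q 0 i) : R) k.+1%:R^-1).
  apply/seteqP; split => t /= Bt i.
    by have := Bt i; rewrite !mxE /= /ball/= distrC.
  by have := Bt i I; rewrite !mxE /= /ball/= distrC.
apply: fin_bigcap_measurable; first exact: finite_finset.
move=> i _; rewrite -[X in measurable X]setTI; apply: measurable_tnth => //.
by rewrite ball_itv; exact: measurable_itv.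
Unshelve. all: by end_near. Qed.

Lemma closed_measurable_tuple n (A : set 'rV[R]_n) : closed A ->
  measurable [set t : n.-tuple RT | A (row_of_tuple t)].
Proof.
move=> cA; rewrite -[X in measurable X]setCK; apply: measurableC.
exact: (@open_measurable_tuple n (~` A) (closed_openC cA)).
Qed.

Lemma measurable_continuous_tuple n (f : 'rV[R]_n -> R) : continuous f ->
  measurable_fun [set: n.-tuple RT] (fun t => f (row_of_tuple t)).
Proof.
move=> cf; apply: (measurability _ (RGenOpens.measurableE R)).
move=> _ [_ [a [b ->] <-]]; rewrite setTI.
have oab : open (f @^-1` `]a, b[%classic).
  by apply: open_comp => [x _|]; [exact: cf|exact: interval_open].
exact: (open_measurable_tuple oab).
Qed.

Lemma measurable_diff_along k n (J : 'rV[R]_k -> 'rV[R]_n) f : continuous f ->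
  measurable [set t : n.-tuple RT | diff_along J f (row_of_tuple t)].
Proof.
move=> cf.
have -> : [set t : n.-tuple RT | diff_along J f (row_of_tuple t)] =
    \bigcap_(i in [set: nat]) \bigcup_(jq in [set: nat * 'rV[rat]_k])
      [set t : n.-tuple RT | approx_at J f i.+1%:R^-1 jq.1.+1%:R^-1
                               (map_mx ratr jq.2) (row_of_tuple t)].
  apply/seteqP; split => t /=.
    by move/diff_along_ratP => H i _; have [j [q jq]] := H i; exists (j, q).
  move=> H; apply/diff_along_ratP => i; have [[j q] _ /= jq] := H i I.
  by exists j, q.
apply: bigcapT_measurable => i.
apply: countable_bigcupT_measurable => // -[j q] /=.
exact: (closed_measurable_tuple (@closed_approx_at R k n J f _ _ _ cf)).
Qed.

End tuple_measurability.

Section product_null.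
Context d1 d2 (T1 : measurableType d1) (T2 : measurableType d2) (R : realType).
Variable m1 : {sigma_finite_measure set T1 -> \bar R}.
Variable m2 : {sigma_finite_measure set T2 -> \bar R}.
Variable E : set (T1 * T2).
Hypothesis mE : measurable E.
Local Open Scope ereal_scope.

Lemma xsection_null :
  (forall x, m2.-negligible (xsection E x)) -> (m1 \x m2) E = 0.
Proof.
move=> E0; rewrite /product_measure1/=; apply: integral0_eq => x _ /=.
by apply: measure_negligible; [exact: measurable_xsection|exact: E0].
Qed.

Lemma ysection_null :
  (forall y, m1.-negligible (ysection E y)) -> (m1 \x m2) E = 0.
Proof.
move=> E0; have -> : (m1 \x m2) E = (m1 \x^ m2) E.
  by apply: product_measure_unique => //= *; rewrite product_measure2E.
rewrite /product_measure2/=; apply: integral0_eq => y _ /=.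
by apply: measure_negligible; [exact: measurable_ysection|exact: E0].
Qed.

End product_null.

Lemma ae_forall_countType d (T : measurableType d) (R : realType)
    (mu : {measure set T -> \bar R}) (I : countType) (P : I -> T -> Prop) :
  (forall i, {ae mu, forall x, P i x}) -> {ae mu, forall x, forall i, P i x}.
Proof.
move=> aeP; pose Q k x := if unpickle k is Some i then P i x else True.
have : {ae mu, forall x, forall k, Q k x}.
  apply: ae_foralln => k; rewrite /Q; case: unpickle => [i|]; first exact: aeP.
  exact: aeW.
apply: negligibleS => x; apply: contra_not => Qx i.
by have := Qx (pickle i); rewrite /Q pickleK.
Qed.

(** * Induction on the dimension *)

Section rademacher.
Context {R : realType}.
Local Notation RT := (measurableTypeR R).
Local Notation mu := (@lebesgue_measure R).

Lemma diff_along_id0 (f : 'rV[R]_0 -> R) x : diff_along id f x.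
Proof.
move=> e e0; exists 0, 1 => // h _.
have -> : x + h = x by apply/rowP => -[].
by rewrite subrr dotp0l subr0 normr0 mulr_ge0 ?enorm_ge0 ?ltW.
Qed.

Lemma diff_along_slice n (f : 'rV[R]_n.+1 -> R) a (p : 'rV[R]_n) :
  diff_along id (fun q => f (consr a q)) p -> diff_along (consr 0) f (consr a p).
Proof.
move=> df e /df[b [r r0 br]]; exists b, r => // h /br.
by rewrite consrD addr0.
Qed.

(** Induction on [n] with two uses of Fubini. Fixing the first coordinate, the induction hypothesis
    makes the complement of [A1] null. Fixing the other coordinates, the one-dimensional theorem and
    density points make [A1] minus [A2] null. The sets have to be measurable for null sections to
    yield a null set. *)
Theorem rademacher n L (f : 'rV[R]_n -> R) : 0 <= L ->
  (forall u v, `|f u - f v| <= L * enorm (u - v)) ->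
  {ae lebesgue_tuple n, forall t, diff_along id f (row_of_tuple t)}.
Proof.
elim: n f => [|n IH] f L0 fL; first by apply: aeW => t; exact: diff_along_id0.
have cf : continuous f := elipschitz_continuous fL.
pose m2 := @lebesgue_tuple R n.
pose mt := @measurable_tcons R n.
pose A1 : set (RT * n.-tuple RT) :=
  @tcons R n @^-1` [set t | diff_along (consr 0) f (row_of_tuple t)].
pose A2 : set (RT * n.-tuple RT) :=
  @tcons R n @^-1` [set t | diff_along id f (row_of_tuple t)].
have mA1 : measurable A1.
  by rewrite -[A1]setTI; apply: mt => //; exact: measurable_diff_along.
have mA2 : measurable A2.
  by rewrite -[A2]setTI; apply: mt => //; exact: measurable_diff_along.
have null1 : (mu \x m2)%E (~` A1) = 0%E.
  apply: xsection_null; first exact: measurableC.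
  move=> a; have fa u v : `|f (consr a u) - f (consr a v)| <= L * enorm (u - v).
    by rewrite (le_trans (fL _ _))// consrN consrD subrr enorm_consr00.
  apply: negligibleS (IH _ L0 fa) => v.
  rewrite /xsection/= inE => nA df; apply: nA.
  by rewrite /A1/= row_of_tuple_tcons; exact: diff_along_slice.
have null2 : (mu \x m2)%E (A1 `\` A2) = 0%E.
  apply: ysection_null; first exact: measurableD.
  move=> v; set p := row_of_tuple v.
  have ae1 : {ae mu, forall a, derivable (fun t => f (consr t p)) a 1}.
    exact: rlipschitz_ae_derivable (rlipschitz_slice fL p).
  (* With rational data there are countably many of these sets, so almost every [a] is a thick point
     of all those that contain it, simultaneously. *)
  pose B (i : nat) (jq : nat * 'rV[rat]_n) : set RT :=
    [set t | approx_at (consr 0) f i.+1%:R^-1 jq.1.+1%:R^-1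
                       (map_mx ratr jq.2) (consr t p)].
  have mB i jq : measurable (B i jq).
    pose C : set (RT * n.-tuple RT) := @tcons R n @^-1` [set t |
      approx_at (consr 0) f i.+1%:R^-1 jq.1.+1%:R^-1 (map_mx ratr jq.2) (row_of_tuple t)].
    have mC : measurable C.
      rewrite -[C]setTI; apply: mt => //.
      exact: (closed_measurable_tuple (@closed_approx_at R n n.+1 (consr 0) f _ _ _ cf)).
    rewrite (_ : B i jq = ysection C v); first exact: measurable_ysection.
    by apply/seteqP; split => t; rewrite /ysection/= inE /C/= row_of_tuple_tcons.
  have ae2 : {ae mu, forall a, forall ijq, B ijq.1 ijq.2 a -> thick_at (B ijq.1 ijq.2) a}.
    by apply: ae_forall_countType => ijq; exact: ae_thick_at (mB _ _).
  have ae12 : {ae mu, forall a, derivable (fun t => f (consr t p)) a 1 /\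
      forall ijq, B ijq.1 ijq.2 a -> thick_at (B ijq.1 ijq.2) a}.
    have FF : Filter (nbhs (almost_everywhere mu)).
      exact: (ae_filter_ringOfSetsType mu).
    exact: filterI ae1 ae2.
  apply: negligibleS ae12 => a.
  rewrite /ysection/= inE => -[]; rewrite /A1 /A2/= row_of_tuple_tcons => d1 nd2 [da thick].
  apply: nd2; apply: (diff_along_consr L0 fL da) => e e0.
  have [i ie] : exists i : nat, i.+1%:R^-1 < e.
    by near \oo => i; exists i; near: i; exact: near_infty_natSinv_lt (PosNum e0).
  move/diff_along_ratP : d1 => /(_ i)[j [q ijq]].
  exists (map_mx ratr q), j.+1%:R^-1; first by rewrite invr_gt0.
  have th := thick (i, (j, q)) ijq => e1 e10.
  have [r r0 rP] := th e1 e10; exists r => // t /rP[t' tt' Bt'].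
  exists t' => // h /Bt' /le_trans; apply.
  exact: ler_wpM2r (enorm_ge0 h) _ _ (ltW ie).
apply/negligibleP.
  by apply: measurableC; exact: measurable_diff_along.
apply/eqP; rewrite -measure_le0.
change (((mu \x m2)%E (~` A2) <= 0)%E).
apply: (@le_trans _ _ ((mu \x m2)%E (~` A1 `|` (A1 `\` A2)))).
  apply: le_measure; rewrite ?inE.
  - by apply: measurableC.
  - by apply: measurableU; [apply: measurableC|apply: measurableD].
  - by move=> z nz; have [?|?] := pselect (A1 z); [right|left].
apply: le_trans (measureU2 _ _ _) _.
- exact: measurableC.
- exact: measurableD.
- by rewrite [X in (X + _)%E]null1 [X in (_ + X)%E]null2 adde0.
Unshelve. all: by end_near. Qed.

End rademacher.

(** * Smoothing of Lipschitz maps *)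

Section unit_ball.
Context {R : realType}.
Local Notation RT := (measurableTypeR R).
Local Notation mu := (@lebesgue_measure R).

(** An inscribed and a circumscribed cube show that the unit ball has positive and finite measure,
    without computing its volume. *)
Definition cube n (c : R) : set (n.-tuple RT) :=
  [set t | forall i, `|tnth t i| <= c].

Lemma measurable_cube n c : measurable (@cube n c).
Proof.
rewrite (_ : cube c = \bigcap_(i in [set: 'I_n])
    ((fun t : n.-tuple RT => tnth t i) @^-1` `[- c, c]%classic)); last first.
  apply/seteqP; split => t tc i; first by move=> _; rewrite /= in_itv/= -ler_norml.
  by have := tc i I; rewrite /= in_itv/= -ler_norml.
apply: fin_bigcap_measurable; first exact: finite_finset.
move=> i _; rewrite -[X in measurable X]setTI; exact: measurable_tnth.
Qed.

Lemma lebesgue_tuple_cube n c : 0 <= c ->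
  lebesgue_tuple n (@cube n c) = ((c *+ 2) ^+ n)%:E.
Proof.
move=> c0; elim: n => [|n IH].
  by rewrite /= diracE mem_set//; case.
have lc : mu `[- c, c]%classic = (c *+ 2)%:E.
  rewrite lebesgue_measure_itv/= lte_fin.
  case: ltP => [_|cc]; first by rewrite -EFinB opprK mulr2n.
  have c00 : c = 0 by lra.
  rewrite c00 mul0rn.
  by [].
have mc : measurable (`[- c, c]%classic : set RT) by exact: measurable_itv.
rewrite [LHS](_ : _ = (mu \x lebesgue_tuple n)%E (`[- c, c]%classic `*` @cube n c)).
  rewrite product_measure1E//; last exact: measurable_cube.
  by rewrite IH [X in (X * _)%E]lc exprS.
rewrite /= /pushforward; congr ((mu \x lebesgue_tuple n)%E _).
apply/seteqP; split => -[a v] /=.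
  move=> H; split; first by have := H ord0; rewrite tnth0 in_itv/= -ler_norml.
  by move=> i; have := H (lift ord0 i); rewrite tnthS.
move=> [ac vc] i; case: (unliftP ord0 i) => [j|] ->.
  by rewrite tnthS; exact: vc.
by rewrite tnth0; move: ac; rewrite in_itv/= -ler_norml.
Qed.

Lemma measurable_unit_tball n : measurable (@unit_tball R n).
Proof.
rewrite /unit_tball.
apply: (@closed_measurable_tuple R n [set x | enorm (x - 0) <= 1]).
apply: (@closed_comp _ _ (fun x : 'rV[R]_n => enorm (x - 0)) [set y | y <= 1]).
  by move=> x _; under eq_fun do rewrite subr0; exact: enorm_continuous.
exact: closed_le.
Qed.

Lemma unit_tball_gt0 n : (0 < lebesgue_tuple n (@unit_tball R n))%E.
Proof.
have n1 : 0 < n%:R + 1 :> R by rewrite ltr_wpDl.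
have c0 : 0 < (n%:R + 1)^-1 :> R by rewrite invr_gt0.
apply: (@lt_le_trans _ _ (lebesgue_tuple n (@cube n (n%:R + 1)^-1))).
  by rewrite lebesgue_tuple_cube ?ltW// lte_fin exprn_gt0// mulrn_wgt0.
apply: le_measure; rewrite ?inE.
- exact: measurable_cube.
- exact: measurable_unit_tball.
move=> t tc; rewrite /unit_tball /eball/= subr0.
apply: (le_trans (enorm_le_mx_norm _)).
apply: (@le_trans _ _ (n%:R * (n%:R + 1)^-1)).
  rewrite ler_wpM2l//; apply: mx_norm_le => [|i j]; first exact: ltW.
  by rewrite mxE; exact: tc.
by rewrite ler_pdivrMr// mul1r lerDl.
Qed.

Lemma unit_tball_lty n : (lebesgue_tuple n (@unit_tball R n) < +oo)%E.
Proof.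
apply: (@le_lt_trans _ _ (lebesgue_tuple n (@cube n 1))); last first.
  by rewrite lebesgue_tuple_cube// ltry.
apply: le_measure; rewrite ?inE.
- exact: measurable_unit_tball.
- exact: measurable_cube.
move=> t; rewrite /unit_tball /eball/= subr0 => t1 i.
by apply: le_trans t1; have := normr_coord_le_enorm (row_of_tuple t) i; rewrite mxE.
Qed.

End unit_ball.

Section mean.
Context d (T : measurableType d) (R : realType) (mu : {measure set T -> \bar R}).
Variable B : set T.
Hypothesis mB : measurable B.
Hypothesis B_gt0 : (0 < mu B)%E.
Hypothesis B_lty : (mu B < +oo)%E.

(** [unif_ball_mean] with the measure and the ball abstracted; on the unit ball the two are
    convertible, which is what [smoothingE] exploits. *)
Definition mean (f : T -> R) : R := (fine (mu B))^-1 * \int[mu]_(t in B) f t.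

(** Since [mu B] is finite, the explicit bound yields integrability, and it serves as the dominating
    constant in [mean_ae_cvg0]. *)
Definition bmeas (M : R) (f : T -> R) :=
  measurable_fun B f /\ forall t, B t -> `|f t| <= M.

Let fB_gt0 : 0 < fine (mu B). Proof. by rewrite fine_gt0// B_gt0. Qed.

Lemma bmeas_integrable M f : bmeas M f -> mu.-integrable B (EFin \o f).
Proof.
move=> [mf fM]; apply: measurable_bounded_integrable => //.
exists M; split; first exact: num_real.
by move=> x Mx t Bt; apply: le_trans (fM t Bt) (ltW Mx).
Qed.

Lemma bmeasZ M f a : bmeas M f -> bmeas (`|a| * M) (fun t => a * f t).
Proof.
move=> [mf fM]; split; first exact: measurable_funM.
by move=> t Bt; rewrite normrM ler_wpM2l// fM.
Qed.

Lemma bmeasB M N f g : bmeas M f -> bmeas N g -> bmeas (M + N) (fun t => f t - g t).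
Proof.
move=> [mf fM] [mg gN]; split; first exact: measurable_funB.
by move=> t Bt; rewrite (le_trans (ler_normB _ _))// lerD// ?fM// gN.
Qed.

Lemma meanD M N f g : bmeas M f -> bmeas N g ->
  mean (fun t => f t + g t) = mean f + mean g.
Proof.
move=> /bmeas_integrable fi /bmeas_integrable gi.
by rewrite /mean RintegralD// mulrDr.
Qed.

Lemma meanZ M f a : bmeas M f -> mean (fun t => a * f t) = a * mean f.
Proof.
by move=> /bmeas_integrable fi; rewrite /mean RintegralZl// mulrCA.
Qed.

Lemma meanB M N f g : bmeas M f -> bmeas N g ->
  mean (fun t => f t - g t) = mean f - mean g.
Proof.
move=> /bmeas_integrable fi /bmeas_integrable gi.
by rewrite /mean RintegralB// mulrBr.
Qed.

Lemma mean_cst a : mean (fun=> a) = a.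
Proof. by rewrite /mean Rintegral_cst// mulrCA mulVf ?mulr1// gt_eqF. Qed.

Lemma bmeas_sum n (f : 'I_n -> T -> R) (M : 'I_n -> R) :
  (forall i, bmeas (M i) (f i)) -> bmeas (\sum_i M i) (fun t => \sum_i f i t).
Proof.
move=> fM; split; first by apply: measurable_sum => i; have [] := fM i.
move=> t Bt; apply: le_trans (ler_norm_sum _ _ _) _.
by apply: ler_sum => i _; have [_] := fM i; exact.
Qed.

Lemma mean_sum n (f : 'I_n -> T -> R) (M : 'I_n -> R) :
  (forall i, bmeas (M i) (f i)) -> mean (fun t => \sum_i f i t) = \sum_i mean (f i).
Proof.
elim: n f M => [|n IH] f M fM.
  by rewrite big_ord0; under eq_fun do rewrite big_ord0; rewrite mean_cst.
rewrite big_ord_recl; under eq_fun do rewrite big_ord_recl.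
rewrite (meanD (fM ord0) (bmeas_sum (fun i => fM (lift ord0 i)))).
by rewrite (IH _ (fun i => M (lift ord0 i))).
Qed.

Lemma mean_ae_le M f K : bmeas M f -> {ae mu, forall t, B t -> f t <= K} ->
  mean f <= K.
Proof.
move=> fM [N [mN N0 fN]].
have fi := bmeas_integrable fM.
have fin_int : \int[mu]_(t in B) f t = \int[mu]_(t in B `\` N) f t.
  by rewrite /Rintegral (negligible_integral mN mB fi N0).
have KE : K = mean (fun=> K) by rewrite mean_cst.
rewrite [leRHS]KE /mean ler_pM2l ?invr_gt0// fin_int.
have ki : mu.-integrable B (EFin \o (fun=> K)).
  by apply: (@bmeas_integrable `|K|); split => //; exact: measurable_cst.
have -> : \int[mu]_(t in B) K = \int[mu]_(t in B `\` N) K.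
  by rewrite /Rintegral (negligible_integral mN mB ki N0).
have mBN : measurable (B `\` N) by exact: measurableD.
apply: le_Rintegral => //.
- exact: integrableS fi.
- exact: integrableS ki.
- move=> t [Bt Nt]; apply: contrapT => nf; apply: Nt; apply: fN => /= H.
  by apply: nf; exact: H.
Qed.

Lemma mean_ae_cvg0 M (f : nat -> T -> R) : (forall k, bmeas M (f k)) ->
  {ae mu, forall t, B t -> f ^~ t @ \oo --> (0 : R)} ->
  (fun k => mean (f k)) @ \oo --> (0 : R).
Proof.
move=> fM f0.
have Mi : mu.-integrable B (EFin \o (fun=> M)).
  by apply: (@bmeas_integrable `|M|); split => //; exact: measurable_cst.
have [| | | |_ _] := @dominated_convergence _ T R mu B mB
    (fun k t => (f k t)%:E) (cst 0%E) (EFin \o (fun=> M)) _ _ _ Mi _.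
- by move=> k; apply/measurable_EFinP; have [] := fM k.
- exact: measurable_cst.
- apply: negligibleS f0 => t; apply: contra_not => H Bt.
  by apply: cvg_EFin; [exact: nearW|exact: H].
- by apply: aeW => t k Bt; rewrite lee_fin; have [_] := fM k; exact.
rewrite integral0 => /fine_cvgP[_] cv.
rewrite -(mulr0 (fine (mu B))^-1).
by apply: cvgM; [exact: cvg_cst|exact: cv].
Qed.

End mean.

(** * Gradients in epsilon form *)

Section gradient.
Context {R : realType}.

Definition is_grad n (f : 'rV[R]_n -> R) (p g : 'rV[R]_n) :=
  forall e, 0 < e -> exists2 r, 0 < r & approx_at id f e r g p.

(** Both sides are positively homogeneous in [h], so [h] can be rescaled into the ball. *)
Lemma dotp_le_near0 n (b : 'rV[R]_n) C r : 0 < r ->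
  (forall h, enorm h < r -> dotp b h <= C * enorm h) ->
  forall h, dotp b h <= C * enorm h.
Proof.
move=> r0 H h; have [h0|h0] := eqVneq (enorm h) 0.
  by rewrite (enorm_eq0 h0) dotp0r enorm0 mulr0.
have hp : 0 < enorm h by rewrite lt_def h0 enorm_ge0.
pose s := r / (2 * enorm h).
have s0 : 0 < s by rewrite divr_gt0// mulr_gt0.
have nsh : enorm (s *: h) = s * enorm h by rewrite enormZ gtr0_norm.
have := H (s *: h); rewrite nsh dotpZr mulrCA ler_pM2l//; apply.
rewrite /s invfM mulrA -mulrA mulVf ?mulr1//; lra.
Qed.

Lemma enorm_le_dotp n (b : 'rV[R]_n) C :
  (forall h, dotp b h <= C * enorm h) -> 0 <= C -> enorm b <= C.
Proof.
move=> H C0; have [->//|b0] := eqVneq (enorm b) 0.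
have bp : 0 < enorm b by rewrite lt_def b0 enorm_ge0.
by have := H b; rewrite -enorm_sqr expr2 ler_pM2r.
Qed.

(** Subtracting the two approximations bounds the linear form [a1 - a2] near 0, hence everywhere.
    This gives the uniqueness of gradients and, in [diff_along_is_grad], the Cauchy property of
    approximate ones. *)
Lemma approx_at_close n (f : 'rV[R]_n -> R) p e1 e2 r1 r2 a1 a2 :
  0 < e1 -> 0 < e2 -> 0 < r1 -> 0 < r2 ->
  approx_at id f e1 r1 a1 p -> approx_at id f e2 r2 a2 p ->
  enorm (a1 - a2) <= e1 + e2.
Proof.
move=> e10 e20 r10 r20 A1 A2; apply: enorm_le_dotp; last by rewrite addr_ge0 ?ltW.
apply: (@dotp_le_near0 _ _ _ (Num.min r1 r2)); first by rewrite lt_min r10.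
move=> h; rewrite lt_min => /andP[/A1 + /A2]; rewrite dotpBl mulrDl.
by rewrite !ler_norml => /andP[? ?] /andP[? ?]; lra.
Qed.

Lemma is_grad_uniq n (f : 'rV[R]_n -> R) p g1 g2 :
  is_grad f p g1 -> is_grad f p g2 -> g1 = g2.
Proof.
move=> H1 H2; apply/eqP; rewrite -subr_eq0; apply/eqP/enorm_eq0.
apply/eqP; rewrite eq_le enorm_ge0 andbT; apply/ler_addgt0Pr => e e0.
have e2 : 0 < e / 2 by rewrite divr_gt0.
have [r1 r10 A1] := H1 _ e2; have [r2 r20 A2] := H2 _ e2.
by have := approx_at_close e2 e2 r10 r20 A1 A2; rewrite add0r; lra.
Qed.

Lemma is_grad_bound n (f : 'rV[R]_n -> R) L p g : 0 <= L ->
  (forall u v, `|f u - f v| <= L * enorm (u - v)) ->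
  is_grad f p g -> enorm g <= L.
Proof.
move=> L0 fL fg; apply/ler_addgt0Pr => e e0.
have [r r0 A] := fg _ e0.
apply: enorm_le_dotp; last by rewrite addr_ge0// ltW.
apply: (dotp_le_near0 r0) => h /A.
have := fL (p + h) p; rewrite addrAC subrr add0r mulrDl.
by rewrite !ler_norml => /andP[? ?] /andP[? ?]; lra.
Qed.

Lemma diff_along_is_grad n (f : 'rV[R]_n -> R) p :
  diff_along id f p -> exists g, is_grad f p g.
Proof.
move=> df.
pose E k : R := k.+1%:R^-1.
have E0 k : 0 < E k by rewrite invr_gt0.
have /choice[a aP] : forall k, exists b, exists2 r, 0 < r & approx_at id f (E k) r b p.
  by move=> k; exact: df.
have ac k l i : `|a k 0 i - a l 0 i| <= E k + E l.
  have [r1 r10 A1] := aP k; have [r2 r20 A2] := aP l.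
  apply: le_trans (approx_at_close (E0 k) (E0 l) r10 r20 A1 A2).
  by have := normr_coord_le_enorm (a k - a l) i; rewrite !mxE.
(* The limit is built coordinatewise. By [ac], each lower bound [a k 0 i - E k] lies below each
   upper bound [a l 0 i + E l], so the supremum of the lower bounds is within [E k] of [a k 0 i] for
   every [k]. *)
pose S i := [set x : R | exists k, x = a k 0 i - E k].
have Sub i k : ubound (S i) (a k 0 i + E k).
  by move=> x [l ->]; have := ac k l i; rewrite ler_norml => /andP[? ?]; lra.
pose g : 'rV[R]_n := \row_i sup (S i).
have ga k i : `|g 0 i - a k 0 i| <= E k.
  have hS : has_sup (S i) by split; [exists (a k 0 i - E k), k|exists (a k 0 i + E k)].
  rewrite mxE ler_norml; apply/andP; split.
    by rewrite lerBrDl; apply: ub_le_sup; [exact: hS.2|exists k; rewrite addrC].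
  by rewrite lerBlDl addrC; apply: ge_sup; [exact: hS.1|rewrite addrC; exact: Sub].
exists g => e e0.
have n0 : 0 < n%:R + 2 :> R by rewrite ltr_wpDl.
have [k ke] : exists k : nat, E k < e / (n%:R + 2).
  have en : 0 < e / (n%:R + 2) by rewrite divr_gt0.
  by near \oo => i; exists i; near: i; exact: near_infty_natSinv_lt (PosNum en).
have [r r0 A] := aP k; exists r => // h /A.
have : `|dotp (g - a k) h| <= n%:R * E k * enorm h.
  apply: le_trans (cauchy_schwarz _ _) _; apply: ler_wpM2r; first exact: enorm_ge0.
  apply: le_trans (enorm_le_mx_norm _) _; apply: ler_wpM2l => //.
  apply: mx_norm_le; first exact: ltW.
  by move=> i j; rewrite ord1; have := ga k j; rewrite !mxE.
rewrite dotpBl => h1 h2.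
have : (n%:R + 1) * E k * enorm h <= e * enorm h.
  apply: ler_wpM2r; first exact: enorm_ge0.
  apply: (@le_trans _ _ ((n%:R + 2) * E k)).
    by rewrite ler_wpM2r ?ltW//; lra.
  by rewrite mulrC -ler_pdivlMr// ltW.
apply: le_trans.
rewrite (_ : _ - _ = (f (p + id h) - f p - dotp (a k) h) - (dotp g h - dotp (a k) h)); last by ring.
by rewrite (le_trans (ler_normB _ _))// mulrDl mul1r mulrDl addrC lerD.
Unshelve. all: by end_near. Qed.

End gradient.

Section smoothing_of_lipschitz.
Context {R : realType} (n : nat).
Local Notation RT := (measurableTypeR R).
Local Notation mu := (@lebesgue_tuple R n).
Local Notation B := (@unit_tball R n).
Local Notation E := (mean mu B).

Section unit_scale.
Variables (L : R) (f : 'rV[R]_n -> R).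
Hypothesis L0 : 0 <= L.
Hypothesis fL : forall u v, `|f u - f v| <= L * enorm (u - v).

Let cf : continuous f := elipschitz_continuous fL.

Let mB : measurable B := @measurable_unit_tball R n.
Let B0 : (0 < mu B)%E := @unit_tball_gt0 R n.
Let B1 : (mu B < +oo)%E := @unit_tball_lty R n.

(** The gradient where it exists, with default 0 elsewhere so that the bound by [L] holds
    everywhere. *)
Let G (t : n.-tuple RT) : 'rV[R]_n :=
  if pselect (diff_along id f (row_of_tuple t)) is left H
  then sval (cid (diff_along_is_grad H)) else 0.

Let GP t : diff_along id f (row_of_tuple t) -> is_grad f (row_of_tuple t) (G t).
Proof. by rewrite /G; case: pselect => // H _; case: cid. Qed.

Let G0 t : ~ diff_along id f (row_of_tuple t) -> G t = 0.
Proof. by rewrite /G; case: pselect. Qed.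

Let GL t : enorm (G t) <= L.
Proof.
have [H|H] := pselect (diff_along id f (row_of_tuple t)).
  exact: is_grad_bound L0 fL (GP H).
by rewrite G0// enorm0.
Qed.

Let continuous_shift (h : 'rV[R]_n) : continuous (fun u : 'rV[R]_n => f (h + u)).
Proof.
apply: (@elipschitz_continuous _ _ L) => u v.
by rewrite (le_trans (fL _ _))// opprD addrACA subrr add0r.
Qed.

Let mfs h : measurable_fun setT (fun t : n.-tuple RT => f (h + row_of_tuple t)).
Proof. exact: (measurable_continuous_tuple (@continuous_shift h)). Qed.

(** [G] is picked by choice, so its measurability comes from a formula: it is the pointwise limit of
    difference quotients multiplied by the indicator of the measurable set [D], the indicator
    reproducing the default 0. *)
Let mG i : measurable_fun setT (fun t => G t 0 i).
Proof.
pose D := [set t : n.-tuple RT | diff_along id f (row_of_tuple t)].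
have mD : measurable D by exact: measurable_diff_along.
pose e : 'rV[R]_n := delta_mx 0 i.
have de (g : 'rV[R]_n) : dotp g e = g 0 i.
  rewrite /dotp (bigD1 i)//= mxE !eqxx mulr1 big1 ?addr0// => j /negPf ji.
  by rewrite mxE ji andbF mulr0.
pose s (k : nat) : R := k.+1%:R^-1.
have s0 k : 0 < s k by rewrite invr_gt0.
pose q k (t : n.-tuple RT) : R :=
  \1_D t * ((s k)^-1 * (f (s k *: e + row_of_tuple t) - f (0 + row_of_tuple t))).
apply: (@measurable_fun_cvg _ _ _ _ q).
  move=> k; apply: measurable_funM; first exact: measurable_indic.
  by apply: measurable_funM => //; apply: measurable_funB.
move=> t _; have [Dt|nD] := pselect (D t); last first.
  rewrite G0// mxE /q; apply: cvg_near_cst; apply: nearW => k.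
  by rewrite indicE memNset// mul0r.
apply/cvgrPdist_le => eps eps0.
have e1 : 0 < enorm e + 1 by rewrite ltr_wpDl ?enorm_ge0.
have [r r0 A] := GP Dt (divr_gt0 eps0 e1).
have re : 0 < r / (enorm e + 1) by rewrite divr_gt0.
near=> k.
have sk : s k < r / (enorm e + 1).
  by near: k; exact: near_infty_natSinv_lt (PosNum re).
have nse : enorm (s k *: e) = s k * enorm e by rewrite enormZ gtr0_norm.
have := A (s k *: e).
have le1 : s k * enorm e <= s k * (enorm e + 1) by rewrite ler_wpM2l ?ltW// ltrDl.
rewrite nse dotpZr de => /(_ _)H.
have {}H := H (le_lt_trans le1 _).
rewrite -ltr_pdivlMr// in H; move: H => /(_ sk) H.
rewrite /q indicE mem_set// mul1r add0r.
have -> : G t 0 i - (s k)^-1 * (f (s k *: e + row_of_tuple t) - f (row_of_tuple t)) =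
   - (s k)^-1 * (f (row_of_tuple t + id (s k *: e)) - f (row_of_tuple t) - s k * G t 0 i).
  by rewrite (addrC (s k *: e)); field; rewrite gt_eqF.
have sk0 : 0 < (s k)^-1 by rewrite invr_gt0.
rewrite normrM normrN (gtr0_norm sk0) ler_pdivrMl//.
apply: (le_trans H); rewrite mulrCA ler_pM2l//.
by rewrite mulrAC ler_pdivrMr// ler_pM2l// lerDl.
Unshelve. all: by end_near. Qed.

Let bG i : bmeas B L (fun t => G t 0 i).
Proof.
split; first exact: measurable_funTS.
by move=> t _; exact: le_trans (normr_coord_le_enorm _ _) (GL t).
Qed.

Let bGd (d : 'rV[R]_n) : bmeas B (\sum_i (`|d 0 i| * L)) (fun t => dotp d (G t)).
Proof. by apply: bmeas_sum => i; exact: bmeasZ. Qed.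

Lemma bmeas_shift h : bmeas B (`|f h| + L) (fun t => f (h + row_of_tuple t)).
Proof.
split; first exact: measurable_funTS.
move=> t; rewrite /unit_tball/= /eball/= subr0 => t1.
rewrite -[f (h + _)](subrK (f h)) (le_trans (ler_normD _ _))// addrC lerD2l.
apply: (le_trans (fL _ _)); rewrite addrAC subrr add0r.
by rewrite -[leRHS]mulr1 ler_wpM2l.
Qed.

Let a : 'rV[R]_n := \row_i E (fun t => G t 0 i).

Let aE (d : 'rV[R]_n) : dotp a d = E (fun t => dotp d (G t)).
Proof.
rewrite dotpC /dotp (mean_sum _ _ _ (fun i => bmeasZ (d 0 i) (bG i)))//.
by apply: eq_bigr => i _; rewrite (meanZ _ _ _ (bG i))// mxE.
Qed.

Let aeD : {ae mu, forall t, diff_along id f (row_of_tuple t)} := rademacher L0 fL.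

(** Differentiation under the integral sign. A failure of differentiability yields a sequence [h k]
    tending to 0 along which the normalized remainder of the mean stays above [e]; but this
    remainder is the mean of [phi k], which is bounded and tends to 0 almost everywhere. *)
Lemma is_grad_mean_shift : is_grad (fun k => E (fun t => f (k + row_of_tuple t))) 0 a.
Proof.
apply: contrapT => /existsNP[e /not_implyP[e0 ne]].
have /choice[h hP] : forall k : nat, exists h, enorm h < k.+1%:R^-1 /\
    ~ `|E (fun t => f (0 + h + row_of_tuple t)) - E (fun t => f (0 + row_of_tuple t))
        - dotp a h| <= e * enorm h.
  move=> k; apply: contrapT => nh; apply: ne; exists k.+1%:R^-1.
    by rewrite invr_gt0.
  by move=> h hk; apply: contrapT => H; apply: nh; exists h.
have h0 k : 0 < enorm (h k).
  rewrite lt_def enorm_ge0 andbT; apply/eqP => hk0; have [_] := hP k; apply.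
  by rewrite (enorm_eq0 hk0) addr0 dotp0r subrr subr0 normr0 enorm0 mulr0.
pose phi k t := (enorm (h k))^-1 * (f (h k + row_of_tuple t) - f (0 + row_of_tuple t)
   - dotp (h k) (G t)).
have hi k : 0 < (enorm (h k))^-1 by rewrite invr_gt0.
have bdf k := bmeasB (bmeas_shift (h k)) (bmeas_shift 0).
have bdiff k := bmeasB (bdf k) (bGd (h k)).
have Ephi k : E (phi k) = (enorm (h k))^-1 *
    (E (fun t => f (h k + row_of_tuple t)) - E (fun t => f (0 + row_of_tuple t)) - dotp a (h k)).
  by rewrite (meanZ mB B1 _ (bdiff k)) (meanB mB B1 (bdf k) (bGd _)) (meanB mB B1 (bmeas_shift _) (bmeas_shift 0)) aE.
(* One [L] bounds the difference quotient of [f], the other the gradient [G t]; together they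
   dominate uniformly in [k]. *)
have bphi k : bmeas B (2 * L) (phi k).
  split; first by have [] := bmeasZ (enorm (h k))^-1 (bdiff k).
  move=> t _; rewrite normrM (gtr0_norm (hi k)) ler_pdivrMl//.
  rewrite (le_trans (ler_normB _ _))// mulrC mulrDl mul1r mulrDl lerD//.
    apply: (le_trans (fL _ _)).
    by rewrite (_ : h k + _ - _ = h k)//; rewrite add0r addrK.
  apply: (le_trans (cauchy_schwarz _ _)); rewrite [leLHS]mulrC.
  exact: ler_wpM2r (enorm_ge0 _) _ _ (GL t).
have phi0 : {ae mu, forall t, B t -> phi ^~ t @ \oo --> (0 : R)}.
  apply: negligibleS aeD => t; apply: contra_not => dt _.
  apply/cvgrPdist_le => eps eps0.
  have [r r0 A] := GP dt eps0.
  near=> k.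
  have kr : enorm (h k) < r.
    apply: (lt_trans (hP k).1).
    by near: k; exact: near_infty_natSinv_lt (PosNum r0).
  have := A _ kr; rewrite sub0r normrN /phi add0r dotpC (addrC _ (h k)).
  by rewrite normrM (gtr0_norm (hi k)) ler_pdivrMl// mulrC.
have /cvgrPdist_le /(_ e e0) := mean_ae_cvg0 mB B1 bphi phi0.
move=> [k _ /(_ k (leqnn k))]; rewrite /= sub0r normrN Ephi.
have [_] := hP k; rewrite add0r normrM (gtr0_norm (hi k)) => nle.
by rewrite ler_pdivrMl// mulrC.
Unshelve. all: by end_near. Qed.

(** A mean cannot exceed almost all the values it averages by a fixed amount. The extra almost sure
    property [P] lets the caller demand more of the sample point, such as differentiability of every
    coordinate of a map of which [f] is only a combination. *)
Lemma mean_shift_grad_le (d : 'rV[R]_n) (eta : R) (P : n.-tuple RT -> Prop) :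
  0 < eta -> {ae mu, forall t, P t} ->
  exists t g, [/\ B t, P t, is_grad f (row_of_tuple t) g
                & dotp a d - eta <= dotp g d].
Proof.
move=> eta0 aeP; apply: contrapT => nex.
have : E (fun t => dotp d (G t)) <= dotp a d - eta.
  apply: (mean_ae_le mB B0 B1 (bGd d)).
  have := negligibleU aeP aeD; apply: negligibleS => t.
  move=> /= /not_implyP[Bt /negP]; rewrite -ltNge => lt.
  have [Pt|] := pselect (P t); last by left.
  right => dt; apply: nex; exists t, (G t); split => //; first exact: GP.
  by rewrite [leRHS]dotpC ltW.
by rewrite -aE; lra.
Qed.

End unit_scale.

End smoothing_of_lipschitz.

(** * Epsilon form and Frechet differential *)

Section differential_epsilon.
Context {R : realType}.

Lemma differentiable_epsilon (V W : normedModType R) (f : V -> W) (x : V)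
    (df : {linear V -> W}) : continuous df ->
  (forall e, 0 < e -> \forall h \near (0 : V), `|f (h + x) - f x - df h| <= e * `|h|) ->
  differentiable f x /\ 'd f x = df :> (V -> W).
Proof.
move=> cdf H.
have o1 : f \o shift x = cst (f x) + df +o_ 0 id.
  apply/eqaddoP => e e0; apply: filterS (H e e0) => h.
  by rewrite -[(_ - _) h]/(f (h + x) - (f x + df h)) opprD addrA.
have dE := diff_unique cdf o1.
by split => //; apply/diff_locallyP; rewrite dE.
Qed.

Lemma epsilon_differentiable (V W : normedModType R) (f : V -> W) (x : V) :
  differentiable f x -> forall e, 0 < e ->
  \forall h \near (0 : V), `|f (h + x) - f x - 'd f x h| <= e * `|h|.
Proof.
move=> /diff_locallyP[_ /eqaddoP H] e e0; apply: filterS (H e e0) => h.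
by rewrite -[(_ - _) h]/(f (h + x) - (f x + 'd f x h)) opprD addrA.
Qed.

Lemma row_linear_sum (W : lmodType R) n (df : {linear 'rV[R]_n -> W}) h :
  df h = \sum_i h 0 i *: df (delta_mx 0 i).
Proof.
by rewrite [in LHS](row_sum_delta h) linear_sum; apply: eq_bigr => i _; rewrite linearZ.
Qed.

Lemma row_linear_continuous (W : normedModType R) n (df : {linear 'rV[R]_n -> W}) :
  continuous df.
Proof.
move=> x; pose C := \sum_i `|df (delta_mx 0 i)|.
have dC h : `|df h| <= C * `|h|.
  rewrite row_linear_sum (le_trans (ler_norm_sum _ _ _))// mulr_suml.
  by apply: ler_sum => i _; rewrite normrZ mulrC ler_wpM2l// normr_coord_le.
have C1 : 0 < C + 1 by rewrite ltr_wpDl// sumr_ge0.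
apply/(@cvgrPdist_le _ _ _ (nbhs x) (nbhs_filter x)) => e e0.
have e1 : 0 < e / (C + 1) by rewrite divr_gt0.
apply/nbhs_ballP; exists (e / (C + 1)) => // y; rewrite -ball_normE/= => xy.
rewrite -linearB (le_trans (dC _))//; apply: (@le_trans _ _ ((C + 1) * `|x - y|)).
  by rewrite ler_wpM2r// lerDl.
by rewrite mulrC -ler_pdivlMr// ltW.
Qed.

Lemma near0_enormP n (P : set 'rV[R]_n) :
  (\forall h \near (0 : 'rV[R]_n), P h) <->
  exists2 r, 0 < r & forall h, enorm h < r -> P h.
Proof.
split=> [/nbhs_enormP[r r0 rP]|[r r0 rP]].
  by exists r => // h /rP; rewrite add0r.
by apply/nbhs_enormP; exists r => // h hr; rewrite add0r; exact: rP.
Qed.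

Lemma is_grad_near n (f : 'rV[R]_n -> R) p g :
  is_grad f p g <-> forall e, 0 < e ->
    \forall h \near (0 : 'rV[R]_n), `|f (h + p) - f p - dotp g h| <= e * `|h|.
Proof.
split=> H e e0.
  have n0 : 0 < n%:R + 1 :> R by rewrite ltr_wpDl.
  have [r r0 A] := H _ (divr_gt0 e0 n0).
  apply/near0_enormP; exists r => // h hr; rewrite (addrC h); apply: le_trans (A h hr) _.
  rewrite mulrAC ler_pdivrMr// -mulrA ler_pM2l// mulrC.
  by rewrite (le_trans (enorm_le_mx_norm _))// ler_wpM2r// lerDl.
have /near0_enormP[r r0 A] := H e e0.
exists r => // h hr; rewrite /= (addrC p); apply: le_trans (A h hr) _.
by rewrite ler_pM2l// mx_norm_le_enorm.
Qed.

Lemma dotp_is_linear n (g : 'rV[R]_n) : linear (dotp g : 'rV[R]_n -> R^o).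
Proof. by move=> a u v; rewrite dotpDr dotpZr. Qed.

Lemma dotp_delta n (g : 'rV[R]_n) i : dotp g (delta_mx 0 i) = g 0 i.
Proof.
rewrite /dotp (bigD1 i)//= mxE !eqxx mulr1 big1 ?addr0// => j /negPf ji.
by rewrite mxE ji andbF mulr0.
Qed.

Lemma is_gradP n (f : 'rV[R]_n -> R) p g : is_grad f p g <->
  differentiable (f : 'rV[R]_n -> R^o) p /\ grad f p = g.
Proof.
split=> [/is_grad_near fg|[df <-]].
  pose dL := GRing.isLinear.Build _ _ _ _ _ (dotp_is_linear g).
  pose D : {linear 'rV[R]_n -> R^o} := HB.pack (dotp g : _ -> R^o) dL.
  have [df dE] := @differentiable_epsilon _ _ (f : _ -> R^o) p D
    (@row_linear_continuous _ _ D) fg.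
  split => //; apply/rowP => i; rewrite mxE.
  by rewrite [LHS](congr1 (fun F => F (delta_mx 0 i)) dE) /= dotp_delta.
apply/is_grad_near => e e0; apply: filterS (epsilon_differentiable df e0) => h.
rewrite (_ : dotp (grad f p) h = 'd (f : 'rV[R]_n -> R^o) p h)//.
by rewrite row_linear_sum dotpC; apply: eq_bigr => i _; rewrite mxE.
Qed.

Lemma is_grad_JacP n m (F : 'rV[R]_n -> 'rV[R]_m) p (M : 'M[R]_(m, n)) :
  (forall j, is_grad (fun u => F u 0 j) p (row j M)) <->
  differentiable F p /\ Jac F p = M.
Proof.
have rE (N : 'M[R]_(m, n)) h j : (h *m N^T) 0 j = dotp (row j N) h.
  by rewrite mxE dotpC; apply: eq_bigr => i _; rewrite !mxE.
split=> [FM|[dF <-] j].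
  have FM' e : 0 < e ->
      \forall h \near (0 : 'rV[R]_n), `|F (h + p) - F p - mulmxr M^T h| <= e * `|h|.
    move=> e0.
    have : \forall h \near (0 : 'rV[R]_n), forall j,
        `|F (h + p) 0 j - F p 0 j - dotp (row j M) h| <= e * `|h|.
      have F0 : Filter (nbhs (0 : 'rV[R]_n)) := nbhs_filter _.
      apply: (@filter_forall _ _
        (fun j h => `|F (h + p) 0 j - F p 0 j - dotp (row j M) h| <= e * `|h|) _ F0) => j.
      exact: (proj1 (is_grad_near _ _ _) (FM j) e e0).
    apply: filterS => h H; apply: mx_norm_le => [|i j]; first by rewrite mulr_ge0// ltW.
    by rewrite ord1; have := H j; rewrite -rE !mxE.
  have [dF dE] := differentiable_epsilon (@row_linear_continuous _ _ (mulmxr M^T)) FM'.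
  split => //; rewrite /Jac /jacobian; apply/matrixP => i j.
  by rewrite 2!mxE dE/= -rowE !mxE.
apply/is_grad_near => e e0; apply: filterS (epsilon_differentiable dF e0) => h.
apply: le_trans; rewrite -rE /Jac trmxK /jacobian mul_rV_lin1.
have := normr_coord_le (F (h + p) - F p - 'd F p h) 0 j.
by rewrite !mxE.
Qed.

End differential_epsilon.

Section smoothing_differentiable.
Context {R : realType}.

(** Carries results on the unit ball over to a smoothing of radius [rho] centred at [u]. *)
Lemma is_grad_rescale n (f : 'rV[R]_n -> R) u (rho : R) t g : 0 < rho ->
  is_grad (fun k => f (u + rho *: k)) t g -> is_grad f (u + rho *: t) (rho^-1 *: g).
Proof.
move=> r0 fg e e0; have [r r1 A] := fg _ (mulr_gt0 e0 r0).
exists (r * rho); first exact: mulr_gt0.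
move=> h hr.
have nh : enorm (rho^-1 *: h) = rho^-1 * enorm h.
  by rewrite enormZ gtr0_norm// invr_gt0.
have := A (rho^-1 *: h); rewrite nh mulrC ltr_pdivrMr// => /(_ hr).
rewrite /= scalerDr addrA scalerA divff ?gt_eqF// scale1r dotpZl dotpZr.
by have -> : e * rho * (enorm h / rho) = e * enorm h by field; rewrite gt_eqF.
Qed.

Lemma is_grad_dotp n m (F : 'rV[R]_n -> 'rV[R]_m) p w : differentiable F p ->
  is_grad (fun u => dotp w (F u)) p (w *m Jac F p).
Proof.
move=> dF; apply/is_grad_near => e e0.
have C0 : 0 < enorm w * m%:R + 1 by rewrite ltr_wpDl// mulr_ge0// enorm_ge0.
apply: filterS (epsilon_differentiable dF (divr_gt0 e0 C0)) => h H.
have -> : dotp (w *m Jac F p) h = dotp w ('d F p h).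
  rewrite -mul_rV_lin1 -/(jacobian F p) /dotp.
  under eq_bigr do rewrite mxE mulr_suml.
  under [RHS]eq_bigr do rewrite mxE mulr_sumr.
  rewrite exchange_big/=; apply: eq_bigr => j _; apply: eq_bigr => i _.
  by rewrite -mulrA [Jac F p j i]mxE (mulrC (h 0 i)).
rewrite -!dotpBr (le_trans (cauchy_schwarz _ _))//.
apply: (@le_trans _ _ ((enorm w * m%:R + 1) * `|F (h + p) - F p - 'd F p h|)).
  rewrite mulrDl -mulrA mul1r; apply: ler_wpDr => //.
  by rewrite ler_wpM2l ?enorm_ge0// enorm_le_mx_norm.
by rewrite mulrC -ler_pdivlMr// mulrAC.
Qed.

Lemma smoothingE n m (y : 'rV[R]_n -> 'rV[R]_m) rho u j :
  smoothing y rho u 0 j =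
  mean (lebesgue_tuple n) (@unit_tball R n) (fun t => y (u + rho *: row_of_tuple t) 0 j).
Proof. by rewrite mxE. Qed.

Variables (n m : nat) (L : R) (y : 'rV[R]_n -> 'rV[R]_m).
Hypothesis L0 : 0 <= L.
Hypothesis yL : forall j u v, `|y u 0 j - y v 0 j| <= L * enorm (u - v).
Variables (rho : R) (u : 'rV[R]_n).
Hypothesis rho0 : 0 < rho.

Let Lr0 : 0 <= L * rho. Proof. by rewrite mulr_ge0// ltW. Qed.

Let yLr j k l : `|y (u + rho *: k) 0 j - y (u + rho *: l) 0 j| <= L * rho * enorm (k - l).
Proof.
apply: (le_trans (yL _ _ _)); rewrite opprD addrACA subrr add0r -scalerBr.
by rewrite enormZ gtr0_norm// mulrA.
Qed.

Let B := @unit_tball R n.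
Let E := mean (lebesgue_tuple n) B.

Let mB := @measurable_unit_tball R n.
Let B0 := @unit_tball_gt0 R n.
Let B1 := @unit_tball_lty R n.

Lemma smoothing_differentiable : differentiable (smoothing y rho) u.
Proof.
pose yj j k := y (u + rho *: k) 0 j.
have /choice[a aP] : forall j, exists b,
    is_grad (fun k => E (fun t => yj j (k + row_of_tuple t))) 0 b.
  by move=> j; eexists; exact: (is_grad_mean_shift Lr0 (yLr j)).
have H j : is_grad (fun v => smoothing y rho v 0 j) u
    (row j (\matrix_j (rho^-1 *: a j))).
  rewrite rowK -[u in is_grad _ u _]addr0 -(scaler0 _ rho).
  apply: is_grad_rescale => //.
  rewrite (_ : (fun k => _) = (fun k => E (fun t => yj j (k + row_of_tuple t)))) //.
  apply/funext => k; rewrite smoothingE /E; congr mean; apply/funext => t.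
  by rewrite /yj scalerDr addrA.
by have /is_grad_JacP[] := H.
Qed.

(** The scalar function [dotp w (y _)] could be differentiable at a sample point where [y] is not.
    Requiring at the same time that all coordinates of [y] be differentiable there, again by
    Rademacher, identifies its gradient with [w *m Jac y p]. *)
Lemma smoothing_Jac_le (w : 'rV[R]_m) (d : 'rV[R]_n) eta : 0 < eta ->
  exists p, [/\ enorm (p - u) <= rho, differentiable y p &
    dotp (w *m Jac (smoothing y rho) u) d - eta <= dotp (w *m Jac y p) d].
Proof.
move=> eta0.
pose f k := dotp w (y (u + rho *: k)).
pose C := \sum_j `|w 0 j| * (L * rho).
have C0 : 0 <= C by apply: sumr_ge0 => j _; rewrite mulr_ge0.
have fC k l : `|f k - f l| <= C * enorm (k - l).
  rewrite /f -dotpBr /dotp (le_trans (ler_norm_sum _ _ _))// mulr_suml.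
  apply: ler_sum => j _; rewrite normrM -mulrA ler_wpM2l//.
  by have := yLr j k l; rewrite !mxE.
have aeP : {ae lebesgue_tuple n, forall t, forall j : 'I_m,
    diff_along id (fun k => y (u + rho *: k) 0 j) (row_of_tuple t)}.
  by apply: ae_forall_countType => j; exact: (rademacher Lr0 (yLr j)).
have ga := is_grad_mean_shift C0 fC.
(* Gradients in the unit-ball variable are [rho] times those in the original one, whence the
   tolerance [rho * eta]. *)
have [t [g [Bt Pt fg le]]] := mean_shift_grad_le C0 fC d (mulr_gt0 rho0 eta0) aeP.
move: ga le; set a := (X in is_grad _ 0 X) => ga le.
pose p := u + rho *: row_of_tuple t.
have dy : differentiable y p.
  have /choice[b bP] : forall j, exists b, is_grad (fun v => y v 0 j) p b.
    move=> j; have [b yb] := diff_along_is_grad (Pt j).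
    by exists (rho^-1 *: b); exact: (is_grad_rescale rho0 yb).
  have H j : is_grad (fun v => y v 0 j) p (row j (\matrix_j b j)) by rewrite rowK.
  by have /is_grad_JacP[] := H.
exists p; split => //.
  rewrite /p addrAC subrr add0r enormZ gtr0_norm//.
  by move: Bt; rewrite /unit_tball /eball/= subr0 => Bt; rewrite ler_piMr// ltW.
have g1 : is_grad (fun v => dotp w (y v)) p (w *m Jac y p) by exact: is_grad_dotp.
have g2 : is_grad (fun v => dotp w (y v)) p (rho^-1 *: g).
  by apply: is_grad_rescale rho0 _; exact: fg.
have e1 : w *m Jac y p = rho^-1 *: g := is_grad_uniq g1 g2.
have g3 : is_grad (fun v => dotp w (smoothing y rho v)) u (rho^-1 *: a).
  rewrite -[u in is_grad _ u _]addr0 -(scaler0 _ rho).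
  apply: is_grad_rescale rho0 _.
  rewrite (_ : (fun k => _) = (fun k => E (fun t => f (k + row_of_tuple t))))//.
  apply/funext => k; rewrite /f /dotp /E.
  rewrite (mean_sum mB B0 B1 (fun j => bmeasZ (w 0 j) (bmeas_shift Lr0 (yLr j) k))).
  apply: eq_bigr => j _.
  rewrite (meanZ mB B1 _ (bmeas_shift Lr0 (yLr j) k)) smoothingE; congr (_ * mean _ _ _).
  by apply/funext => s; rewrite scalerDr addrA.
have e3 := is_grad_uniq (is_grad_dotp w smoothing_differentiable) g3.
rewrite [X in dotp X d - _]e3 [X in _ <= dotp X _]e1.
rewrite !dotpZl -(ler_pM2l rho0) mulrBr !mulrA divff ?gt_eqF// !mul1r.
exact: le.
Qed.

End smoothing_differentiable.

(** * From increments to Jacobians *)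

Section increments.
Context {R : realType}.

Lemma is_derive_epsilon (F : R -> R) (x v : R) :
  (forall e, 0 < e -> exists2 r, 0 < r & forall h, `|h| < r ->
     `|F (x + h) - F x - v * h| <= e * `|h|) -> is_derive x 1 F v.
Proof.
move=> H.
have cv : h^-1 *: (F (h *: 1 + x) - F x) @[h --> 0^'] --> v.
  apply/cvgrPdist_le => e e0; have [r r0 rP] := H e e0.
  exists r => // h; rewrite /ball_/= sub0r normrN => hr h0.
  rewrite [h *: 1]mulr1 /GRing.scale/= distrC (addrC h).
  have -> : h^-1 * (F (x + h) - F x) - v = h^-1 * (F (x + h) - F x - v * h) by field.
  by rewrite normrM normfV ler_pdivrMl ?normr_gt0// [leRHS]mulrC rP.
split; first by apply/cvg_ex; exists v.
exact/cvg_lim.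
Qed.

Variables (n m : nat) (L : R) (y : 'rV[R]_n -> 'rV[R]_m).
Hypothesis L0 : 0 <= L.
Hypothesis yL : forall j u v, `|y u 0 j - y v 0 j| <= L * enorm (u - v).

Lemma smoothing_close rho (u : 'rV[R]_n) j : 0 < rho ->
  `|smoothing y rho u 0 j - y u 0 j| <= L * rho.
Proof.
move=> r0; rewrite smoothingE.
have yLr k l : `|y (u + rho *: k) 0 j - y (u + rho *: l) 0 j| <= L * rho * enorm (k - l).
  apply: (le_trans (yL _ _ _)); rewrite opprD addrACA subrr add0r -scalerBr.
  by rewrite enormZ gtr0_norm// mulrA.
have Lr0 : 0 <= L * rho by rewrite mulr_ge0// ltW.
have mB := @measurable_unit_tball R n.
have B0 := @unit_tball_gt0 R n.
have B1 := @unit_tball_lty R n.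
have bm : bmeas (@unit_tball R n) (`|y (u + rho *: 0) 0 j| + L * rho)
    (fun t => y (u + rho *: row_of_tuple t) 0 j).
  rewrite (_ : (fun t => _) = (fun t => y (u + rho *: (0 + row_of_tuple t)) 0 j)).
    exact: (bmeas_shift Lr0 yLr 0).
  by apply/funext => t; rewrite add0r.
have bc (a : R) : bmeas (@unit_tball R n) `|a| (fun=> a).
  by split => //; exact: measurable_cst.
have bt t : @unit_tball R n t ->
    `|y (u + rho *: row_of_tuple t) 0 j - y u 0 j| <= L * rho.
  move=> Bt; apply: (le_trans (yL _ _ _)); rewrite addrAC subrr add0r.
  rewrite enormZ gtr0_norm//; apply: ler_wpM2l => //.
  by rewrite ler_piMr ?(ltW r0)//; move: Bt; rewrite /unit_tball /eball/= subr0.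
rewrite -[X in _ - X](mean_cst mB B0 B1 (y u 0 j)) -(meanB mB B1 bm (bc _)) ler_norml.
apply/andP; split; last first.
  apply: (mean_ae_le mB B0 B1 (bmeasB bm (bc _))); apply: aeW => t /bt.
  by rewrite ler_norml => /andP[].
rewrite lerNl -mulN1r -(meanZ mB B1 _ (bmeasB bm (bc _))).
apply: (mean_ae_le mB B0 B1 (bmeasZ _ (bmeasB bm (bc _)))); apply: aeW => t /bt.
by rewrite mulN1r ler_norml lerNl => /andP[].
Qed.

(* The mean value theorem is applied to a smoothing of [y] with a radius so small
   that the increment changes little. *)
Lemma increment_Jac_le (w : 'rV[R]_m) (s d : 'rV[R]_n) (t c : R) : 0 < t ->
  c * t <= dotp w (y (s + t *: d)) - dotp w (y s) ->
  forall eta, 0 < eta -> exists p,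
    [/\ enorm (p - s) <= t * enorm d + eta, differentiable y p
      & c - eta <= dotp (w *m Jac y p) d].
Proof.
move=> t0 ct eta eta0.
pose C := (\sum_j `|w 0 j|) * L.
have C0 : 0 <= C by rewrite mulr_ge0// sumr_ge0.
(* The first bound keeps [p] within [eta] of the segment. The second makes smoothing cost
   [eta / 4 * t] at each end of the increment, hence [eta / 2] on the slope; the other [eta / 2] is
   spent in passing from the Jacobian of [z] to that of [y]. *)
pose rho := Num.min eta (eta / 4 * t / (C + 1)).
have C1 : 0 < C + 1 by rewrite ltr_wpDl.
have rho0 : 0 < rho by rewrite lt_min eta0/= !mulr_gt0// invr_gt0.
have Crho : C * rho <= eta / 4 * t.
  apply: (@le_trans _ _ ((C + 1) * rho)); first by rewrite ler_wpM2r ?ltW// ltrDl.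
  by rewrite mulrC -ler_pdivlMr// /rho ge_min lexx orbT.
pose z := smoothing y rho.
have zy u : `|dotp w (z u) - dotp w (y u)| <= eta / 4 * t.
  apply: le_trans Crho; rewrite -dotpBr /dotp (le_trans (ler_norm_sum _ _ _))//.
  rewrite /C -mulrA mulr_suml; apply: ler_sum => j _; rewrite normrM ler_wpM2l//.
  by have := smoothing_close u j rho0; rewrite !mxE.
have eta2 : 0 < eta / 2 by rewrite divr_gt0.
have sJ u := smoothing_Jac_le L0 yL u rho0 w d eta2.
have dz u := smoothing_differentiable L0 yL u rho0.
rewrite -/z in sJ dz; clearbody z.
pose F (x : R) : R := dotp w (z (s + x *: d)).
pose dF (x : R) : R := dotp (w *m Jac z (s + x *: d)) d.
have FP (x : R) : is_derive x 1 F (dF x).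
  apply: is_derive_epsilon => e e0.
  have d1 : 0 < enorm d + 1 by rewrite ltr_wpDl ?enorm_ge0.
  have [r r0 A] := is_grad_dotp w (dz (s + x *: d)) (divr_gt0 e0 d1).
  exists (r / (enorm d + 1)); first by rewrite divr_gt0.
  move=> h; rewrite ltr_pdivlMr// => hr.
  have hd : enorm (h *: d) <= `|h| * (enorm d + 1).
    by rewrite enormZ ler_wpM2l// lerDl.
  rewrite /F scalerDl addrA (mulrC (dF x)) -dotpZr.
  apply: (le_trans (A _ (le_lt_trans hd hr))); rewrite mulrAC ler_pdivrMr// -mulrA ler_pM2l//.
have cF : {within `[0, t], continuous F}.
  apply: derivable_within_continuous => x _.
  by have [] := FP x.
have [x] := @MVT R F dF 0 t t0 (fun x _ => FP x) cF.
rewrite in_itv/= => /andP[x0 xt] FE.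
have dFx : c - eta / 2 <= dF x.
  rewrite -(ler_pM2r t0).
  have := zy (s + t *: d); have := zy (s + 0 *: d).
  move: FE; rewrite /F scale0r addr0 subr0; move: ct.
  move: (dotp w _) (dotp w _) (dotp w _) (dotp w _) => a1 a2 a3 a4.
  by rewrite !ler_norml => ? ? /andP[? ?] /andP[? ?]; lra.
have [p [ps dp le]] := sJ (s + x *: d).
exists p; split; [|exact: dp|]; last first.
  by apply: le_trans le; move: dFx; rewrite /dF; lra.
rewrite (_ : p - s = x *: d + (p - (s + x *: d))); last first.
  by rewrite opprD [RHS]addrCA (addrC (x *: d)) subrK.
apply: (le_trans (enormD _ _)); rewrite enormZ gtr0_norm//; apply: lerD.
  by rewrite ler_wpM2r ?enorm_ge0// ltW.
by apply: (le_trans ps); rewrite /rho ge_min lexx.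
Qed.

End increments.

(** * Limiting Jacobians and convex hulls *)

Section limit_sets.
Context {R : realType} (V W : normedModType R).

(** The common shape of the sets whose hulls are [clarke_jac] and [clarke_subdiff], with the domain
    and the derivative abstracted. *)
Definition limit_set (D : set V) (G : V -> W) (z : V) : set W :=
  [set v | exists xk : nat -> V,
    [/\ forall k, D (xk k), xk @ \oo --> z & (fun k => G (xk k)) @ \oo --> v]].

Definition graph_on (D : set V) (G : V -> W) : set (V * W) :=
  [set q | D q.1 /\ q.2 = G q.1].

Lemma limit_setP D G z v : limit_set D G z v <->
  forall e, 0 < e -> exists p, [/\ D p, `|z - p| < e & `|v - G p| < e].
Proof.
split=> [[xk [Dx xz Gv]] e e0|H].
  move/cvgrPdist_lt : xz => /(_ e e0) xz; move/cvgrPdist_lt : Gv => /(_ e e0) Gv.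
  have [k [zk vk]] : exists k, `|z - xk k| < e /\ `|v - G (xk k)| < e.
    by near \oo => k; exists k; split; near: k.
  by exists (xk k).
have e0 k : 0 < k.+1%:R^-1 :> R by rewrite invr_gt0.
have /choice[xk xP] := fun k : nat => H k.+1%:R^-1 (e0 k).
exists xk; split => [k||]; first by have [] := xP k.
- apply/cvgrPdist_lt => e e1; near=> k; have [_ + _] := xP k.
  move=> /lt_trans; apply; near: k; exact: near_infty_natSinv_lt (PosNum e1).
- apply/cvgrPdist_lt => e e1; near=> k; have [_ _] := xP k.
  move=> /lt_trans; apply; near: k; exact: near_infty_natSinv_lt (PosNum e1).
Unshelve. all: by end_near. Qed.

(** This shows closedness jointly in [z] and [v], the source of compactness when [z] ranges over a
    compact set. *)
Lemma limit_set_closure D G z v :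
  limit_set D G z v <-> closure (graph_on D G) (z, v).
Proof.
split=> [/limit_setP H B /nbhs_ballP[e /= e0 eB]|H].
  have [p [Dp zp vp]] := H e e0; exists (p, G p); split; first by split.
  by apply: eB; split; rewrite /= -ball_normE.
apply/limit_setP => e e0.
have [[p g] [[Dp /= ->] [/= zp vp]]] := H _ (nbhsx_ballx (z, v) e e0).
by exists p; split => //; [move: zp|move: vp]; rewrite -ball_normE.
Qed.

Lemma eq_limit_set (U : set V) D1 D2 G1 G2 z : nbhs z U ->
  (forall p, U p -> D1 p -> D2 p /\ G1 p = G2 p) ->
  limit_set D1 G1 z `<=` limit_set D2 G2 z.
Proof.
move=> /nbhs_ballP[r /= r0 rU] DG v /limit_setP H; apply/limit_setP => e e0.
have [|p [Dp zp vp]] := H (Num.min e r); first by rewrite lt_min e0.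
have [D2p Gp] : D2 p /\ G1 p = G2 p.
  apply: DG => //; apply: rU; rewrite -ball_normE/=.
  by apply: lt_le_trans zp _; rewrite ge_min lexx orbT.
exists p; split => //; first by apply: lt_le_trans zp _; rewrite ge_min lexx.
by rewrite -Gp; apply: lt_le_trans vp _; rewrite ge_min lexx.
Qed.

Lemma compact_seq_cluster (A : set V) (u : nat -> V) : compact A ->
  (forall k, A (u k)) -> exists2 q, A q &
    forall e N, 0 < e -> exists2 k, (N <= k)%N & `|q - u k| < e.
Proof.
move=> cA Au; have [|q [Aq cq]] := cA (u @ \oo) _.
  by exists 0%N => // k _; exact: Au.
exists q => // e N e0.
have [|v [[k Nk <-] qv]] := cq (u @` [set k | (N <= k)%N]) _ _ (nbhsx_ballx q e e0).
  by exists N => // k Nk; exists k.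
by exists k => //; move: qv; rewrite -ball_normE.
Qed.

End limit_sets.

Section limit_sets_compact.
Context {R : realType} (n m : nat).
Variables (D K : set 'rV[R]_n) (G : 'rV[R]_n -> 'M[R]_(m, n)) (C : R).
Hypothesis cK : compact K.
Hypothesis GC : forall p, D p -> `|G p| <= C.

Definition limits_over : set 'M[R]_(m, n) :=
  [set V | exists2 z, K z & limit_set D G z V].

(** Written as an image under [vec_mx] so that compactness is transported from row vectors. *)
Definition mx_ball : set 'M[R]_(m, n) :=
  [set vec_mx v | v in [set v : 'rV[R]_(m * n) | `|v| <= C]].

Lemma compact_mx_ball : compact mx_ball.
Proof.
apply: continuous_compact.
  apply: continuous_subspaceT.
  exact: (@row_linear_continuous _ _ _ (vec_mx : {linear 'rV[R]_(m * n) -> 'M[R]_(m, n)})).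
apply: bounded_closed_compact.
  by exists C; split; [exact: num_real|move=> M CM v /= /le_trans; apply; exact: ltW].
apply: (@closed_comp _ _ (fun v : 'rV[R]_(m * n) => `|v|) [set x | x <= C]).
  by move=> v _; exact: norm_continuous.
exact: closed_le.
Qed.

Lemma mx_ballP (M : 'M[R]_(m, n)) : 0 <= C -> `|M| <= C -> mx_ball M.
Proof.
move=> C0 MC; exists (mxvec M); last by rewrite mxvecK.
apply: mx_norm_le => // i j; rewrite ord1; case/mxvec_indexP : j => a b.
by rewrite mxvecE (le_trans (normr_coord_le _ _ _)).
Qed.

Lemma mx_norm_mulmx_le (w : 'rV[R]_m) (V : 'M[R]_(m, n)) :
  `|w *m V| <= m%:R * `|w| * `|V|.
Proof.
apply: mx_norm_le => [|i j]; first by rewrite !mulr_ge0.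
rewrite mxE (le_trans (ler_norm_sum _ _ _))//.
apply: (@le_trans _ _ (\sum_(k < m) `|w| * `|V|)).
  apply: ler_sum => k _; rewrite normrM.
  by apply: ler_pM => //; exact: normr_coord_le.
by rewrite sumr_const card_ord -[leLHS]mulr_natl mulrA.
Qed.

Lemma mulmx_continuous (w : 'rV[R]_m) :
  continuous (fun V : 'M[R]_(m, n) => w *m V).
Proof.
move=> V; apply/(@cvgrPdist_le _ _ _ (nbhs V) (nbhs_filter V)) => e e0.
have C1 : 0 < m%:R * `|w| + 1 by rewrite ltr_wpDl// mulr_ge0.
have e1 : 0 < e / (m%:R * `|w| + 1) by rewrite divr_gt0.
apply/nbhs_ballP; exists (e / (m%:R * `|w| + 1)) => // V'; rewrite -ball_normE/= => VV.
rewrite -mulmxBr (le_trans (mx_norm_mulmx_le _ _))//.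
apply: (@le_trans _ _ ((m%:R * `|w| + 1) * `|V - V'|)).
  by rewrite ler_wpM2r// lerDl.
by rewrite mulrC -ler_pdivlMr// ltW.
Qed.

Lemma limits_over_compact (w : 'rV[R]_m) (b : 'rV[R]_n) :
  compact [set b + w *m V | V in limits_over].
Proof.
(* A negative [C] forces [D] to be empty, so there are no limits. Otherwise the set is a continuous
   image of the part of [K] times a ball that lies in the closure of the graph of [G]. *)
have [C0|C0] := leP 0 C; last first.
  rewrite (_ : [set _ | V in _] = set0); first exact: compact0.
  apply/seteqP; split => [x [V [z _ /limit_setP/(_ 1 ltr01)[p [Dp _ _]]] _]|//].
  by have := le_lt_trans (le_trans (normr_ge0 _) (GC Dp)) C0; rewrite ltxx.
pose S := (K `*` mx_ball) `&` closure (graph_on D G).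
have -> : [set b + w *m V | V in limits_over] = (fun q => b + w *m q.2) @` S.
  apply/seteqP; split => [_ [V [z Kz lV] <-]|_ [[z V] [[/= Kz _] /limit_set_closure lV] <-]].
    exists (z, V) => //; split; last exact/limit_set_closure.
    split => //=; apply: mx_ballP => //; apply/ler_addgt0Pr => e e0.
    move/limit_setP : lV => /(_ e e0)[p [Dp _ Ve]].
    rewrite -(subrK (G p) V) (le_trans (ler_normD _ _))// addrC lerD ?GC//.
    exact: ltW.
  by exists V => //; exists z.
apply: continuous_compact.
  apply: continuous_subspaceT => q.
  apply: cvgD; first exact: cvg_cst.
  apply: (@continuous_comp _ _ _ snd (fun V : 'M[R]_(m, n) => w *m V)).
    exact: cvg_snd.
  exact: mulmx_continuous.
apply: subclosed_compact (compact_setX cK compact_mx_ball) _.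
  apply: closedI; last exact: closed_closure.
  apply: compact_closed; first exact: norm_hausdorff.
  exact: compact_setX cK compact_mx_ball.
exact: subIsetl.
Qed.

(** Taking [eta] to be the inverse of [k + 1] gives a sequence of pairs of a point of [K] and a
    value of [G] at a nearby point. A cluster point of it is a limit over [K], and the error
    disappears there. *)
Lemma limits_over_ge (w : 'rV[R]_m) (d : 'rV[R]_n) c :
  (forall eta, 0 < eta -> exists p s, [/\ K s, D p, enorm (p - s) <= eta &
      c - eta <= dotp (w *m G p) d]) ->
  exists2 V, limits_over V & c <= dotp (w *m V) d.
Proof.
move=> H; have e0 k : 0 < k.+1%:R^-1 :> R by rewrite invr_gt0.
have /choice[ps psP] : forall k : nat, exists ps : 'rV[R]_n * 'rV[R]_n,
    [/\ K ps.2, D ps.1, enorm (ps.1 - ps.2) <= k.+1%:R^-1 &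
        c - k.+1%:R^-1 <= dotp (w *m G ps.1) d].
  by move=> k; have [p [s sp]] := H _ (e0 k); exists (p, s).
have C0 : 0 <= C.
  by have [_ Dp _ _] := psP 0%N; exact: le_trans (normr_ge0 _) (GC Dp).
have [|[z V] [/= Kz _] cl] := @compact_seq_cluster R ('rV[R]_n * 'M[R]_(m, n))%type _
    (fun k => ((ps k).2, G (ps k).1)) (compact_setX cK compact_mx_ball).
  by move=> k; have [Ks Dp _ _] := psP k; split => //=; apply: mx_ballP => //; exact: GC.
have {}cl e : 0 < e -> exists k, [/\ k.+1%:R^-1 < e, `|z - (ps k).2| < e & `|V - G (ps k).1| < e].
  move=> e1; have [N Ne] : exists N : nat, N.+1%:R^-1 < e.
    by near \oo => i; exists i; near: i; exact: near_infty_natSinv_lt (PosNum e1).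
  have [k Nk] := cl e N e1; rewrite prod_normE/= gt_max => /andP[zk Vk].
  exists k; split => //; apply: le_lt_trans Ne.
  by rewrite lef_pV2 ?posrE// ler_nat ltnS.
exists V.
  exists z => //; apply/limit_setP => e e1.
  have e2 : 0 < e / 2 by rewrite divr_gt0.
  have [k [ke zk Vk]] := cl _ e2; have [Ks Dp pse _] := psP k.
  exists (ps k).1; split => //; last by apply: lt_trans Vk _; lra.
  rewrite -(subrK (ps k).2 z) -addrA (le_lt_trans (ler_normD _ _))//.
  rewrite (_ : e = e / 2 + e / 2); last by lra.
  apply: ltrD => //; rewrite distrC; apply: le_lt_trans (mx_norm_le_enorm _) _.
  exact: le_lt_trans pse ke.
apply/ler_addgt0Pr => e e1.
(* A Lipschitz constant of the functional sending [V] to [dotp (w *m V) d], increased by 1 to be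
   positive. *)
pose M := n%:R * (m%:R * `|w|) * enorm d + 1.
have M0 : 0 < M by rewrite ltr_wpDl// !mulr_ge0 ?enorm_ge0.
have eM : 0 < Num.min (e / 2) (e / 2 / M) by rewrite lt_min !divr_gt0.
have [k [+ _ +]] := cl _ eM; rewrite !lt_min => /andP[ke _] /andP[_ Vk].
have [_ _ _ ck] := psP k.
rewrite -lerBlDl -[w *m V](subrK (w *m G (ps k).1)) dotpDl -mulmxBr.
have : `|dotp (w *m (V - G (ps k).1)) d| <= e / 2.
  apply: (le_trans (cauchy_schwarz _ _)).
  apply: (@le_trans _ _ (M * `|V - G (ps k).1|)); last first.
    by rewrite mulrC -ler_pdivlMr// ltW.
  rewrite /M mulrDl mul1r; apply: ler_wpDr => //.
  rewrite [leRHS]mulrAC; apply: ler_wpM2r; first exact: enorm_ge0.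
  apply: (le_trans (enorm_le_mx_norm _)); rewrite -mulrA; apply: ler_wpM2l => //.
  exact: mx_norm_mulmx_le.
move: ke ck; move: (k.+1%:R^-1) => q ke ck; rewrite ler_norml => /andP[? _].
lra.
Unshelve. all: by end_near. Qed.

End limit_sets_compact.

(** * Convex hulls, Caratheodory's theorem and separation *)

Section convex_hull.
Context {R : realType} {V : lmodType R}.
Implicit Types A C : set V.

Lemma convex_setP C : @convex_set R V C <->
  forall x y t, 0 <= t <= 1 -> C x -> C y -> C (t *: x + (1 - t) *: y).
Proof.
split=> [cC x y t /andP[t0 t1] Cx Cy|cC x y l].
  have /(_ x y (Itv01 t0 t1)) := cC.
  by rewrite !inE => /(_ Cx Cy).
rewrite !inE => Cx Cy; apply: cC => //.
by apply/andP; split.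
Qed.

Lemma sub_conv_hull A : A `<=` conv_hull A.
Proof. exact: sub_gen_smallest. Qed.

Lemma conv_hull_convex A : @convex_set R V (conv_hull A).
Proof.
apply/convex_setP => x y t t01 Ax Ay C [cC AC].
by move/convex_setP : (cC); apply => //; [exact: Ax|exact: Ay].
Qed.

Lemma conv_hull_min A C : @convex_set R V C -> A `<=` C -> conv_hull A `<=` C.
Proof. by move=> cC AC; exact: smallest_sub. Qed.

Lemma conv_hull_bigcup {I : Type} (P : set I) (F : I -> set V) :
  conv_hull (\bigcup_(i in P) conv_hull (F i)) = conv_hull (\bigcup_(i in P) F i).
Proof.
apply/seteqP; split; apply: conv_hull_min; try exact: conv_hull_convex.
  move=> x [i Pi]; apply: conv_hull_min; first exact: conv_hull_convex.
  by move=> z Fz; apply: sub_conv_hull; exists i.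
by move=> x [i Pi Fx]; apply: sub_conv_hull; exists i => //; exact: sub_conv_hull.
Qed.

Definition conv_comb N A : set V := [set x | exists l : 'I_N -> R, exists a : 'I_N -> V,
  [/\ forall i, 0 <= l i, \sum_i l i = 1, forall i, A (a i) & x = \sum_i l i *: a i]].

Lemma conv_comb_sub N A C : @convex_set R V C -> A `<=` C -> conv_comb N A `<=` C.
Proof.
move=> /convex_setP cC AC; elim: N => [|N IH] _ [l [a [l0 l1 Aa ->]]].
  by move/eqP: l1; rewrite big_ord0 eq_sym oner_eq0.
rewrite big_ord_recl in l1; rewrite big_ord_recl.
pose s := \sum_(i < N) l (lift ord0 i).
have s0 : 0 <= s by exact: sumr_ge0.
have ls : 1 - l ord0 = s by rewrite -l1 addrAC subrr add0r.
have [s00|s_neq0] := eqVneq s 0.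
  have li i : l (lift ord0 i) = 0.
    by apply/eqP; move/eqP : s00; rewrite psumr_eq0// => /allP/(_ i); apply; rewrite mem_index_enum.
  rewrite big1 => [|i _]; last by rewrite li scale0r.
  have -> : l ord0 = 1 by move: ls; rewrite s00; lra.
  by rewrite scale1r addr0; exact: AC.
have -> : \sum_(i < N) l (lift ord0 i) *: a (lift ord0 i) =
    (1 - l ord0) *: \sum_(i < N) (l (lift ord0 i) / s) *: a (lift ord0 i).
  rewrite ls scaler_sumr; apply: eq_bigr => i _.
  by rewrite scalerA mulrCA divff// mulr1.
apply: cC; [by rewrite l0/=; move: s0; rewrite -ls; lra|exact: AC|].
apply: IH; exists (fun i => l (lift ord0 i) / s), (fun i => a (lift ord0 i)); split => //.
  by move=> i; rewrite divr_ge0.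
by rewrite -mulr_suml divff.
Qed.

Lemma conv_combD N M A x y t : 0 <= t <= 1 -> conv_comb N A x -> conv_comb M A y ->
  conv_comb (N + M) A (t *: x + (1 - t) *: y).
Proof.
move=> /andP[t0 t1] [l [a [l0 l1 Aa ->]]] [k [b [k0 k1 Ab ->]]].
exists (fun i => match fintype.split i with inl j => t * l j | inr j => (1 - t) * k j end).
exists (fun i => match fintype.split i with inl j => a j | inr j => b j end).
have sl (j : 'I_N) : fintype.split (lshift M j) = inl j by exact: (unsplitK (inl j)).
have sr (j : 'I_M) : fintype.split (rshift N j) = inr j by exact: (unsplitK (inr j)).
split.
- by move=> i; case: fintype.split => j; rewrite mulr_ge0// subr_ge0.
- rewrite big_split_ord/=.
  rewrite (eq_bigr (fun j => t * l j)) => [|j _]; last by rewrite sl.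
  rewrite [X in _ + X](eq_bigr (fun j => (1 - t) * k j)) => [|j _]; last by rewrite sr.
  by rewrite -!mulr_sumr l1 k1 !mulr1 addrC subrK.
- by move=> i; case: fintype.split.
- rewrite big_split_ord/= !scaler_sumr; congr (_ + _); apply: eq_bigr => j _.
    by rewrite sl scalerA.
  by rewrite sr scalerA.
Qed.

End convex_hull.

Section caratheodory.
Context {R : realType} (n : nat).
Implicit Types A : set 'rV[R]_n.

(** More than [n + 1] points are affinely dependent: the rows [(1, a i)] of [M] have a nonzero left
    kernel vector [u], with weights and weighted points both summing to 0. Subtracting from [l] the
    multiple of [u] given by the least ratio [l i / u i] over positive [u i] keeps the weights
    nonnegative and cancels one of them. *)
Lemma conv_comb_reduce N A : (n.+1 <= N)%N -> conv_comb N.+1 A `<=` conv_comb N A.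
Proof.
move=> nN _ [l [a [l0 l1 Aa ->]]].
pose M : 'M[R]_(N.+1, n.+1) := \matrix_(i, j) consr 1 (a i) 0 j.
have [u uM u0] : exists2 u : 'rV[R]_N.+1, u *m M = 0 & u != 0.
  have /rowV0Pn[u /sub_kermxP uM u0] : kermx M != 0.
    rewrite kermx_eq0 /row_free neq_ltn.
    by rewrite (leq_ltn_trans (rank_leq_col M))// ltnS.
  by exists u.
have su : \sum_i u 0 i = 0.
  have := congr1 (fun v : 'rV[R]_n.+1 => v 0 ord0) uM; rewrite !mxE => H.
  by rewrite -[RHS]H; apply: eq_bigr => i _; rewrite mxE consr0E mulr1.
have sua : \sum_i u 0 i *: a i = 0.
  apply/rowP => j; rewrite summxE.
  have := congr1 (fun v : 'rV[R]_n.+1 => v 0 (lift ord0 j)) uM; rewrite !mxE => H.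
  by rewrite -[RHS]H; apply: eq_bigr => i _; rewrite !mxE liftK.
have [i0 ui0] : exists i, 0 < u 0 i.
  apply: contrapT => nex; move/negP : u0; apply; apply/eqP/rowP => i; rewrite mxE.
  have un k : u 0 k <= 0 by rewrite leNgt; apply/negP => ?; apply: nex; exists k.
  have : \sum_k - u 0 k == 0 by rewrite sumrN su oppr0.
  rewrite psumr_eq0 => [/allP/(_ i)|k _]; last by rewrite oppr_ge0.
  by rewrite mem_index_enum oppr_eq0 => /(_ isT)/eqP.
case: (@Order.TotalTheory.arg_minP _ _ _ i0 (fun i => 0 < u 0 i) (fun i => l i / u 0 i) ui0).
move=> j uj jmin.
pose r := l j / u 0 j.
have r0 : 0 <= r by rewrite divr_ge0// ltW.
pose l' i := l i - r * u 0 i.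
have l'0 i : 0 <= l' i.
  rewrite /l' subr_ge0; have [ui|ui] := ltP 0 (u 0 i).
    by rewrite -ler_pdivlMr//; exact: jmin.
  by rewrite (le_trans _ (l0 i))// mulr_ge0_le0.
have l'j : l' j = 0 by rewrite /l' /r mulfVK ?subrr// gt_eqF.
exists (fun k => l' (lift j k)), (fun k => a (lift j k)); split => //.
  have : \sum_i l' i = 1 by rewrite /l' sumrB -mulr_sumr su mulr0 subr0.
  by rewrite (bigD1_ord j)//= l'j add0r.
have -> : \sum_i l i *: a i = \sum_i l' i *: a i.
  under [RHS]eq_bigr do rewrite /l' scalerBl -scalerA.
  by rewrite sumrB -scaler_sumr sua scaler0 subr0.
by rewrite (bigD1_ord j)//= l'j scale0r add0r.
Qed.

Lemma conv_hull_caratheodory A : conv_hull A `<=` conv_comb n.+1 A.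
Proof.
have red N : conv_comb (N + n.+1) A `<=` conv_comb n.+1 A.
  elim: N => // N IH x; rewrite addSn => /conv_comb_reduce H; apply: IH.
  by apply: H; rewrite leq_addl.
apply: conv_hull_min.
  (* A convex combination of two combinations of [n + 1] points uses [2 (n + 1)] points, which
     reduce again to [n + 1]; so these combinations form a convex set. *)
  apply/convex_setP => x y t t01 Ax Ay; apply: (red n.+1).
  exact: conv_combD.
move=> x Ax; exists (fun i => (i == ord0)%:R), (fun=> x); split => //.
- by rewrite (bigD1 ord0)//= big1 ?addr0// => i /negPf ->.
- by rewrite (bigD1 ord0)//= big1 ?addr0 ?scale1r// => i /negPf ->; rewrite scale0r.
Qed.

End caratheodory.

Section support.
Context {R : realType} (n : nat).
Implicit Types A : set 'rV[R]_n.

Lemma dotp_sqrBZ (p r : 'rV[R]_n) t :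
  dotp (p - t *: r) (p - t *: r) = dotp p p - 2 * t * dotp p r + t ^+ 2 * dotp r r.
Proof. by rewrite dotpBl !dotpBr !dotpZl !dotpZr (dotpC r p); ring. Qed.

Lemma compact_combinations N A : compact A ->
  compact [set q : 'rV[R]_N * 'M[R]_(N, n) |
    [/\ forall i, 0 <= q.1 0 i, \sum_i q.1 0 i = 1 & forall i, A (row i q.2)]].
Proof.
move=> cA.
have [C CA] : exists C, forall x, A x -> `|x| <= C.
  have [C [_ HC]] := compact_bounded cA; exists (C + 1) => x Ax.
  by apply: HC => //; rewrite ltrDl.
have cB := compact_setX (@compact_mx_ball R N 1 1)
  (@compact_mx_ball R n N (Num.max C 0)).
apply: (subclosed_compact _ cB); last first.
  move=> [l a] [/= l0 l1 Aa]; split => /=.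
    apply: mx_ballP => //; apply: mx_norm_le => // i j; rewrite ord1.
    rewrite ger0_norm// -l1 (bigD1 j)//= lerDl.
    by apply: sumr_ge0 => k _.
  apply: mx_ballP; first by rewrite le_max lexx orbT.
  apply: mx_norm_le; first by rewrite le_max lexx orbT.
  move=> i j; have := CA _ (Aa i); have := normr_coord_le (row i a) 0 j; rewrite mxE.
  by move=> h1 h2; rewrite le_max (le_trans h1 h2).
have -> : [set q : 'rV[R]_N * 'M[R]_(N, n) |
    [/\ forall i, 0 <= q.1 0 i, \sum_i q.1 0 i = 1 & forall i, A (row i q.2)]] =
  (\bigcap_(i in [set: 'I_N]) ((fun q : 'rV[R]_N * 'M[R]_(N, n) => q.1 0 i) @^-1` [set x | 0 <= x])) `&`
  (((fun q : 'rV[R]_N * 'M[R]_(N, n) => \sum_i q.1 0 i) @^-1` [set 1]) `&`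
  (\bigcap_(i in [set: 'I_N]) ((fun q : 'rV[R]_N * 'M[R]_(N, n) => row i q.2) @^-1` A))).
  apply/seteqP; split => [q [q0 q1 Aq]|q [q0 [q1 Aq]]].
    by split; [move=> i _; exact: q0|split => // i _; exact: Aq].
  by split => // i; [exact: q0|exact: Aq].
have c1 i : continuous (fun q : 'rV[R]_N * 'M[R]_(N, n) => q.1 0 i).
  move=> q; apply: (@continuous_comp _ _ _ fst (fun v : 'rV[R]_N => v 0 i)).
    exact: cvg_fst.
  exact: coord_continuous.
apply: closedI; first by apply: closed_bigI => i _; apply: closed_comp => [q _|]; [exact: c1|exact: closed_ge].
apply: closedI.
  apply: (@closed_comp _ _ (fun q : 'rV[R]_N * 'M[R]_(N, n) => \sum_i q.1 0 i)); last exact: closed_eq.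
  move=> q _; apply: (@continuous_comp _ _ _ fst (fun v : 'rV[R]_N => \sum_i v 0 i)).
    exact: cvg_fst.
  have sE (v : 'rV[R]_N) : \sum_i v 0 i = dotp (const_mx 1) v.
    by apply: eq_bigr => i _; rewrite mxE mul1r.
  apply: (@elipschitz_continuous _ _ (enorm (const_mx 1 : 'rV[R]_N))) => v w.
  by rewrite !sE -dotpBr cauchy_schwarz.
apply: closed_bigI => i _; apply: closed_comp; last first.
  by apply: compact_closed => //; exact: norm_hausdorff.
move=> q _.
apply: (@continuous_comp _ _ _ snd (fun V : 'M[R]_(N, n) => row i V)).
  exact: cvg_snd.
have -> : (fun V : 'M[R]_(N, n) => row i V) = (fun V => delta_mx 0 i *m V).
  by apply/funext => V; rewrite rowE.
exact: mulmx_continuous.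
Qed.

Lemma row_mulmx_continuous N :
  continuous (fun q : 'rV[R]_N * 'M[R]_(N, n) => q.1 *m q.2).
Proof.
move=> [l a]; apply/(@cvgrPdist_le _ _ _ (nbhs (l, a)) (nbhs_filter _)) => e e0.
pose M := N%:R * (`|l| + 1 + `|a|) + 1.
have M0 : 0 < M by rewrite ltr_wpDl// mulr_ge0// !addr_ge0.
apply/nbhs_ballP; exists (Num.min 1 (e / M)); first by rewrite /= lt_min ltr01 divr_gt0.
move=> [l' a'] [/=]; rewrite -!ball_normE/= !lt_min => /andP[l1 le1] /andP[_ ae].
rewrite (_ : _ - _ = (l - l') *m a + l' *m (a - a')); last first.
  by rewrite mulmxBl mulmxBr addrA subrK.
rewrite (le_trans (ler_normD _ _))//.
have h1 := mx_norm_mulmx_le (l - l') a; have h2 := mx_norm_mulmx_le l' (a - a').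
have nl' : `|l'| <= `|l| + 1.
  rewrite -(subrK l l') (le_trans (ler_normD _ _))// addrC lerD2l.
  by rewrite distrC ltW.
have N0 : 0 <= N%:R :> R by [].
have : N%:R * `|l - l'| * `|a| <= N%:R * (e / M) * `|a|.
  by apply: ler_wpM2r => //; apply: ler_wpM2l => //; exact: ltW.
have : N%:R * `|l'| * `|a - a'| <= N%:R * (`|l| + 1) * (e / M).
  apply: (@le_trans _ _ (N%:R * (`|l| + 1) * `|a - a'|)).
    by apply: ler_wpM2r => //; exact: ler_wpM2l.
  by apply: ler_wpM2l (ltW ae); rewrite mulr_ge0// addr_ge0.
have : N%:R * (`|l| + 1 + `|a|) * (e / M) <= e.
  rewrite mulrA ler_pdivrMr// mulrC ler_pM2l//; rewrite /M lerDl//.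
have -> : N%:R * (`|l| + 1 + `|a|) * (e / M) = N%:R * (`|l| + 1) * (e / M) + N%:R * (e / M) * `|a|.
  by ring.
lra.
Qed.

(* The point of the hull nearest to [v] exists because, by Caratheodory, the hull
   is the continuous image of a compact set. *)
Lemma conv_hull_support A v : compact A ->
  (forall d, exists2 a, A a & dotp v d <= dotp a d) -> conv_hull A v.
Proof.
move=> cA H.
pose S := [set q : 'rV[R]_n.+1 * 'M[R]_(n.+1, n) |
    [/\ forall i, 0 <= q.1 0 i, \sum_i q.1 0 i = 1 & forall i, A (row i q.2)]].
have SP x : conv_hull A x -> exists2 q, S q & x = q.1 *m q.2.
  move=> /conv_hull_caratheodory[l [a [l0 l1 Aa ->]]].
  exists (\row_i l i, \matrix_i a i) => /=.
    split => /= [i||i]; [by rewrite mxE| |by rewrite rowK].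
    by rewrite -[RHS]l1; apply: eq_bigr => i _; rewrite mxE.
  by rewrite mulmx_sum_row; apply: eq_bigr => i _; rewrite mxE rowK.
have PS q : S q -> conv_hull A (q.1 *m q.2).
  move=> [q0 q1 Aq]; apply: (conv_comb_sub (N := n.+1) (@conv_hull_convex _ _ A) (@sub_conv_hull _ _ A)).
  exists (fun i => q.1 0 i), (fun i => row i q.2); split => //.
  by rewrite mulmx_sum_row.
have [a0 Aa0 _] := H 0.
have S0 : S !=set0.
  by have [q Sq _] := SP _ (sub_conv_hull Aa0); exists q.
have cf : {within S, continuous (fun q : 'rV[R]_n.+1 * 'M[R]_(n.+1, n) => enorm (v - q.1 *m q.2))}.
  apply: continuous_subspaceT => q.
  apply: (@continuous_comp _ _ _ (fun q : 'rV[R]_n.+1 * 'M[R]_(n.+1, n) => v - q.1 *m q.2) (@enorm R n)).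
    by apply: cvgB; [exact: cvg_cst|exact: row_mulmx_continuous].
  exact: enorm_continuous.
have [q] := compact_EVT_min S0 (@compact_combinations n.+1 A cA) cf.
rewrite inE => Sq qmin.
set x := q.1 *m q.2 in qmin.
have Ax : conv_hull A x := PS q Sq.
have xmin z : conv_hull A z -> enorm (v - x) <= enorm (v - z).
  by move=> /SP[r Sr ->]; apply: qmin; rewrite inE.
(* The hypothesis is used in the direction from the nearest point [x] to [v]. Minimality of [x] on
   the segment towards [a] gives [ang]; combined with [vda] it forces [v = x]. *)
have [a Aa vda] := H (v - x).
have ang : dotp (v - x) (a - x) <= 0.
  apply/ler_addgt0Pr => e e0; rewrite add0r.
  have K0 : 0 < dotp (a - x) (a - x) + 1 by rewrite ltr_wpDl// dotp_ge0.
  (* Minimality at parameter [t] bounds twice the inner product by [t] times the squared length of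
     [a - x], which this choice keeps below [e]. *)
  pose t := Num.min 1 (e / (dotp (a - x) (a - x) + 1)).
  have t0 : 0 < t by rewrite lt_min ltr01 divr_gt0.
  have t1 : t <= 1 by rewrite ge_min lexx.
  have tK : t * (dotp (a - x) (a - x) + 1) <= e.
    by rewrite -ler_pdivlMr// ge_min lexx orbT.
  have Az : conv_hull A (t *: a + (1 - t) *: x).
    move/convex_setP: (@conv_hull_convex _ _ A); apply => //; first by rewrite ltW.
    exact: sub_conv_hull.
  have := xmin _ Az.
  have -> : v - (t *: a + (1 - t) *: x) = (v - x) - t *: (a - x).
    by apply/rowP => j; rewrite !mxE; ring.
  rewrite -(@ler_pXn2r _ 2) ?nnegrE ?enorm_ge0// !enorm_sqr.
  rewrite dotp_sqrBZ.
  move: tK; move: (dotp (v - x) (v - x)) (dotp (v - x) (a - x)) (dotp (a - x) (a - x)) (dotp_ge0 (a - x)).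
  move=> b c k k0 tk H1.
  have : t * (2 * c) <= t * (t * k) by lra.
  rewrite ler_pM2l// => H2.
  nra.
have : dotp (v - x) (v - x) <= 0.
  move: ang vda; rewrite !dotpBl !dotpBr (dotpC v a) (dotpC x a) (dotpC x v); lra.
rewrite -enorm_sqr => vx0.
have : enorm (v - x) = 0.
  by apply/eqP; rewrite -sqrf_eq0 eq_le vx0 sqr_ge0.
by move/enorm_eq0/eqP; rewrite subr_eq0 => /eqP ->.
Qed.

End support.

(** * Generalized gradients of composite functions *)

Section partial_gradients.
Context {R : realType} (n m : nat).
Variable phi : 'rV[R]_n * 'rV[R]_m -> R.
Local Notation phiR := (phi : 'rV[R]_n * 'rV[R]_m -> R^o).

Lemma is_grad1 x z : differentiable phiR (x, z) ->
  is_grad (fun x' => phi (x', z)) x (\row_i 'd phiR (x, z) (delta_mx 0 i, 0)).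
Proof.
move=> dphi; apply/is_grad_near => e e0.
have /nbhs_ballP[r /= r0 rP] := epsilon_differentiable dphi e0.
apply/nbhs_ballP; exists r => //= h; rewrite -ball_normE/= => hr.
have hb : ball (0 : 'rV[R]_n * 'rV[R]_m) r (h, 0).
  by split; [rewrite -ball_normE|exact: ballxx].
have := rP _ hb; rewrite /= prod_normE/= normr0.
rewrite (_ : (h, 0) + (x, z) = (h + x, z)); last by congr pair; rewrite add0r.
rewrite max_l//; apply: le_trans; rewrite le_eqVlt; apply/orP; left; apply/eqP.
congr (`| _ - _ |).
pose l1 := fun h : 'rV[R]_n => 'd phiR (x, z) (h, 0).
have l1l : linear l1.
  move=> a u v; rewrite /l1 -linearP; congr ('d phiR (x, z) _).
  by apply: injective_projections; rewrite //= scaler0 addr0.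
pose l1L := GRing.isLinear.Build _ _ _ _ _ l1l.
pose D : {linear 'rV[R]_n -> R^o} := HB.pack l1 l1L.
rewrite -[RHS]/(D h) row_linear_sum dotpC; apply: eq_bigr => i _.
by rewrite mxE.
Qed.

Lemma is_grad2 x z : differentiable phiR (x, z) ->
  is_grad (fun z' => phi (x, z')) z (\row_i 'd phiR (x, z) (0, delta_mx 0 i)).
Proof.
move=> dphi; apply/is_grad_near => e e0.
have /nbhs_ballP[r /= r0 rP] := epsilon_differentiable dphi e0.
apply/nbhs_ballP; exists r => //= h; rewrite -ball_normE/= => hr.
have hb : ball (0 : 'rV[R]_n * 'rV[R]_m) r (0, h).
  by split; [exact: ballxx|rewrite -ball_normE].
have := rP _ hb; rewrite /= prod_normE/= normr0.
rewrite (_ : (0, h) + (x, z) = (x, h + z)); last by congr pair; rewrite add0r.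
rewrite max_r//; apply: le_trans; rewrite le_eqVlt; apply/orP; left; apply/eqP.
congr (`| _ - _ |).
pose l1 := fun h : 'rV[R]_m => 'd phiR (x, z) (0, h).
have l1l : linear l1.
  move=> a u v; rewrite /l1 -linearP; congr ('d phiR (x, z) _).
  by apply: injective_projections; rewrite //= scaler0 addr0.
pose l1L := GRing.isLinear.Build _ _ _ _ _ l1l.
pose D : {linear 'rV[R]_m -> R^o} := HB.pack l1 l1L.
rewrite -[RHS]/(D h) row_linear_sum dotpC; apply: eq_bigr => i _.
by rewrite mxE.
Qed.

Lemma grad1E x z : differentiable phiR (x, z) ->
  grad1 phi x z = \row_i 'd phiR (x, z) (delta_mx 0 i, 0).
Proof. by move=> /is_grad1/is_gradP[]. Qed.

Lemma grad2E x z : differentiable phiR (x, z) ->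
  grad2 phi x z = \row_i 'd phiR (x, z) (0, delta_mx 0 i).
Proof. by move=> /is_grad2/is_gradP[]. Qed.

Lemma diff_partial x z h k : differentiable phiR (x, z) ->
  'd phiR (x, z) (h, k) = dotp (grad1 phi x z) h + dotp (grad2 phi x z) k.
Proof.
move=> dphi; rewrite grad1E// grad2E//.
have hk : (h, k) = \sum_i (h 0 i *: (delta_mx 0 i, 0)) +
    \sum_i (k 0 i *: (0, delta_mx 0 i)) :> 'rV[R]_n * 'rV[R]_m.
  rewrite (_ : \sum_i (h 0 i *: (delta_mx 0 i, 0)) = (h, 0)); last first.
    rewrite {2}(row_sum_delta h); apply: (big_ind2 (fun a b => a = (b, 0))) => //.
    - by move=> ? a ? b -> ->; congr pair; rewrite addr0.
    - by move=> i _; congr pair; rewrite scaler0.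
  rewrite (_ : \sum_i (k 0 i *: (0, delta_mx 0 i)) = (0, k)); last first.
    rewrite {2}(row_sum_delta k); apply: (big_ind2 (fun a b => a = (0, b))) => //.
    - by move=> ? a ? b -> ->; congr pair; rewrite addr0.
    - by move=> i _; congr pair; rewrite scaler0.
  by congr pair; rewrite ?addr0 ?add0r.
rewrite hk linearD !linear_sum; congr (_ + _).
  by rewrite dotpC; apply: eq_bigr => i _; rewrite linearZ mxE.
by rewrite dotpC; apply: eq_bigr => i _; rewrite linearZ mxE.
Qed.

Lemma diff_partialB q q' v : differentiable phiR q -> differentiable phiR q' ->
  'd phiR q v - 'd phiR q' v =
  dotp (grad1 phi q.1 q.2 - grad1 phi q'.1 q'.2) v.1
  + dotp (grad2 phi q.1 q.2 - grad2 phi q'.1 q'.2) v.2.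
Proof.
case: q q' v => [q1 q2] [p1 p2] [v1 v2] dq dp /=.
rewrite !dotpBl addrACA -opprD.
exact: (congr2 (fun a b => a - b) (diff_partial v1 v2 dq) (diff_partial v1 v2 dp)).
Qed.

Lemma is_grad_chain (F : 'rV[R]_n -> 'rV[R]_m) p :
  differentiable F p -> differentiable phiR (p, F p) ->
  is_grad (fun u => phi (u, F u)) p
    (grad1 phi p (F p) + grad2 phi p (F p) *m Jac F p).
Proof.
move=> dF dphi.
pose H := fun u => (u, F u).
have dH : differentiable H p by apply: differentiable_pair.
have dc : differentiable (phiR \o H) p by exact: differentiable_comp.
apply/is_gradP; split; first exact: dc.
apply/rowP => i; rewrite mxE.
have -> : 'd (fun u => phi (u, F u) : R^o) p (delta_mx 0 i) =
    'd phiR (p, F p) ('d H p (delta_mx 0 i)).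
  by rewrite -[LHS]/('d (phiR \o H) p (delta_mx 0 i)) diff_comp.
have -> : 'd H p (delta_mx 0 i) = (delta_mx 0 i, 'd F p (delta_mx 0 i)).
  by rewrite diff_pair// diff_val.
rewrite diff_partial// dotp_delta [RHS]mxE; congr (_ + _).
rewrite [RHS]mxE /dotp; apply: eq_bigr => j _; congr (_ * _).
by rewrite !mxE.
Qed.

Hypothesis phiC1 : C1 phi.

Lemma partial_grads_continuous q0 e : 0 < e ->
  exists2 r, 0 < r & forall q, `|q0 - q| < r ->
    `|grad1 phi q.1 q.2 - grad1 phi q0.1 q0.2| <= e /\
    `|grad2 phi q.1 q.2 - grad2 phi q0.1 q0.2| <= e.
Proof.
move=> e0; case: phiC1 => dphi cphi.
have F0 : Filter (nbhs q0) := nbhs_filter _.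
have c1 v : \forall q \near q0, `|'d phiR q0 v - 'd phiR q v| <= e.
  have := cphi v q0.
  by move/(@cvgrPdist_le _ R^o _ (nbhs q0) F0) => /(_ e e0).
have n1 := @filter_forall _ _
  (fun i q => `|'d phiR q0 (delta_mx 0 i, 0) - 'd phiR q (delta_mx 0 i, 0)| <= e) _ F0
  (fun i : 'I_n => c1 (delta_mx 0 i, 0)).
have n2 := @filter_forall _ _
  (fun i q => `|'d phiR q0 (0, delta_mx 0 i) - 'd phiR q (0, delta_mx 0 i)| <= e) _ F0
  (fun i : 'I_m => c1 (0, delta_mx 0 i)).
have n12 : nbhs q0 [set q |
    (forall i : 'I_n, `|'d phiR q0 (delta_mx 0 i, 0) - 'd phiR q (delta_mx 0 i, 0)| <= e) /\
    (forall i : 'I_m, `|'d phiR q0 (0, delta_mx 0 i) - 'd phiR q (0, delta_mx 0 i)| <= e)].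
  exact: filterI n1 n2.
have /nbhs_ballP[r /= r0 rP] := n12.
exists r => // q q0q; have [H1 H2] : (forall i : 'I_n, `|'d phiR q0 (delta_mx 0 i, 0) - 'd phiR q (delta_mx 0 i, 0)| <= e) /\
   (forall i : 'I_m, `|'d phiR q0 (0, delta_mx 0 i) - 'd phiR q (0, delta_mx 0 i)| <= e).
  by apply: rP; rewrite -ball_normE.
case: q q0 H1 H2 {c1 n1 n2 n12 rP F0 q0q} => [q1 q2] [a1 a2] H1 H2 /=.
rewrite !grad1E// !grad2E//; split; apply: mx_norm_le; rewrite ?ltW// => i j.
  rewrite [X in `|X|]mxE [X in `|X + _|]mxE [X in `|_ + X|]mxE [X in `|_ - X|]mxE.
  rewrite distrC; exact: H1.
rewrite [X in `|X|]mxE [X in `|X + _|]mxE [X in `|_ + X|]mxE [X in `|_ - X|]mxE.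
rewrite distrC; exact: H2.
Qed.

Lemma normr_dotp_le k (a h : 'rV[R]_k) : `|dotp a h| <= k%:R * `|a| * `|h|.
Proof.
rewrite (le_trans (ler_norm_sum _ _ _))//.
apply: (@le_trans _ _ (\sum_(i < k) `|a| * `|h|)); last first.
  by rewrite sumr_const card_ord -[leLHS]mulr_natl mulrA.
by apply: ler_sum => i _; rewrite normrM; apply: ler_pM => //; exact: normr_coord_le.
Qed.

(** Mean value theorem on the segment from [q] to [q']: it stays in the ball about [q0], where the
    differential is close to that at [q0]. Both endpoints must be free because limiting gradients at
    [q0] involve increments based at nearby points. *)
Lemma strictly_differentiable q0 e : 0 < e ->
  exists2 r, 0 < r & forall q q', `|q0 - q| < r -> `|q0 - q'| < r ->
    `|phi q' - phi q - 'd phiR q0 (q' - q)| <= e * `|q' - q|.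
Proof.
move=> e0; have dphi q : differentiable phiR q by case: phiC1.
have nm0 : 0 < n%:R + m%:R + 1 :> R by rewrite ltr_wpDl// addr_ge0.
have [r r0 rP] := partial_grads_continuous q0 (divr_gt0 e0 nm0).
exists r => // q q' qr q'r; set v := q' - q.
pose g (t : R) : R := phi (q + t *: v).
pose dg (t : R) : R := 'd phiR (q + t *: v) v.
have gP (t : R) : is_derive t 1 g (dg t).
  apply: is_derive_epsilon => e' e'0.
  have v0 : 0 < `|v| + 1 by rewrite ltr_wpDl.
  have /nbhs_ballP[s /= s0 sP] := epsilon_differentiable (dphi (q + t *: v)) (divr_gt0 e'0 v0).
  exists (s / (`|v| + 1)); first by rewrite divr_gt0.
  move=> h; rewrite ltr_pdivlMr// => hs.
  have hv : `|h *: v| <= `|h| * (`|v| + 1) by rewrite normrZ ler_wpM2l// lerDl.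
  have hb : ball (0 : 'rV[R]_n * 'rV[R]_m) s (h *: v).
    by rewrite -ball_normE/= sub0r normrN; exact: le_lt_trans hv hs.
  have := sP _ hb; rewrite /= linearZ/= => H.
  rewrite /g scalerDl addrA (addrC (q + _)) mulrC.
  apply: (le_trans H); rewrite mulrAC ler_pdivrMr// -mulrA ler_pM2l//.
have cg : {within `[0, 1], continuous g}.
  by apply: derivable_within_continuous => t _; have [] := gP t.
have [t] := @MVT R g dg 0 1 ltr01 (fun t _ => gP t) cg.
rewrite in_itv/= => /andP[t0 t1]; rewrite /g /dg scale1r scale0r addr0 subr0 mulr1.
rewrite (_ : q + v = q'); last by rewrite addrC subrK.
move=> ->; set z := q + t *: v.
have zr : `|q0 - z| < r.
  have -> : q0 - z = (1 - t) *: (q0 - q) + t *: (q0 - q').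
    rewrite /z /v; apply: injective_projections; apply/rowP => j;
    by rewrite /= !mxE; ring.
  rewrite (le_lt_trans (ler_normD _ _))// !normrZ (gtr0_norm t0).
  rewrite (@gtr0_norm _ (1 - t)) ?subr_gt0//.
  rewrite (_ : r = (1 - t) * r + t * r); last by ring.
  by apply: ltrD; rewrite ltr_pM2l// subr_gt0.
have [g1 g2] := rP z zr.
have -> := diff_partialB v (dphi z) (dphi q0).
set V := `|v|.
have V1 : `|v.1| <= V by rewrite /V prod_normE/= le_max lexx.
have V2 : `|v.2| <= V by rewrite /V prod_normE/= le_max lexx orbT.
rewrite (le_trans (ler_normD _ _))//.
apply: (@le_trans _ _ ((n%:R + m%:R) * (e / (n%:R + m%:R + 1)) * V)).
  rewrite mulrDl mulrDl; apply: lerD; apply: (le_trans (normr_dotp_le _ _));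
    by apply: ler_pM => //; apply: ler_wpM2l.
apply: ler_wpM2r; first exact: normr_ge0.
by rewrite mulrA ler_pdivrMr// mulrC ler_pM2l// lerDl.
Qed.

End partial_gradients.

Section generalized_gradients.
Context {R : realType} (n m : nat) (L : R) (y : 'rV[R]_n -> 'rV[R]_m).
Hypothesis L0 : 0 <= L.
Hypothesis yL : forall j u v, `|y u 0 j - y v 0 j| <= L * enorm (u - v).

Local Notation D0 := [set p | differentiable y p].
Local Notation JL K := (limits_over D0 K (Jac y)).

Lemma Jac_bound p : differentiable y p -> `|Jac y p| <= L.
Proof.
move=> dy; apply: mx_norm_le => // i j.
have /(_ i) yi := (is_grad_JacP y p (Jac y p)).2 (conj dy erefl).
apply: le_trans (is_grad_bound L0 (yL i) yi).
by have := normr_coord_le_enorm (row i (Jac y p)) j; rewrite [row _ _ _ _]mxE.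
Qed.

(** The shared entry to the hull: with [K] a point it captures limiting gradients, with [K] the ball
    it captures the hypergradient. *)
Lemma conv_hull_limits K (w : 'rV[R]_m) (b v : 'rV[R]_n) : compact K ->
  (forall d eta, 0 < eta -> exists p s, [/\ K s, differentiable y p,
     enorm (p - s) <= eta & dotp (v - b) d - eta <= dotp (w *m Jac y p) d]) ->
  conv_hull [set b + w *m V | V in JL K] v.
Proof.
move=> cK H; apply: conv_hull_support.
  exact: (limits_over_compact cK Jac_bound).
move=> d.
have [V KV le] := limits_over_ge cK Jac_bound (H d).
exists (b + w *m V); first by exists V.
by move: le; rewrite dotpBl dotpDl; lra.
Qed.

Section at_point.
Variables (O : set 'rV[R]_n) (f : 'rV[R]_n -> R) (z b : 'rV[R]_n) (w : 'rV[R]_m).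

Local Notation grads :=
  (limit_set [set p | O p /\ differentiable (f : 'rV[R]_n -> R^o) p] (grad f) z).

Lemma limit_grads_sub_hull :
  (forall e, 0 < e -> exists2 r, 0 < r & forall u u',
     enorm (u - z) < r -> enorm (u' - z) < r ->
     `|f u' - f u - dotp b (u' - u) - dotp w (y u' - y u)| <= e * enorm (u' - u)) ->
  grads `<=` conv_hull [set b + w *m V | V in JL [set z]].
Proof.
move=> HS v /limit_setP vz; apply: conv_hull_limits; first exact: compact_set1.
move=> d eta eta0.
have d1 : 0 < enorm d + 1 by rewrite ltr_wpDl ?enorm_ge0.
(* Three errors of [eta / 4] occur on the slope: [v] against the gradient at [u], that gradient
   against the increment of [f], and the increment of [f] against its model. The last [eta / 4] goes
   to [increment_Jac_le]. *)
pose e := eta / 4 / (enorm d + 1).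
have e0 : 0 < e by rewrite !divr_gt0.
have ed : e * enorm d <= eta / 4.
  apply: (@le_trans _ _ (e * (enorm d + 1))); first by rewrite ler_wpM2l ?ltW// ltrDl.
  by rewrite /e divfK// gt_eqF.
have [r r0 rP] := HS e e0.
have n1 : 0 < n%:R + 1 :> R by rewrite ltr_wpDl.
pose s := Num.min (r / 2) (eta / 2).
have s0 : 0 < s by rewrite lt_min !divr_gt0.
have se0 : 0 < Num.min s e by rewrite lt_min s0.
have [u [[Ou du] zu vu]] := vz _ (divr_gt0 se0 n1).
move/enorm_lt_mx in zu; move/enorm_lt_mx in vu; rewrite lt_min in zu; rewrite lt_min in vu.
case/andP : zu => zus _; case/andP : vu => _ vue.
move: zus; rewrite /s lt_min => /andP[zur zue].
have gu : is_grad f u (grad f u) by apply/is_gradP.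
have [r' r'0 A] := gu e e0.
(* The step [t *: d] stays where the model is valid ([r]), where the gradient at [u] is accurate
   ([r']), and short enough for [p] to be within [eta] of [z]. *)
pose t := Num.min (Num.min (r / 2) (eta / 4)) (r' / 2) / (enorm d + 1).
have t0 : 0 < t by rewrite divr_gt0// !lt_min !divr_gt0.
have td c : 0 <= c -> t * (enorm d + 1) <= c -> t * enorm d <= c.
  move=> c0; apply: le_trans; by rewrite ler_wpM2l ?ltW// ltrDl.
have tm : t * (enorm d + 1) = Num.min (Num.min (r / 2) (eta / 4)) (r' / 2).
  by rewrite /t divfK// gt_eqF.
have tdr : t * enorm d <= r / 2.
  by apply: td; [rewrite divr_ge0 ?ltW|rewrite tm !ge_min lexx].
have tde : t * enorm d <= eta / 4.
  by apply: td; [rewrite divr_ge0 ?ltW|rewrite tm !ge_min lexx ?orbT].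
have tdr' : t * enorm d <= r' / 2.
  by apply: td; [rewrite divr_ge0 ?ltW|rewrite tm !ge_min lexx ?orbT].
have ntd : enorm (t *: d) = t * enorm d by rewrite enormZ gtr0_norm.
have h1 := A (t *: d); rewrite ntd in h1.
have lt1 : r' / 2 < r' by lra.
have {h1} := h1 (le_lt_trans tdr' lt1); rewrite /= dotpZr => h1.
have uz : enorm (u - z) < r by rewrite enormB; lra.
have utz : enorm (u + t *: d - z) < r.
  rewrite addrAC; apply: le_lt_trans (enormD _ _) _; rewrite ntd enormB; lra.
have := rP u (u + t *: d) uz utz.
rewrite (_ : u + t *: d - u = t *: d); last by rewrite addrAC subrr add0r.
rewrite ntd !dotpZr dotpBr => h2.
have h3 : `|dotp (v - grad f u) d| <= eta / 4.
  apply: le_trans (cauchy_schwarz _ _) _; apply: le_trans ed.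
  by apply: ler_wpM2r; [exact: enorm_ge0|exact: ltW].
have inc : (dotp (v - b) d - 3 / 4 * eta) * t <=
    dotp w (y (u + t *: d)) - dotp w (y u).
  move: h1 h2 h3; rewrite !dotpBl !(mulrCA e) => h1 h2.
  have ted : t * (e * enorm d) <= t * (eta / 4) by rewrite ler_pM2l.
  move: (f _) (f _) (dotp w _) (dotp w _) (dotp (grad f u) d) (dotp v d) (dotp b d) h1 h2.
  move=> a1 a2 a3 a4 a5 a6 a7; rewrite !ler_norml.
  move=> /andP[? ?] /andP[? ?] /andP[k1 k2].
  have : t * (a6 - a5) <= t * (eta / 4) by rewrite ler_pM2l.
  by lra.
have eta4 : 0 < eta / 4 by rewrite divr_gt0.
have [p [pu dp le]] := increment_Jac_le L0 yL t0 inc eta4.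
exists p, z; split => //; last by lra.
rewrite (_ : p - z = (p - u) + (u - z)); last by rewrite addrA subrK.
apply: le_trans (enormD _ _) _; rewrite [enorm (u - z)]enormB; lra.
Qed.

(** Along points where [y] is differentiable, the gradients of [f] converge as soon as the Jacobians
    do. The coefficients [bp] and [wp] may vary with the point: they are constant for the anchored
    model and move for the hyperobjective. *)
Lemma hull_sub_limit_grads (bp : 'rV[R]_n -> 'rV[R]_n) (wp : 'rV[R]_n -> 'rV[R]_m) :
  (forall e, 0 < e -> exists2 r, 0 < r & forall p, `|z - p| < r -> differentiable y p ->
     [/\ O p, is_grad f p (bp p + wp p *m Jac y p), `|b - bp p| <= e & `|w - wp p| <= e]) ->
  [set b + w *m V | V in JL [set z]] `<=` grads.
Proof.
move=> H _ [V [_ -> /limit_setP Vz] <-]; apply/limit_setP => e e0.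
(* The terms weigh the errors in [b], in the Jacobian and in [w], in this order. *)
pose M := 1 + m%:R * `|w| + m%:R * L.
have M0 : 0 < M by rewrite /M -addrA ltr_pwDl// addr_ge0// mulr_ge0.
have eM : 0 < e / 2 / M by rewrite !divr_gt0.
have [r r0 rP] := H _ eM.
have m0 : 0 < Num.min e (Num.min r (e / 2 / M)) by rewrite !lt_min e0 r0.
have [p [dp zp Vp]] := Vz _ m0.
move: zp Vp; rewrite !lt_min => /and3P[zpe zpr _] /and3P[_ _ Vpe].
have [Op /is_gradP[df gE] bpe wpe] := rP p zpr dp.
exists p; split => //; rewrite gE.
rewrite (_ : _ - _ = (b - bp p) + (w *m (V - Jac y p) + (w - wp p) *m Jac y p)); last first.
  rewrite mulmxBr mulmxBl (addrA (w *m V - _)) subrK opprD.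
  by rewrite addrACA.
apply: (@le_lt_trans _ _ (e / 2)); last by lra.
rewrite (le_trans (ler_normD _ _))//.
have h1 := ler_normD (w *m (V - Jac y p)) ((w - wp p) *m Jac y p).
have h2 := mx_norm_mulmx_le w (V - Jac y p).
have h3 := mx_norm_mulmx_le (w - wp p) (Jac y p).
set q := e / 2 / M in eM bpe wpe Vpe.
have h4 : m%:R * `|w| * `|V - Jac y p| <= m%:R * `|w| * q.
  by apply: ler_wpM2l; [rewrite mulr_ge0|exact: ltW].
have h5 : m%:R * `|w - wp p| * `|Jac y p| <= m%:R * q * L.
  by apply: ler_pM; rewrite ?mulr_ge0// ?ler_wpM2l// Jac_bound.
have -> : e / 2 = q + (m%:R * `|w| * q + m%:R * q * L).
  by rewrite /q /M; field; rewrite gt_eqF.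
by lra.
Qed.

End at_point.

End generalized_gradients.

(** * Localization *)

Section locality.
Context {R : realType}.

Lemma eball_nbhs n (x z : 'rV[R]_n) r : enorm (z - x) < r ->
  nbhs z [set p | enorm (p - x) < r].
Proof.
move=> zx; apply/nbhs_enormP; exists (r - enorm (z - x)); first by rewrite subr_gt0.
move=> h hr /=; rewrite addrAC; apply: le_lt_trans (enormD _ _) _; lra.
Qed.

Lemma eq_is_grad n (f g : 'rV[R]_n -> R) p a : (\forall u \near p, f u = g u) ->
  is_grad f p a -> is_grad g p a.
Proof.
move=> /nbhs_enormP[r r0 fg] fa e e0; have [s s0 A] := fa e e0.
exists (Num.min r s); first by rewrite lt_min r0.
move=> h; rewrite lt_min => /andP[hr hs].
have f0 : f p = g p by have := fg 0; rewrite addr0 enorm0; apply.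
by rewrite -f0 -(fg h hr); exact: A.
Qed.

Lemma eq_differentiable n m (F G : 'rV[R]_n -> 'rV[R]_m) p :
  (\forall u \near p, F u = G u) -> differentiable F p ->
  differentiable G p /\ Jac G p = Jac F p.
Proof.
move=> FG dF; apply/is_grad_JacP => j.
have := (is_grad_JacP F p (Jac F p)).2 (conj dF erefl) j.
by apply: eq_is_grad; apply: filterS FG => u ->.
Qed.

Lemma is_grad_affine n m (F : 'rV[R]_n -> 'rV[R]_m) (c : R) x y0 b w p :
  differentiable F p ->
  is_grad (fun u => c + dotp b (u - x) + dotp w (F u - y0)) p (b + w *m Jac F p).
Proof.
move=> dF e e0; have [r r0 A] := is_grad_dotp w dF e0.
exists r => // h hr; apply: le_trans (A h hr).
rewrite le_eqVlt; apply/orP; left; apply/eqP; congr (`| _ |).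
by rewrite !dotpBr dotpDl dotpDr; ring.
Qed.

Lemma mcshane n (K : set 'rV[R]_n) (L : R) (f : 'rV[R]_n -> R) : 0 <= L ->
  K !=set0 -> (forall u v, K u -> K v -> `|f u - f v| <= L * enorm (u - v)) ->
  exists g : 'rV[R]_n -> R, (forall u v, `|g u - g v| <= L * enorm (u - v)) /\
    forall u, K u -> g u = f u.
Proof.
move=> L0 [a0 Ka0] fL.
pose S u := [set f a + L * enorm (u - a) | a in K].
have lbS u a v : K a -> K v -> f v - L * enorm (u - v) <= f a + L * enorm (u - a).
  move=> Ka Kv; have := fL _ _ Kv Ka.
  have : L * enorm (v - a) <= L * (enorm (u - v) + enorm (u - a)).
    apply: ler_wpM2l => //; rewrite (enormB u v).
    rewrite (_ : v - a = (v - u) + (u - a)); first exact: enormD.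
    by rewrite addrA subrK.
  by rewrite mulrDr ler_norml => ? /andP[? ?]; lra.
have hS u : has_inf (S u).
  split; first by exists (f a0 + L * enorm (u - a0)), a0.
  by exists (f a0 - L * enorm (u - a0)) => _ [a Ka <-]; exact: lbS.
pose g u := inf (S u).
have gle u v : g u <= g v + L * enorm (u - v).
  rewrite -lerBlDr; apply: lb_le_inf; first exact: (hS v).1.
  move=> _ [a Ka <-]; rewrite lerBlDr.
  apply: (@le_trans _ _ (f a + L * enorm (u - a))).
    by apply: ge_inf; [exact: (hS u).2|exists a].
  rewrite -addrA lerD2l -mulrDr; apply: ler_wpM2l => //.
  rewrite (_ : u - a = (v - a) + (u - v)); first exact: enormD.
  by apply/rowP => j; rewrite !mxE; ring.
exists g; split=> [u v|u Ku].
  have := gle u v; have := gle v u; rewrite (enormB v u) ler_norml => ? ?.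
  by apply/andP; split; lra.
apply/eqP; rewrite eq_le; apply/andP; split.
  apply: ge_inf; first exact: (hS u).2.
  by exists u => //; rewrite subrr enorm0 mulr0 addr0.
apply: lb_le_inf; first exact: (hS u).1.
move=> _ [a Ka <-]; have := lbS u a u Ka Ku.
by rewrite subrr enorm0 mulr0 subr0.
Qed.

Lemma compact_eball n (x : 'rV[R]_n) r : compact (eball x r).
Proof.
apply: bounded_closed_compact.
  exists (`|x| + r); split; first exact: num_real.
  move=> M xM z zx; have := ler_normD (z - x) x; rewrite subrK => /le_trans; apply.
  apply: ltW; apply: le_lt_trans xM; rewrite addrC lerD2l.
  exact: le_trans (mx_norm_le_enorm _) zx.
apply: (@closed_comp _ _ (fun z : 'rV[R]_n => enorm (z - x)) [set s | s <= r]).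
  move=> z _; apply: (@elipschitz_continuous _ _ 1) => u v; rewrite mul1r.
  have := enormD (u - v) (v - x); have := enormD (v - u) (u - x).
  rewrite !addrA !subrK (enormB v u) => ? ?.
  by rewrite ler_norml; apply/andP; split; lra.
exact: closed_le.
Qed.

Lemma eball_sub_open n (x : 'rV[R]_n) r (N : set 'rV[R]_n) :
  open N -> eball x r `<=` N -> exists2 eta, 0 < eta & eball x (r + eta) `<=` N.
Proof.
move=> oN rN; apply: contrapT => H.
have e0 k : 0 < k.+1%:R^-1 :> R by rewrite invr_gt0.
have /choice[u uP] : forall k : nat, exists u, eball x (r + k.+1%:R^-1) u /\ ~ N u.
  move=> k; apply: contrapT => nu; apply: H; exists k.+1%:R^-1 => // v vx.
  by apply: contrapT => Nv; apply: nu; exists v.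
have [|q _ cl] := compact_seq_cluster (@compact_eball n x (r + 1)) (u := u).
  move=> k; have [ux _] := uP k; rewrite /eball/=; apply: le_trans ux _.
  by rewrite lerD2l invf_le1// ler1n.
have n1 : 0 < n%:R + 1 :> R by rewrite ltr_wpDl.
have Nq : N q.
  apply: rN; rewrite /eball/=; apply/ler_addgt0Pr => e e1.
  have e2 : 0 < e / 2 by rewrite divr_gt0.
  have [M Me] : exists M : nat, M.+1%:R^-1 < e / 2.
    by near \oo => i; exists i; near: i; exact: near_infty_natSinv_lt (PosNum e2).
  have [k Mk /enorm_lt_mx qk] := cl _ M (divr_gt0 e2 n1).
  have [uk _] := uP k.
  have km : k.+1%:R^-1 <= M.+1%:R^-1 :> R by rewrite lef_pV2 ?posrE// ler_nat ltnS.
  rewrite (_ : q - x = (q - u k) + (u k - x)); last by rewrite addrA subrK.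
  apply: le_trans (enormD _ _) _; move: uk; rewrite /eball/= => uk.
  move: uk km Me; move: (k.+1%:R^-1) (M.+1%:R^-1) => a b; lra.
have /nbhs_ballP[s /= s0 sN] : nbhs q N by exact: open_nbhs_nbhs.
have [k _ qk] := cl s 0%N s0.
have [_] := uP k; apply; apply: sN; by rewrite -ball_normE.
Unshelve. all: by end_near. Qed.

(** Local constants cannot be chained along segments, which may leave [K]. Instead, pairs violating
    the constant [k] for each [k] cluster at some [(u0, v0)]. If [u0 = v0], the local constant there
    is contradicted; otherwise distances stay above [D / 2] while increments of [y] stay below
    [M]. *)
Lemma locally_lipschitz_compact n m (N K : set 'rV[R]_n) (y : 'rV[R]_n -> 'rV[R]_m) :
  open N -> locally_lipschitz N y -> compact K -> K `<=` N ->
  exists2 L, 0 <= L & forall u v, K u -> K v -> enorm (y u - y v) <= L * enorm (u - v).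
Proof.
move=> oN yloc cK KN; apply: contrapT => H.
have /choice[uv uvP] : forall k : nat, exists uv : 'rV[R]_n * 'rV[R]_n,
    [/\ K uv.1, K uv.2 & k%:R * enorm (uv.1 - uv.2) < enorm (y uv.1 - y uv.2)].
  move=> k; apply: contrapT => nuv; apply: H; exists k%:R => // u v Ku Kv.
  by rewrite leNgt; apply/negP => lt; apply: nuv; exists (u, v).
have [|[u0 v0] [/= Ku0 Kv0] cl] := compact_seq_cluster (compact_setX cK cK) (u := uv).
  by move=> k; have [] := uvP k.
have n1 : 0 < n%:R + 1 :> R by rewrite ltr_wpDl.
have loc a : K a -> exists C, exists2 r, 0 < r &
    forall u v, enorm (u - a) < r -> enorm (v - a) < r ->
      enorm (y u - y v) <= C * enorm (u - v).
  move=> Ka; have [C [U aU CU]] := yloc a (KN a Ka).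
  have aN : nbhs a N by apply: open_nbhs_nbhs; split => //; exact: KN.
  have /nbhs_enormP[r r0 rP] : nbhs a (U `&` N) by exact: filterI.
  exists C, r => // u v ua va; apply: CU.
    by have := rP _ ua; rewrite addrC subrK.
  by have := rP _ va; rewrite addrC subrK.
have [C1 [r1 r10 P1]] := loc u0 Ku0.
have [C2 [r2 r20 P2]] := loc v0 Kv0.
have pick e (N0 : nat) : 0 < e -> exists k, [/\ (N0 <= k)%N, enorm ((uv k).1 - u0) < e & enorm ((uv k).2 - v0) < e].
  move=> e0; have [k Nk] := cl _ N0 (divr_gt0 e0 n1).
  rewrite prod_normE/= gt_max => /andP[/enorm_lt_mx + /enorm_lt_mx].
  by rewrite enormB => ? h; exists k; split => //; rewrite enormB.
have [uv0|uv0] := eqVneq u0 v0.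
  subst v0.
  have [k [Nk uk vk]] := pick r1 (Num.bound `|C1|) r10.
  have [_ _] := uvP k; apply/negP; rewrite -leNgt.
  apply: le_trans (P1 _ _ uk vk) _; apply: ler_wpM2r; first exact: enorm_ge0.
  apply: le_trans (ler_norm _) _; apply: le_trans (ltW (archi_boundP _)) _ => //.
  by rewrite ler_nat.
pose D := enorm (u0 - v0).
have D0 : 0 < D.
  rewrite lt_def enorm_ge0 andbT; apply: contra uv0 => /eqP/enorm_eq0/eqP.
  by rewrite subr_eq0.
pose M := `|C1| * r1 + enorm (y u0 - y v0) + `|C2| * r2.
have M0 : 0 <= M by rewrite /M !addr_ge0 ?mulr_ge0 ?enorm_ge0// ltW.
pose s := Num.min (Num.min r1 r2) (D / 4).
have s0 : 0 < s by rewrite !lt_min r10 r20 divr_gt0.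
have [k [Nk uk vk]] := pick s (Num.bound (M / (D / 2))) s0.
have [_ _] := uvP k; apply/negP; rewrite -leNgt.
rewrite /s !lt_min in uk vk.
case/andP : uk => /andP[uk1 _] uk3; case/andP : vk => /andP[_ vk2] vk3.
have yM : enorm (y (uv k).1 - y (uv k).2) <= M.
  have b1 : enorm (y (uv k).1 - y u0) <= `|C1| * r1.
    have := P1 _ u0 uk1; rewrite subrr enorm0 => /(_ r10)/le_trans; apply.
    apply: (@le_trans _ _ (`|C1| * enorm ((uv k).1 - u0))).
      by apply: ler_wpM2r; [exact: enorm_ge0|exact: ler_norm].
    by apply: ler_wpM2l => //; exact: ltW.
  have b2 : enorm (y (uv k).2 - y v0) <= `|C2| * r2.
    have := P2 _ v0 vk2; rewrite subrr enorm0 => /(_ r20)/le_trans; apply.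
    apply: (@le_trans _ _ (`|C2| * enorm ((uv k).2 - v0))).
      by apply: ler_wpM2r; [exact: enorm_ge0|exact: ler_norm].
    by apply: ler_wpM2l => //; exact: ltW.
  rewrite (_ : y (uv k).1 - y (uv k).2 =
    (y (uv k).1 - y u0) + (y u0 - y v0) + (y v0 - y (uv k).2)); last first.
    by apply/rowP => j; rewrite !mxE; ring.
  apply: le_trans (enormD _ _) _; rewrite (enormB (y v0)) /M lerD//.
  by apply: le_trans (enormD _ _) _; rewrite lerD2r.
apply: (le_trans yM).
have Dk : D / 2 <= enorm ((uv k).1 - (uv k).2).
  have : D <= enorm (u0 - (uv k).1) + enorm ((uv k).1 - (uv k).2) + enorm ((uv k).2 - v0).
    rewrite /D (_ : u0 - v0 = (u0 - (uv k).1) + ((uv k).1 - (uv k).2) + ((uv k).2 - v0)).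
      by apply: le_trans (enormD _ _) _; rewrite lerD2r; exact: enormD.
    by apply/rowP => j; rewrite !mxE; ring.
  by rewrite (enormB u0); lra.
apply: (@le_trans _ _ (k%:R * (D / 2))); last by rewrite ler_wpM2l.
rewrite -ler_pdivrMr ?divr_gt0//.
apply: le_trans (ltW (archi_boundP _)) _; first by rewrite !divr_ge0// ltW.
by rewrite ler_nat.
Qed.

End locality.

Section affine_hulls.
Context {R : realType} (V W : lmodType R).

(** Images and preimages of convex sets under an affine map are convex. Used to move [d_y] through
    the hull in [clarke_jac] and to pull [d_x] out of the Goldstein hull. *)
Lemma conv_hull_affine (T : {linear V -> W}) b (A : set V) :
  conv_hull [set b + T a | a in A] = [set b + T a | a in conv_hull A].
Proof.
apply/seteqP; split.
  apply: conv_hull_min; last first.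
    by move=> _ [a Aa <-]; exists a => //; exact: sub_conv_hull.
  apply/convex_setP => _ _ t t01 [a Aa <-] [c Ac <-].
  exists (t *: a + (1 - t) *: c).
    by have /convex_setP := @conv_hull_convex _ _ A; apply.
  rewrite linearD !linearZ/= !scalerDr addrACA -scalerDl.
  by rewrite [t + _]addrC subrK scale1r.
move=> _ [a + <-]; move: a.
apply: (@conv_hull_min _ _ A
  [set a | conv_hull [set b + T a | a in A] (b + T a)]); last first.
  by move=> a Aa; apply: sub_conv_hull; exists a.
apply/convex_setP => a c t t01 /= Ha Hc.
have -> : b + T (t *: a + (1 - t) *: c) = t *: (b + T a) + (1 - t) *: (b + T c).
  rewrite linearD !linearZ/= !scalerDr addrACA -scalerDl.
  by rewrite [t + _]addrC subrK scale1r.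
by have /convex_setP := @conv_hull_convex _ _ [set b + T a | a in A]; apply.
Qed.

End affine_hulls.

(** * The conclusions in terms of the Lipschitz extension *)

Section local_model.
Context {R : realType} (n m : nat).
Variables (N : set 'rV[R]_n) (y yt : 'rV[R]_n -> 'rV[R]_m) (x : 'rV[R]_n).
Variables (delta eta L : R).
Hypothesis delta0 : 0 < delta.
Hypothesis eta0 : 0 < eta.
Hypothesis L0 : 0 <= L.
Hypothesis yL : forall j u v, `|yt u 0 j - yt v 0 j| <= L * enorm (u - v).
Hypothesis KN : eball x (delta + eta) `<=` N.
Hypothesis yE : forall u, eball x (delta + eta) u -> yt u = y u.

Local Notation JL K := (limits_over [set p | differentiable yt p] K (Jac yt)).

Let ball_lt s : eball x delta s -> enorm (s - x) < delta + eta.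
Proof. by move=> /le_lt_trans; apply; rewrite ltrDl. Qed.

Let nbhs_extension s : eball x delta s ->
  nbhs s [set p | enorm (p - x) < delta + eta].
Proof. by move=> /ball_lt; exact: eball_nbhs. Qed.

Let near_extension s : enorm (s - x) < delta + eta -> \forall u \near s, yt u = y u.
Proof. by move=> /eball_nbhs; apply: filterS => u /= /ltW/yE. Qed.

Let near_extensionV s : enorm (s - x) < delta + eta -> \forall u \near s, y u = yt u.
Proof. by move=> /near_extension; apply: filterS. Qed.

Lemma clarke_jac_extension s : eball x delta s ->
  clarke_jac N y s = conv_hull (limit_set [set p | differentiable yt p] (Jac yt) s).
Proof.
move=> xs; have xU := nbhs_extension xs.
suff <- : limit_set [set p | N p /\ differentiable y p] (Jac y) s =
    limit_set [set p | differentiable yt p] (Jac yt) s by [].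
apply/seteqP; split; apply: (eq_limit_set xU) => p /= px.
  move=> [_ dy]; have [dyt JE] := eq_differentiable (near_extensionV px) dy.
  exact: conj dyt (esym JE).
move=> dyt; have [dy JE] := eq_differentiable (near_extension px) dyt.
exact: conj (conj (KN (ltW px)) dy) (esym JE).
Qed.

(** For [u] within [eta] of [x], all sample points lie in the ball of radius [delta + eta].
    Agreement on a neighbourhood, not just at [x], is what transfers the Jacobian. *)
Lemma smoothing_extension : \forall u \near x, smoothing yt delta u = smoothing y delta u.
Proof.
apply/nbhs_enormP; exists eta => // h heta; apply/rowP => j.
rewrite !mxE /unif_ball_mean; congr (_ * _); apply: eq_Rintegral => t.
rewrite inE => /= t1; rewrite yE// /eball/=.
rewrite (_ : _ - x = delta *: row_of_tuple t + h); last first.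
  by apply/rowP => i; rewrite !mxE; ring.
apply: (le_trans (enormD _ _)); apply: lerD; last exact: ltW.
rewrite enormZ gtr0_norm// -[leRHS]mulr1; apply: ler_wpM2l; first exact: ltW.
by move: t1; rewrite /unit_tball/eball/= subr0.
Qed.

Lemma smoothing_extension_Jac : differentiable (smoothing y delta) x /\
  Jac (smoothing y delta) x = Jac (smoothing yt delta) x.
Proof.
apply: eq_differentiable smoothing_extension _.
exact: (smoothing_differentiable L0 yL x delta0).
Qed.

Lemma clarke_subdiff_extension (f : 'rV[R]_n -> R) z b w bp wp :
  (forall e, 0 < e -> exists2 r, 0 < r & forall u u',
     enorm (u - z) < r -> enorm (u' - z) < r ->
     `|f u' - f u - dotp b (u' - u) - dotp w (yt u' - yt u)| <= e * enorm (u' - u)) ->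
  (forall e, 0 < e -> exists2 r, 0 < r & forall p, `|z - p| < r -> differentiable yt p ->
     [/\ N p, is_grad f p (bp p + wp p *m Jac yt p), `|b - bp p| <= e & `|w - wp p| <= e]) ->
  clarke_subdiff N f z = conv_hull [set b + w *m V | V in JL [set z]].
Proof.
move=> H1 H2; apply/seteqP; split.
  apply: conv_hull_min; first exact: conv_hull_convex.
  exact: (limit_grads_sub_hull L0 yL H1).
apply: conv_hull_min; first exact: conv_hull_convex.
move=> v Hv; apply: sub_conv_hull.
exact: (hull_sub_limit_grads L0 yL H2 Hv).
Qed.

Variable phi : 'rV[R]_n * 'rV[R]_m -> R.

Let ball_small z : eball x delta z -> exists2 r, 0 < r &
  (forall u, enorm (u - z) < r -> enorm (u - x) < delta + eta) /\
  (forall u, `|z - u| < r -> enorm (u - x) < delta + eta).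
Proof.
move=> /nbhs_extension zx; have /nbhs_enormP[r r0 rP] := zx.
have /nbhs_ballP[s /= s0 sP] := zx.
exists (Num.min r s); first by rewrite lt_min r0.
split=> u; rewrite lt_min => /andP[ur us].
  by have := rP _ ur; rewrite /= [z + _]addrC subrK.
by apply: sP; rewrite -ball_normE.
Qed.

(** The increment model holds with zero error and the same coefficients at every [z] of the ball,
    since the anchored model is affine in the pair of [u] and [y u]. *)
Lemma clarke_subdiff_anchored z : eball x delta z ->
  clarke_subdiff N (anchored phi y x) z =
  conv_hull [set d_x phi y x + d_y phi y x *m V | V in JL [set z]].
Proof.
move=> zx; have [r r0 [rP rP']] := ball_small zx.
apply: (clarke_subdiff_extension (bp := fun=> d_x phi y x) (wp := fun=> d_y phi y x)).
  move=> e e0; exists r => // u u' /rP ux /rP u'x.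
  rewrite /anchored (yE (ltW ux)) (yE (ltW u'x)) !dotpBr.
  rewrite [X in `|X|](_ : _ = 0); last by ring.
  by rewrite normr0 mulr_ge0 ?enorm_ge0// ltW.
move=> e e0; exists r => // p /rP' px dyt; rewrite !subrr !normr0 (ltW e0).
split => //; first by apply: KN; exact: ltW.
have [dy <-] := eq_differentiable (near_extension px) dyt.
exact: is_grad_affine.
Qed.

(** The coefficients are those of the differential of [phi] at [(x, y x)], so this is tied to the
    anchor. Strict differentiability there gives the increment model, and continuity of the partial
    gradients makes the coefficients of the chain rule converge. *)
Lemma clarke_subdiff_hyperobjective : C1 phi ->
  clarke_subdiff N (hyperobjective phi y) x =
  conv_hull [set d_x phi y x + d_y phi y x *m V | V in JL [set x]].
Proof.
move=> phiC1; have xx : eball x delta x by rewrite /eball/= subrr enorm0 ltW.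
have [r0 r00 [rP rP']] := ball_small xx.
have yx : yt x = y x by apply/yE; apply/ltW/ball_lt.
have dphi q : differentiable (phi : _ -> R^o) q by case: phiC1.
have y_le u v : `|yt u - yt v| <= L * enorm (u - v).
  apply: mx_norm_le => [|i j]; first by rewrite mulr_ge0 ?enorm_ge0.
  by rewrite ord1 !mxE.
pose C := 1 + L.
have C0 : 0 < C by rewrite ltr_wpDr.
have pair_le u v : `|(u, yt u) - (v, yt v)| <= C * enorm (u - v).
  rewrite prod_normE/= ge_max /C mulrDl mul1r; apply/andP; split.
    by rewrite ler_wpDr ?mulr_ge0 ?enorm_ge0//; exact: mx_norm_le_enorm.
  by rewrite ler_wpDl ?enorm_ge0//; exact: y_le.
apply: (clarke_subdiff_extension (bp := fun p => grad1 phi p (yt p))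
  (wp := fun p => grad2 phi p (yt p))).
  move=> e e0; have [r r1 H] := strictly_differentiable phiC1 (x, yt x) (divr_gt0 e0 C0).
  exists (Num.min r0 (r / C)); first by rewrite lt_min r00 divr_gt0.
  move=> u u'; rewrite !lt_min => /andP[/rP ux ur] /andP[/rP u'x u'r].
  have near_r v : enorm (v - x) < r / C -> `|(x, yt x) - (v, yt v)| < r.
    by rewrite ltr_pdivlMr// mulrC enormB; exact: le_lt_trans (pair_le _ _).
  have := H _ _ (near_r _ ur) (near_r _ u'r).
  rewrite diff_partial// yx -/(d_x phi y x) -/(d_y phi y x).
  rewrite /hyperobjective -(yE (ltW ux)) -(yE (ltW u'x)) opprD addrA => /le_trans; apply.
  rewrite -mulrA ler_pM2l// ler_pdivrMl//; exact: pair_le.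
move=> e e0; have [r r1 H] := partial_grads_continuous phiC1 (x, yt x) e0.
have K0 : 0 < C * (n%:R + 1) by rewrite mulr_gt0// ltr_wpDl.
exists (Num.min r0 (r / (C * (n%:R + 1)))); first by rewrite lt_min r00 divr_gt0.
move=> p; rewrite lt_min => /andP[/rP' px pr] dyt.
have [|/= g1 g2] := H (p, yt p).
  apply: le_lt_trans (pair_le _ _) _; rewrite -ltr_pdivlMl//.
  by apply: enorm_lt_mx; rewrite [C^-1 * r]mulrC -mulrA -invfM.
rewrite /d_x /d_y -yx distrC g1 distrC g2; split => //.
  by apply: KN; exact: ltW.
apply: (@eq_is_grad _ _ (fun u => phi (u, yt u))).
  by apply: filterS (near_extension px) => u /= ->.
exact: is_grad_chain.
Qed.

Lemma goldstein_anchored : goldstein N (anchored phi y x) delta x =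
  conv_hull [set d_x phi y x + d_y phi y x *m V | V in JL (eball x delta)].
Proof.
rewrite /goldstein; have -> : N `&` eball x delta = eball x delta.
  apply/setIidr => z /ball_lt/ltW; exact: KN.
rewrite (@eq_bigcupr _ _ _ _ (fun z => conv_hull
  [set d_x phi y x + d_y phi y x *m V | V in JL [set z]])); last first.
  by move=> z zx; exact: clarke_subdiff_anchored.
rewrite conv_hull_bigcup; congr conv_hull; apply/seteqP; split.
  by move=> _ [z zx [V [_ -> zV] <-]]; exists V => //; exists z.
by move=> _ [V [z zx zV] <-]; exists z => //; exists V => //; exists z.
Qed.

Lemma goldstein_hypergradient :
  goldstein N (anchored phi y x) delta x (hypergradient phi y delta x).
Proof.
rewrite goldstein_anchored; apply: (conv_hull_limits L0 yL (@compact_eball _ _ x delta)).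
move=> d e e0; have [p [px dp le]] :=
  smoothing_Jac_le L0 yL x delta0 (d_y phi y x) d e0.
(* The sample point already lies in the ball, so it serves as its own nearby point of [K]. *)
exists p, p; split => //; first by rewrite subrr enorm0 ltW.
by rewrite /hypergradient addrAC subrr add0r (smoothing_extension_Jac).2.
Qed.

Lemma goldstein_jac : goldstein N (anchored phi y x) delta x =
  [set d_x phi y x + w | w in conv_hull (\bigcup_(s in eball x delta)
     [set d_y phi y x *m V | V in clarke_jac N y s])].
Proof.
pose mul := (fun V : 'M[R]_(m, n) => d_y phi y x *m V).
have hullM (A : set 'M[R]_(m, n)) : [set d_y phi y x *m V | V in conv_hull A] =
    conv_hull [set d_y phi y x *m V | V in A].
  have := conv_hull_affine (mulmx (d_y phi y x) : {linear 'M[R]_(m, n) -> 'rV[R]_n}) 0 A.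
  rewrite (_ : [set 0 + _ | a in A] = [set d_y phi y x *m V | V in A]); last first.
    by apply: eq_imagel => V _; rewrite add0r.
  by move=> ->; apply: eq_imagel => V _; rewrite add0r.
rewrite (@eq_bigcupr _ _ _ _ (fun s => conv_hull
  [set d_y phi y x *m V | V in limit_set [set p | differentiable yt p] (Jac yt) s])); last first.
  by move=> s sx; rewrite clarke_jac_extension.
rewrite conv_hull_bigcup goldstein_anchored.
rewrite -(conv_hull_affine (idfun : {linear 'rV[R]_n -> 'rV[R]_n})).
congr conv_hull; apply/seteqP; split.
  by move=> _ [V [s sx sV] <-]; exists (d_y phi y x *m V) => //; exists s => //; exists V.
by move=> _ [_ [s sx [V sV <-]] <-]; exists V => //; exists s.
Qed.

End local_model.

(** McShane's formula extends each coordinate separately, which is why the Lipschitz bound on the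
    extension is coordinatewise throughout. *)
Lemma lipschitz_extension {R : realType} n m (N : set 'rV[R]_n)
    (y : 'rV[R]_n -> 'rV[R]_m) x delta :
  open N -> locally_lipschitz N y -> 0 < delta -> eball x delta `<=` N ->
  exists eta L (yt : 'rV[R]_n -> 'rV[R]_m), [/\ 0 < eta, 0 <= L,
    forall j u v, `|yt u 0 j - yt v 0 j| <= L * enorm (u - v),
    eball x (delta + eta) `<=` N &
    forall u, eball x (delta + eta) u -> yt u = y u].
Proof.
move=> oN yloc d0 xN; have [eta e0 eN] := eball_sub_open oN xN.
have [L L0 yL] := locally_lipschitz_compact oN yloc (@compact_eball _ _ x (delta + eta)) eN.
have K0 : eball x (delta + eta) !=set0.
  by exists x; rewrite /eball/= subrr enorm0 addr_ge0// ltW.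
have /choice[g gP] : forall j, exists g : 'rV[R]_n -> R,
    (forall u v, `|g u - g v| <= L * enorm (u - v)) /\
    forall u, eball x (delta + eta) u -> g u = y u 0 j.
  move=> j; apply: mcshane => // u v Ku Kv.
  apply: le_trans (yL u v Ku Kv); have := normr_coord_le_enorm (y u - y v) j.
  by rewrite !mxE.
exists eta, L, (fun u => \row_j g j u); split => // [j u v|u Ku].
  by rewrite !mxE; exact: (gP j).1.
by apply/rowP => j; rewrite mxE; exact: (gP j).2.
Qed.

Lemma eball_sub_enlarge {R : realType} n (X : set 'rV[R]_n) x r s :
  X x -> 0 < r -> r <= s -> eball x r `<=` enlarge X s.
Proof.
move=> Xx r0 rs u ux; have s0 := lt_le_trans r0 rs.
exists x => //; exists (s^-1 *: (u - x)); last first.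
  by rewrite scalerA divff ?gt_eqF// scale1r addrC subrK.
rewrite /eball/= subr0 enormZ gtr0_norm ?invr_gt0// mulrC ler_pdivrMr// mul1r.
exact: le_trans ux rs.
Qed.

Theorem proposition2 (R : realType) (n m : nat)
  (X N : set 'rV[R]_n) (Y : set 'rV[R]_m)
  (g : 'rV[R]_n -> 'rV[R]_m -> R) (y : 'rV[R]_n -> 'rV[R]_m)
  (deltabar Ymax Ly : R)
  (phi : 'rV[R]_n * 'rV[R]_m -> R)
  (W : set ('rV[R]_n * 'rV[R]_m)) (L1x L1y L2x L2y My : R)
  (X_neq0 : X !=set0) (X_compact : compact X)
  (N_open : open N) (X_sub_N : X `<=` N)
  (y_sol : forall x, N x -> argmin Y (g x) = [set y x])
  (y_loclip : locally_lipschitz N y)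
  (deltabar_gt0 : 0 < deltabar)
  (Xdelta_sub_N : enlarge X deltabar `<=` N)
  (y_bounded : forall u, enlarge X deltabar u -> enorm (y u) <= Ymax)
  (y_lip : elipschitz Ly (enlarge X deltabar) y)
  (phi_C1 : C1 phi)
  (L1x_gt0 : 0 < L1x) (L1y_gt0 : 0 < L1y)
  (L2x_gt0 : 0 < L2x) (L2y_gt0 : 0 < L2y) (My_gt0 : 0 < My)
  (grad1_lip : forall x z x' z', W (x, z) -> W (x', z') ->
    enorm (grad1 phi x z - grad1 phi x' z')
      <= L1x * enorm (x - x') + L1y * enorm (z - z'))
  (grad2_lip : forall x z x' z', W (x, z) -> W (x', z') ->
    enorm (grad2 phi x z - grad2 phi x' z')
      <= L2x * enorm (x - x') + L2y * enorm (z - z'))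
  (grad2_bounded : forall x z, W (x, z) -> enorm (grad2 phi x z) <= My)
  (W_y : forall x, X x -> W (x, y x))
  (W_ydelta : forall (x : 'rV[R]_n) (delta : R), X x -> 0 < delta <= deltabar ->
    W (x, smoothing y delta x)) :
  forall (x : 'rV[R]_n) (delta : R), X x -> 0 < delta <= deltabar ->
  [/\ clarke_subdiff N (anchored phi y x) x
        = clarke_subdiff N (hyperobjective phi y) x,
      [/\ differentiable (smoothing y delta) x,
          differentiable (anchored_smooth phi y delta x : 'rV[R]_n -> R^o) x
        & hypergradient phi y delta x
            = grad (anchored_smooth phi y delta x) x],
      goldstein N (anchored phi y x) delta x (hypergradient phi y delta x)
    & goldstein N (anchored phi y x) delta x
        = [set d_x phi y x + w | w in
             conv_hull (\bigcup_(s in eball x delta)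
               [set d_y phi y x *m V | V in clarke_jac N y s])]].

Proof.
move=> x delta Xx /andP[delta0 delta_le].
have xN : eball x delta `<=` N.
  by apply: subset_trans Xdelta_sub_N; exact: eball_sub_enlarge.
have [eta [L [yt [eta0 L0 yL KN yE]]]] := lipschitz_extension N_open y_loclip delta0 xN.
have xx : eball x delta x by rewrite /eball/= subrr enorm0 ltW.
split.
- rewrite (clarke_subdiff_anchored eta0 L0 yL KN yE _ xx).
  exact/esym/(clarke_subdiff_hyperobjective delta0 eta0 L0 yL KN yE).
- have [dS _] := smoothing_extension_Jac delta0 eta0 L0 yL yE.
  by have /is_gradP[dA ->] := is_grad_affine (phi (x, y x)) x (y x)
    (d_x phi y x) (d_y phi y x) dS.
- exact: goldstein_hypergradient delta0 eta0 L0 yL KN yE phi.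
- exact: goldstein_jac eta0 L0 yL KN yE phi.
Qed.
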